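(* Let $r\ge 1$, let $({\bm a},{\bm j})=((a_i,j_i))_{i=0}^{r-1}\in\mathcal{P}_{\mathbb{Z}}^r$ and let ${\bm\varepsilon}\in\mathcal{Y}_r({\bm a},{\bm j})$. Then the set $\widehat{\mathcal{B}}_r(({\bm a},{\bm j}),{\bm\varepsilon})$ forms a $k$-basis of the $\mathcal{U}_r$-module $\mathcal{U}_rB^{({\bm\varepsilon})}({\bm a},{\bm j})$.
   Context: **Hyperalgebra.** $k$ is an algebraically closed field of characteristic $p>0$. Let $X,Y,H$ be the standard basis of $\mathfrak{sl}_2(\mathbb{C})$ ($X=E_{12}$, $Y=E_{21}$, $H=E_{11}-E_{22}$). $\mathcal{U}_{\mathbb{Z}}$ is the subring of the universal enveloping algebra of $\mathfrak{sl}_2(\mathbb{C})$ generated by all $X^{(m)}=X^m/m!$ and $Y^{(m)}=Y^m/m!$, $m\ge0$; it contains $\binom{H+c}{m}=\frac{(H+c)(H+c-1)\cdots(H+c-m+1)}{m!}$ for $c\in\mathbb{Z}$, $m\ge 0$. Put $\mathcal{U}=\mathcal{U}_{\mathbb{Z}}\otimes_{\mathbb{Z}}k$ (the hyperalgebra of ${\rm SL}_2$), with the same symbols for images in $\mathcal{U}$; it has $k$-basis $Y^{(m)}\binom{H}{n}X^{(m')}$, $m,n,m'\ge0$. For $r\ge1$, $\mathcal{U}_r$ is the subalgebra of $\mathcal{U}$ generated by $X^{(n)},Y^{(n)}$ with $0\le n\le p^r-1$. Modules are finite-dimensional left modules. **Elements $B^{(\varepsilon)}(a,j)$.** For $a\in\mathbb{Z}$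 put $\mu_a=\binom{H-a-1}{p-1}\in\mathcal{U}_1$ (depends only on $a$ mod $p$). Regard $\mathbb{F}_2=\{0,1\}$. If $p$ is odd: $\mathcal{S}=\{0,1,\dots,(p-1)/2\}$, $\mathcal{P}_{\mathbb{Z}}=\mathbb{Z}\times\mathcal{S}$; in $\mathbb{F}_p[x]$ put $\psi_0^{(0)}(x)=\psi_0^{(1)}(x)=\prod_{i\in\mathcal{S}\setminus\{0\}}(x-i^2)^2$ and, for $s\in\mathcal{S}\setminus\{0\}$, $\psi_s^{(0)}(x)=2x(x+s^2)\prod_{i\in\mathcal{S}\setminus\{0,s\}}(x-i^2)^2$, $\psi_s^{(1)}(x)=x(x-s^2)\prod_{i\in\mathcal{S}\setminus\{0,s\}}(x-i^2)^2$ (integers read mod $p$); and $B^{(\varepsilon)}(a,j)=\psi_j^{(\varepsilon)}\left(\mu_aYX+\left(\frac{a+1}{2}\right)^2\right)\cdot\mu_a$ for $\varepsilon\in\mathbb{F}_2$, $(a,j)\in\mathcal{P}_{\mathbb{Z}}$. If $p=2$: $\mathcal{P}_{\mathbb{Z}}=\{(2i,\frac12),(1+2i,0),(1+2i,1)\mid i\in\mathbb{Z}\}$ and $B^{(0)}(2i,\frac12)=\mu_0$, $B^{(1)}(2i,\frac12)=\mu_0YX$, $B^{(0)}(1+2i,0)=B^{(1)}(1+2i,0)=\mu_1YX$, $B^{(0)}(1+2i,1)=B^{(1)}(1+2i,1)=\mu_1YX+\mu_1$. **Conditions on $(a,j)\in\mathcal{P}_{\mathbb{Z}}$.** Let $\widehat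 a\in\{0,\dots,p-1\}$, $\widehat a\equiv a$ mod $p$. (A): $\widehat a$ even and $(p-\widehat a+1)/2\le j\le(p-1)/2$. (B): $\widehat a$ even and $0\le j\le(p-\widehat a-1)/2$. (C): $\widehat a$ odd and $0\le j\le(\widehat a-1)/2$. (D): $\widehat a$ odd and $(\widehat a+1)/2\le j\le(p-1)/2$. For $p=2$, by convention $(2i,\frac12),(1+2i,0),(1+2i,1)$ satisfy (B),(C),(D) respectively. (E): $j=0$ if $p$ is odd, $a$ odd if $p=2$. **Integers $n^{(\varepsilon)}(a,j),\widetilde n^{(\varepsilon)}(a,j)$** (the quadruple $(n^{(0)},n^{(1)},\widetilde n^{(0)},\widetilde n^{(1)})$ at $(a,j)$): (A): $\left(\frac{p-\widehat a-1}{2}+j,\ \frac{3p-\widehat a-1}{2}-j,\ \frac{-p+\widehat a-1}{2}+j,\ \frac{p+\widehat a-1}{2}-j\right)$; (B): $\left(\frac{p-\widehat a-1}{2}-j,\ \frac{p-\widehat a-1}{2}+j,\ \frac{p+\widehat a-1}{2}-j,\ \frac{p+\widehat a-1}{2}+j\right)$; (C): $\left(\frac{2p-\widehat a-1}{2}-j,\ \frac{2p-\widehat a-1}{2}+j,\ \frac{\widehat a-1}{2}-j,\ \frac{\widehat a-1}{2}+j\right)$; (D): $\left(j-\frac{\widehat a+1}{2},\ \frac{2p-\widehat a-1}{2}-j,\ \frac{\widehat a-1}{2}+j,\ \frac{2p+\widehat a-1}{2}-j\right)$. It is known that $B^{(\varepsilon)}(a,j)=\mu_a\sum_{m=n^{(\varepsilon)}(a,j)}^{p-1}c_m^{(\varepsilon)}(a,j)Y^mX^m$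 for (unique) $c_m^{(\varepsilon)}(a,j)\in\mathbb{F}_p$. **Maps $Z^{(\varepsilon)}$ and elements $B^{({\bm\varepsilon})}({\bm a},{\bm j})$.** ${\rm Fr}':\mathcal{U}\to\mathcal{U}$ is the $k$-linear map with $Y^{(m)}\binom{H}{n}X^{(m')}\mapsto Y^{(mp)}\binom{H}{np}X^{(m'p)}$. If $(a,j)$ satisfies (A) or (C), let $s(a,j)=(p-\widehat a+1)/2$ if $p$ is odd and $\widehat a$ even, $s(a,j)=(p-\widehat a)/2$ if $p$ and $\widehat a$ are odd, $s(a,j)=1$ if $p=2$. For $z\in\mathcal{U}$: $Z^{(\varepsilon)}(z;(a,j))=\mu_a\sum_{m=n^{(\varepsilon)}(a,j)}^{p-1}c_m^{(\varepsilon)}(a,j)Y^mX^{m-s(a,j)}{\rm Fr}'(z)X^{s(a,j)}$ in cases (A),(C), and $Z^{(\varepsilon)}(z;(a,j))={\rm Fr}'(z)B^{(\varepsilon)}(a,j)$ in cases (B),(D). An element of $\mathcal{P}_{\mathbb{Z}}^r$ is written $({\bm a},{\bm j})=((a_i,j_i))_{i=0}^{r-1}$, ${\bm a}=(a_0,\dots,a_{r-1})$, ${\bm j}=(j_0,\dots,j_{r-1})$. For ${\bm\varepsilon}=(\varepsilon_0,\dots,\varepsilon_{r-1})\in\mathbb{F}_2^r$ define inductively $B^{({\bm\varepsilon})}({\bm a},{\bm j})=B^{(\varepsilon_0)}(a_0,j_0)$ if $r=1$, and $B^{({\bm\varepsilon})}({\bm a},{\bm j})=Z^{(\varepsilon_0)}\left(B^{(\varepsilon_1,\dots,\varepsilon_{r-1})}((a_1,\dots,a_{r-1}),(j_1,\dots,j_{r-1}));(a_0,j_0)\right)$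 if $r\ge2$. These lie in $\mathcal{U}_r$. **Elements $B^{({\bm\varepsilon})}(({\bm a},{\bm j});{\bm t})$.** For $i\ge0$, $t\in\mathbb{Z}$: $u^{(i,t)}=(X^{(p^i)})^t$ if $t\ge0$ and $u^{(i,t)}=(Y^{(p^i)})^{-t}$ if $t<0$. For ${\bm t}=(t_0,\dots,t_{r-1})\in\mathbb{Z}^r$: $B^{({\bm\varepsilon})}(({\bm a},{\bm j});{\bm t})=u^{(0,t_0)}u^{(1,t_1)}\cdots u^{(r-1,t_{r-1})}B^{({\bm\varepsilon})}({\bm a},{\bm j})$. **Index sets.** On $\mathbb{F}_2^r$ write ${\bm\varepsilon}\le{\bm\theta}$ if $\varepsilon_i\le\theta_i$ for all $i$ (with $0<1$). $\mathcal{Y}_r({\bm a},{\bm j})=\{{\bm\varepsilon}\in\mathbb{F}_2^r\mid\varepsilon_i=1\text{ whenever }(a_i,j_i)\text{ satisfies (E)}\}$. For ${\bm\varepsilon}\in\mathcal{Y}_r({\bm a},{\bm j})$, $\widehat\Theta_r(({\bm a},{\bm j}),{\bm\varepsilon})$ is the set of pairs $({\bm\theta},{\bm t})\in\mathbb{F}_2^r\times\mathbb{Z}^r$ with ${\bm\varepsilon}\le{\bm\theta}\in\mathcal{Y}_r({\bm a},{\bm j})$ and $-\widetilde n^{(\theta_i+1)}(a_i,j_i)\le t_i\le n^{(\theta_i+1)}(a_i,j_i)$ for each $i$ (with $\theta_i+1$ computed in $\mathbb{F}_2$), and $\widehat{\mathcal{B}}_r(({\bm a},{\bm j}),{\bm\varepsilon})=\{B^{({\bm\theta})}(({\bm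 a},{\bm j});{\bm t})\mid({\bm\theta},{\bm t})\in\widehat\Theta_r(({\bm a},{\bm j}),{\bm\varepsilon})\}$. *)

(* Defs.v *)
From HB Require Import structures.
From mathcomp Require Import all_boot all_order all_algebra.
From mathcomp Require Import boolp classical_sets.
From mathcomp Require Import complex Rstruct.
From Stdlib Require Rdefinitions.

Set Implicit Arguments.
Unset Strict Implicit.
Unset Printing Implicit Defensive.

Import Order.TTheory GRing.Theory Num.Theory.
Local Open Scope ring_scope.
Local Open Scope classical_set_scope.
Local Open Scope quotient_scope.

Section Presentation.
Variables (K : comNzRingType) (G : Type).

Inductive term :=
  | Gen of G
  | Cst of K
  | Add of term & term
  | Mul of term & term.

Variable rel : term -> term -> Prop.

(* The least K-algebra congruence containing rel. *)
Inductive cong : term -> term -> Prop :=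
  | cong_rel s t : rel s t -> cong s t
  | cong_refl s : cong s s
  | cong_sym s t : cong s t -> cong t s
  | cong_trans s t u : cong s t -> cong t u -> cong s u
  | cong_Add s s' t t' : cong s s' -> cong t t' -> cong (Add s t) (Add s' t')
  | cong_Mul s s' t t' : cong s s' -> cong t t' -> cong (Mul s t) (Mul s' t')
  | cong_addA s t u : cong (Add s (Add t u)) (Add (Add s t) u)
  | cong_addC s t : cong (Add s t) (Add t s)
  | cong_add0 s : cong (Add (Cst 0) s) s
  | cong_mulA s t u : cong (Mul s (Mul t u)) (Mul (Mul s t) u)
  | cong_mul1 s : cong (Mul (Cst 1) s) s
  | cong_mul0 s : cong (Mul (Cst 0) s) (Cst 0)
  | cong_mulDl s t u : cong (Mul (Add s t) u) (Add (Mul s u) (Mul t u))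
  | cong_mulDr s t u : cong (Mul s (Add t u)) (Add (Mul s t) (Mul s u))
  | cong_CstD a b : cong (Cst (a + b)) (Add (Cst a) (Cst b))
  | cong_CstM a b : cong (Cst (a * b)) (Mul (Cst a) (Cst b))
  | cong_CstC a s : cong (Mul (Cst a) s) (Mul s (Cst a)).

HB.instance Definition _ := gen_eqMixin term.
HB.instance Definition _ := gen_choiceMixin term.

Definition congb (s t : term) : bool := `[< cong s t >].

Lemma congb_equiv : equiv_class_of congb.
Proof.
split=> [s|s t|t s u]; first by apply/asboolP/cong_refl.
  by apply/asboolP/asboolP; apply: cong_sym.
by move=> /asboolP st /asboolP tu; apply/asboolP/(cong_trans st tu).
Qed.

Canonical congb_equivRel := EquivRelPack congb_equiv.

Definition presAlg := {eq_quot congb}.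
HB.instance Definition _ := Choice.on presAlg.
HB.instance Definition _ := EqQuotient.on presAlg.

Lemma pres_eq (s t : term) : cong s t -> \pi_presAlg s = \pi_presAlg t.
Proof. by move=> st; apply/eqmodP/asboolP. Qed.

Lemma pres_cong (s t : term) : \pi_presAlg s = \pi_presAlg t -> cong s t.
Proof. by move/eqmodP/asboolP. Qed.

Lemma pres_reprK (s : term) : cong (repr (\pi_presAlg s)) s.
Proof. by apply: pres_cong; rewrite reprK. Qed.

Definition pres_gen (g : G) : presAlg := \pi_presAlg (Gen g).
Definition pres_cst (a : K) : presAlg := \pi_presAlg (Cst a).
Definition pres_add (x y : presAlg) : presAlg := \pi_presAlg (Add (repr x) (repr y)).
Definition pres_mul (x y : presAlg) : presAlg := \pi_presAlg (Mul (repr x) (repr y)).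

Lemma pres_addE s t :
  pres_add (\pi_presAlg s) (\pi_presAlg t) = \pi_presAlg (Add s t).
Proof. by apply: pres_eq; apply: cong_Add; apply: pres_reprK. Qed.

Lemma pres_mulE s t :
  pres_mul (\pi_presAlg s) (\pi_presAlg t) = \pi_presAlg (Mul s t).
Proof. by apply: pres_eq; apply: cong_Mul; apply: pres_reprK. Qed.

Local Notation opp := (pres_mul (pres_cst (-1))).

Lemma pres_addA : associative pres_add.
Proof.
elim/quotW=> s; elim/quotW=> t; elim/quotW=> u.
by rewrite (pres_addE t) (pres_addE s t) !pres_addE; apply/pres_eq/cong_addA.
Qed.

Lemma pres_addC : commutative pres_add.
Proof.
elim/quotW=> s; elim/quotW=> t.
by rewrite !pres_addE; apply/pres_eq/cong_addC.
Qed.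

Lemma pres_add0 : left_id (pres_cst 0) pres_add.
Proof. by elim/quotW=> s; rewrite pres_addE; apply/pres_eq/cong_add0. Qed.

Lemma pres_mulA : associative pres_mul.
Proof.
elim/quotW=> s; elim/quotW=> t; elim/quotW=> u.
by rewrite (pres_mulE t) (pres_mulE s t) !pres_mulE; apply/pres_eq/cong_mulA.
Qed.

Lemma pres_mul1 : left_id (pres_cst 1) pres_mul.
Proof. by elim/quotW=> s; rewrite pres_mulE; apply/pres_eq/cong_mul1. Qed.

Lemma pres_mulDl : left_distributive pres_mul pres_add.
Proof.
elim/quotW=> s; elim/quotW=> t; elim/quotW=> u.
rewrite (pres_addE s) (pres_mulE s) (pres_mulE t) pres_mulE pres_addE.
by apply/pres_eq/cong_mulDl.
Qed.

Lemma pres_mulDr : right_distributive pres_mul pres_add.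
Proof.
elim/quotW=> s; elim/quotW=> t; elim/quotW=> u.
rewrite (pres_addE t) (pres_mulE s t) (pres_mulE s u) pres_mulE pres_addE.
by apply/pres_eq/cong_mulDr.
Qed.

Lemma pres_mul0 x : pres_mul (pres_cst 0) x = pres_cst 0.
Proof. by elim/quotW: x => s; rewrite pres_mulE; apply/pres_eq/cong_mul0. Qed.

Lemma pres_cstD a b : pres_cst (a + b) = pres_add (pres_cst a) (pres_cst b).
Proof. by rewrite pres_addE; apply/pres_eq/cong_CstD. Qed.

Lemma pres_cstM a b : pres_cst (a * b) = pres_mul (pres_cst a) (pres_cst b).
Proof. by rewrite pres_mulE; apply/pres_eq/cong_CstM. Qed.

Lemma pres_cstC a x : pres_mul (pres_cst a) x = pres_mul x (pres_cst a).
Proof. by elim/quotW: x => s; rewrite !pres_mulE; apply/pres_eq/cong_CstC. Qed.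

Lemma pres_mulr1 : right_id (pres_cst 1) pres_mul.
Proof. by move=> x; rewrite -pres_cstC pres_mul1. Qed.

Lemma pres_addN : left_inverse (pres_cst 0) opp pres_add.
Proof.
move=> x; rewrite -[X in pres_add _ X]pres_mul1 -pres_mulDl -pres_cstD addNr.
exact: pres_mul0.
Qed.

HB.instance Definition _ :=
  GRing.isZmodule.Build presAlg pres_addA pres_addC pres_add0 pres_addN.
HB.instance Definition _ := GRing.Zmodule_isPzRing.Build presAlg
  pres_mulA pres_mul1 pres_mulr1 pres_mulDl pres_mulDr.

Definition pres_scale (a : K) (x : presAlg) : presAlg := pres_cst a * x.

Lemma pres_scaleA a b x : pres_scale a (pres_scale b x) = pres_scale (a * b) x.
Proof. by rewrite /pres_scale mulrA; congr (_ * x); rewrite pres_cstM. Qed.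

Lemma pres_scale1 : left_id 1 pres_scale.
Proof. by move=> x; apply: pres_mul1. Qed.

Lemma pres_scaleDr : right_distributive pres_scale +%R.
Proof. by move=> a x y; apply: mulrDr. Qed.

Lemma pres_scaleDl x : {morph pres_scale^~ x : a b / a + b}.
Proof. by move=> a b; rewrite /pres_scale pres_cstD; apply: mulrDl. Qed.

HB.instance Definition _ := GRing.Zmodule_isLmodule.Build K presAlg
  pres_scaleA pres_scale1 pres_scaleDr pres_scaleDl.

Section Lift.
Variables (A : algType K) (f : G -> A).

Fixpoint eval (s : term) : A :=
  match s with
  | Gen g => f g
  | Cst a => a%:A
  | Add s t => eval s + eval t
  | Mul s t => eval s * eval t
  end.

Hypothesis f_rel : forall s t, rel s t -> eval s = eval t.

Lemma eval_cong s t : cong s t -> eval s = eval t.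
Proof.
elim=> //= {s t}.
- by move=> s t u _ -> _ ->.
- by move=> s s' t t' _ -> _ ->.
- by move=> s s' t t' _ -> _ ->.
- by move=> s t u; rewrite addrA.
- by move=> s t; rewrite addrC.
- by move=> s; rewrite scale0r add0r.
- by move=> s t u; rewrite mulrA.
- by move=> s; rewrite scale1r mul1r.
- by move=> s; rewrite scale0r mul0r.
- by move=> s t u; rewrite mulrDl.
- by move=> s t u; rewrite mulrDr.
- by move=> a b; rewrite scalerDl.
- by move=> a b; rewrite -scalerAl mul1r scalerA.
- by move=> a s; rewrite -scalerAl mul1r -scalerAr mulr1.
Qed.

Definition pres_lift (x : presAlg) : A := eval (repr x).

Lemma pres_lift_pi s : pres_lift (\pi_presAlg s) = eval s.
Proof. exact/eval_cong/pres_reprK. Qed.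

Lemma pres_lift_gen g : pres_lift (pres_gen g) = f g.
Proof. exact: pres_lift_pi. Qed.

Lemma pres_lift1 : pres_lift 1 = 1.
Proof. by rewrite pres_lift_pi /= scale1r. Qed.

Lemma pres_liftD : {morph pres_lift : x y / x + y}.
Proof. by move=> x y; rewrite pres_lift_pi. Qed.

Lemma pres_liftM : {morph pres_lift : x y / x * y}.
Proof. by move=> x y; rewrite pres_lift_pi. Qed.

Lemma pres_liftZ a : {morph pres_lift : x / a *: x}.
Proof.
move=> x; rewrite [LHS]pres_liftM pres_lift_pi /=.
by rewrite -scalerAl mul1r.
Qed.

Lemma pres_liftN : {morph pres_lift : x / - x}.
Proof. by move=> x; rewrite -scaleN1r pres_liftZ scaleN1r. Qed.

Lemma pres_nontrivial : 1 != 0 :> presAlg.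
Proof.
apply/eqP => /(congr1 pres_lift); rewrite pres_lift1 pres_lift_pi /= scale0r.
exact/eqP/oner_neq0.
Qed.

End Lift.

Lemma pres_scaleAl a (x y : presAlg) : a *: (x * y) = a *: x * y.
Proof. exact: mulrA. Qed.

Lemma pres_scaleAr a (x y : presAlg) : a *: (x * y) = x * (a *: y).
Proof.
rewrite [LHS]mulrA [RHS]mulrA; congr (_ * y); exact: pres_cstC.
Qed.

End Presentation.

(* The enveloping algebra of a Lie algebra (L, br). *)
Inductive env_rel (K : comNzRingType) (L : lmodType K) (br : L -> L -> L) :
    term K L -> term K L -> Prop :=
  | env_rel_lin a x y :
      env_rel br (Gen K (a *: x + y)) (Add (Mul (Cst L a) (Gen K x)) (Gen K y))
  | env_rel_br x y :
      env_rel br (Mul (Gen K x) (Gen K y))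
                 (Add (Mul (Gen K y) (Gen K x)) (Gen K (br x y))).

(* The base change A (x)_Z K of a ring A: the generator (u, c) is the pure
   tensor u (x) c. *)
Inductive tens_rel (A : nzRingType) (K : comNzRingType) :
    term K (A * K) -> term K (A * K) -> Prop :=
  | tens_rel_addl u v c :
      tens_rel (Gen K (u + v, c)) (Add (Gen K (u, c)) (Gen K (v, c)))
  | tens_rel_addr u c d :
      tens_rel (Gen K (u, c + d)) (Add (Gen K (u, c)) (Gen K (u, d)))
  | tens_rel_scale u c d :
      tens_rel (Gen K (u, d * c)) (Mul (Cst (A * K) d) (Gen K (u, c)))
  | tens_rel_mul u v c d :
      tens_rel (Gen K (u * v, c * d)) (Mul (Gen K (u, c)) (Gen K (v, d)))
  | tens_rel_one : tens_rel (Gen K (1, 1)) (Cst (A * K) 1).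

Notation CC := (complex Rdefinitions.R).

Definition sl2_pred : {pred 'M[CC]_2} := fun A => \tr A == 0.

Lemma sl2_submod_closed : submod_closed sl2_pred.
Proof.
split=> [|a A B]; rewrite !unfold_in ?mxtrace0 // => /eqP trA /eqP trB.
by rewrite mxtraceD mxtraceZ trA trB mulr0 addr0.
Qed.

HB.instance Definition _ :=
  GRing.isSubmodClosed.Build CC 'M[CC]_2 sl2_pred sl2_submod_closed.

Record sl2 := SL2 { sl2_val :> 'M[CC]_2; _ : sl2_val \in sl2_pred }.
HB.instance Definition _ := [isSub for sl2_val].
HB.instance Definition _ := [Choice of sl2 by <:].
HB.instance Definition _ := [SubChoice_isSubLmodule of sl2 by <:].

Lemma sl2_bracket_subproof (A B : 'M[CC]_2) :
  A *m B - B *m A \in sl2_pred.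
Proof. by rewrite unfold_in raddfB /= mxtrace_mulC subrr. Qed.

Definition sl2_bracket (A B : sl2) : sl2 := SL2 (sl2_bracket_subproof A B).

Lemma sl2_X_subproof : delta_mx 0 1 \in sl2_pred.
Proof.
by rewrite unfold_in /mxtrace big_ord_recl big_ord1 !mxE /= addr0.
Qed.

Lemma sl2_Y_subproof : delta_mx 1 0 \in sl2_pred.
Proof.
by rewrite unfold_in /mxtrace big_ord_recl big_ord1 !mxE /= addr0.
Qed.

Lemma sl2_H_subproof : delta_mx 0 0 - delta_mx 1 1 \in sl2_pred.
Proof.
by rewrite unfold_in /mxtrace big_ord_recl big_ord1 !mxE /= subr0 sub0r subrr.
Qed.

Definition Usl2 : Type := presAlg (env_rel sl2_bracket).
HB.instance Definition _ := GRing.PzRing.on Usl2.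
HB.instance Definition _ := GRing.Lmodule.on Usl2.

Definition counit_gen (x : sl2) : CC^o := 0.

Lemma counit_gen_rel s t : env_rel sl2_bracket s t ->
  eval counit_gen s = eval counit_gen t.
Proof. by case=> *; rewrite /= /counit_gen ?mulr0 ?mul0r ?addr0. Qed.

HB.instance Definition _ := GRing.PzSemiRing_isNonZero.Build Usl2
  (pres_nontrivial counit_gen_rel).
HB.instance Definition _ := GRing.Lmodule_isLalgebra.Build CC Usl2
  (@pres_scaleAl _ _ (env_rel sl2_bracket)).
HB.instance Definition _ := GRing.Lalgebra_isAlgebra.Build CC Usl2
  (@pres_scaleAr _ _ (env_rel sl2_bracket)).

Definition eX : Usl2 := pres_gen (env_rel sl2_bracket) (SL2 sl2_X_subproof).
Definition eY : Usl2 := pres_gen (env_rel sl2_bracket) (SL2 sl2_Y_subproof).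
Definition eH : Usl2 := pres_gen (env_rel sl2_bracket) (SL2 sl2_H_subproof).

Definition divpow (x : Usl2) (m : nat) : Usl2 := (m`!%:R : CC)^-1 *: x ^+ m.

Definition binH (c : int) (m : nat) : Usl2 :=
  (m`!%:R : CC)^-1 *: \prod_(i < m) (eH + (c - i%:Z)%:~R).

Inductive inUZ : Usl2 -> Prop :=
  | inUZ_X m : inUZ (divpow eX m)
  | inUZ_Y m : inUZ (divpow eY m)
  | inUZ_1 : inUZ 1
  | inUZ_B x y : inUZ x -> inUZ y -> inUZ (x - y)
  | inUZ_M x y : inUZ x -> inUZ y -> inUZ (x * y).

Definition UZ_pred : {pred Usl2} := fun x => `[< inUZ x >].

Lemma UZ_subring_closed : subring_closed UZ_pred.
Proof.
split=> [|x y|x y]; rewrite !unfold_in; first exact/asboolP/inUZ_1.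
  by move=> /asboolP ux /asboolP uy; apply/asboolP/inUZ_B.
by move=> /asboolP ux /asboolP uy; apply/asboolP/inUZ_M.
Qed.

HB.instance Definition _ :=
  GRing.isSubringClosed.Build Usl2 UZ_pred UZ_subring_closed.

Record UZ := MkUZ { UZ_val :> Usl2; _ : UZ_val \in UZ_pred }.
HB.instance Definition _ := [isSub for UZ_val].
HB.instance Definition _ := [Choice of UZ by <:].
HB.instance Definition _ := [SubChoice_isSubNzRing of UZ by <:].

Lemma counit_int (x : Usl2) : inUZ x ->
  exists z : int, pres_lift counit_gen x = z%:~R :> CC.
Proof.
have divpow_int y m : pres_lift counit_gen y = 0 ->
    exists z : int, pres_lift counit_gen (divpow y m) = z%:~R :> CC.
  move=> y0; rewrite /divpow (pres_liftZ counit_gen_rel).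
  case: m => [|m].
    by exists 1; rewrite expr0 (pres_lift1 counit_gen_rel) invr1 scale1r.
  exists 0; rewrite exprS (pres_liftM counit_gen_rel) y0 mul0r.
  by rewrite scaler0.
have gen0 g :
    pres_lift counit_gen (pres_gen (env_rel sl2_bracket) g) = 0.
  exact: (pres_lift_gen counit_gen_rel).
elim=> {x} [m|m||x y _ [a xa] _ [b yb]|x y _ [a xa] _ [b yb]].
- exact/divpow_int/gen0.
- exact/divpow_int/gen0.
- by exists 1; rewrite (pres_lift1 counit_gen_rel).
- exists (a - b); rewrite (pres_liftD counit_gen_rel).
  by rewrite (pres_liftN counit_gen_rel) xa yb rmorphB.
- by exists (a * b); rewrite (pres_liftM counit_gen_rel) xa yb rmorphM.
Qed.

Lemma UZ_inUZ (u : UZ) : inUZ u.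
Proof. by apply/asboolP; have := valP u; rewrite unfold_in. Qed.

Definition counitZ (u : UZ) : int := projT1 (cid (counit_int (UZ_inUZ u))).

Lemma counitZE (u : UZ) : (counitZ u)%:~R = pres_lift counit_gen (u : Usl2).
Proof. by rewrite -(projT2 (cid (counit_int (UZ_inUZ u)))). Qed.

Section Hyperalgebra.
Variable k : fieldType.

Definition hyper : Type := presAlg (@tens_rel UZ k).
HB.instance Definition _ := GRing.PzRing.on hyper.
HB.instance Definition _ := GRing.Lmodule.on hyper.

Definition hyper_counit_gen (uc : UZ * k) : k^o := (counitZ uc.1)%:~R * uc.2.

Lemma hyper_counit_gen_rel s t : tens_rel s t ->
  eval hyper_counit_gen s = eval hyper_counit_gen t.
Proof.
have counitZD u v : counitZ (u + v) = counitZ u + counitZ v.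
  apply/eqP; rewrite -(eqr_int CC) rmorphD /= !counitZE.
  by rewrite -(pres_liftD counit_gen_rel).
have counitZM u v : counitZ (u * v) = counitZ u * counitZ v.
  apply/eqP; rewrite -(eqr_int CC) rmorphM /= !counitZE.
  by rewrite -(pres_liftM counit_gen_rel).
have counitZ1 : counitZ 1 = 1.
  apply/eqP; rewrite -(eqr_int CC) counitZE.
  by rewrite (pres_lift1 counit_gen_rel).
case=> [u v c|u c d|u c d|u v c d|]; rewrite /= /hyper_counit_gen /=.
- by rewrite counitZD rmorphD mulrDl.
- by rewrite mulrDr.
- by rewrite -scalerAl mul1r [LHS]mulrCA.
- by rewrite counitZM rmorphM mulrACA.
- by rewrite counitZ1 mulr1 scale1r.
Qed.

HB.instance Definition _ := GRing.PzSemiRing_isNonZero.Build hyper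
  (pres_nontrivial hyper_counit_gen_rel).
HB.instance Definition _ := GRing.Lmodule_isLalgebra.Build k hyper
  (@pres_scaleAl _ _ (@tens_rel UZ k)).
HB.instance Definition _ := GRing.Lalgebra_isAlgebra.Build k hyper
  (@pres_scaleAr _ _ (@tens_rel UZ k)).

(* The image u (x) 1 of u in UZ; the junk value 0 outside UZ is never used,
   since the divided powers and the binH c m all lie in UZ. *)
Definition of_UZ (x : Usl2) : hyper :=
  if insub x is Some u then pres_gen (@tens_rel UZ k) (u, 1) else 0.

Definition hX (m : nat) : hyper := of_UZ (divpow eX m).
Definition hY (m : nat) : hyper := of_UZ (divpow eY m).
Definition hbin (c : int) (m : nat) : hyper := of_UZ (binH c m).

Inductive Ur (p r : nat) : hyper -> Prop :=
  | Ur_X n : (n <= p ^ r - 1)%N -> Ur p r (hX n)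
  | Ur_Y n : (n <= p ^ r - 1)%N -> Ur p r (hY n)
  | Ur_1 : Ur p r 1
  | Ur_D x y : Ur p r x -> Ur p r y -> Ur p r (x + y)
  | Ur_Z c x : Ur p r x -> Ur p r (c *: x)
  | Ur_M x y : Ur p r x -> Ur p r y -> Ur p r (x * y).

End Hyperalgebra.

Arguments Ur k p%_N r%_N _ : clear implicits.

Section Combinatorics.
Variable p : nat.
Implicit Type aj : int * rat.

Definition hat (a : int) : nat := `|(a %% p)%Z|%N.

Definition PZ aj : bool :=
  let: (a, j) := aj in
  if (p == 2)%N then
    if odd (hat a) then (j == 0) || (j == 1) else j == 1 / 2
  else [exists i : 'I_(p./2).+1, j == i%:R].

Definition condA aj : bool :=
  let: (a, j) := aj in
  [&& (p != 2)%N, ~~ odd (hat a), (p%:R - (hat a)%:R + 1) / 2 <= j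
    & j <= (p%:R - 1) / 2].

Definition condB aj : bool :=
  let: (a, j) := aj in
  ~~ odd (hat a) &&
  if (p == 2)%N then j == 1 / 2
  else (0 <= j) && (j <= (p%:R - (hat a)%:R - 1) / 2).

Definition condC aj : bool :=
  let: (a, j) := aj in
  odd (hat a) &&
  if (p == 2)%N then j == 0 else (0 <= j) && (j <= ((hat a)%:R - 1) / 2).

Definition condD aj : bool :=
  let: (a, j) := aj in
  odd (hat a) &&
  if (p == 2)%N then j == 1
  else (((hat a)%:R + 1) / 2 <= j) && (j <= (p%:R - 1) / 2).

Definition condE aj : bool :=
  let: (a, j) := aj in if (p == 2)%N then odd (hat a) else j == 0.

(* Elements of F_2 are encoded as booleans. *)
Definition nn (e : bool) aj : rat :=
  let: (a, j) := aj in
  let h : rat := (hat a)%:R in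
  let P : rat := p%:R in
  if condA aj then
    if e then (3 * P - h - 1) / 2 - j else (P - h - 1) / 2 + j
  else if condB aj then
    if e then (P - h - 1) / 2 + j else (P - h - 1) / 2 - j
  else if condC aj then
    if e then (2 * P - h - 1) / 2 + j else (2 * P - h - 1) / 2 - j
  else
    if e then (2 * P - h - 1) / 2 - j else j - (h + 1) / 2.

Definition ntilde (e : bool) aj : rat :=
  let: (a, j) := aj in
  let h : rat := (hat a)%:R in
  let P : rat := p%:R in
  if condA aj then
    if e then (P + h - 1) / 2 - j else (- P + h - 1) / 2 + j
  else if condB aj then
    if e then (P + h - 1) / 2 + j else (P + h - 1) / 2 - j
  else if condC aj then
    if e then (h - 1) / 2 + j else (h - 1) / 2 - j
  else
    if e then (2 * P + h - 1) / 2 - j else (h - 1) / 2 + j.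

Definition shift aj : nat :=
  if (p == 2)%N then 1%N else if odd (hat aj.1) then (p - hat aj.1)./2
  else (p - hat aj.1 + 1)./2.

Definition psi (e : bool) (s : nat) : {poly 'F_p} :=
  let q (i : nat) : {poly 'F_p} := ('X - ((i ^ 2)%:R)%:P) in
  if s == 0%N then \prod_(1 <= i < (p./2).+1) q i ^+ 2
  else
    let rest := \prod_(1 <= i < (p./2).+1 | i != s) q i ^+ 2 in
    if e then 'X * q s * rest
    else 2 *: ('X * ('X + ((s ^ 2)%:R)%:P) * rest).

Section Tuples.
Variable r : nat.
Implicit Types (ajs : r.-tuple (int * rat)) (e th : r.-tuple bool).

Definition le_F2 e th : bool := [forall i, tnth e i ==> tnth th i].

Definition Yr ajs e : bool := [forall i, condE (tnth ajs i) ==> tnth e i].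

Definition Theta ajs e : set (r.-tuple bool * r.-tuple int) :=
  [set tht | [/\ le_F2 e tht.1, Yr ajs tht.1 & forall i,
     - ntilde (~~ tnth tht.1 i) (tnth ajs i) <= (tnth tht.2 i)%:~R
     /\ (tnth tht.2 i)%:~R <= nn (~~ tnth tht.1 i) (tnth ajs i)]].

End Tuples.
End Combinatorics.

Section Elements.
Variables (k : fieldType) (p : nat).
Local Notation U := (hyper k).
Local Notation X := (hX k 1).
Local Notation Y := (hY k 1).

Definition Fp_emb (x : 'F_p) : k := (x : nat)%:R.

Definition mu (a : int) : U := hbin k (- a - 1) p.-1.

Definition B1 (e : bool) (aj : int * rat) : U :=
  let: (a, j) := aj in
  if (p == 2)%N then
    if ~~ odd (hat p a) then (if e then mu 0 * Y * X else mu 0)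
    else if j == 0 then mu 1 * Y * X else mu 1 * Y * X + mu 1
  else
    horner_alg (mu a * Y * X + ((((a + 1)%:~R / 2) ^+ 2 : k))%:A)
      (map_poly Fp_emb (psi p e (Num.truncn j))) * mu a.

(* The coefficients c_m characterised by
   B1 e (a, j) = mu a * \sum_(n <= m < p) c_m Y^m X^m. *)
Definition Bcoef (e : bool) (aj : int * rat) : nat -> 'F_p :=
  xget (fun=> 0) [set c : nat -> 'F_p |
    B1 e aj = mu aj.1 *
      \sum_(m < p | nn p e aj <= m%:R) Fp_emb (c m) *: (Y ^+ m * X ^+ m)].

Definition Fr' : U -> U :=
  xget (fun=> 0) [set f : U -> U | linear f /\ forall m n m' : nat,
    f (hY k m * hbin k 0 n * hX k m')
    = hY k (m * p) * hbin k 0 (n * p) * hX k (m' * p)].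

Definition Zmap (e : bool) (z : U) (aj : int * rat) : U :=
  if condA p aj || condC p aj then
    mu aj.1 * \sum_(m < p | nn p e aj <= m%:R)
      Fp_emb (Bcoef e aj m) *:
        (Y ^+ m * X ^+ (m - shift p aj) * Fr' z * X ^+ shift p aj)
  else Fr' z * B1 e aj.

Fixpoint Bvec (es : seq bool) (ajs : seq (int * rat)) : U :=
  match es, ajs with
  | [:: e], [:: aj] => B1 e aj
  | e :: es', aj :: ajs' => Zmap e (Bvec es' ajs') aj
  | _, _ => 0
  end.

Definition u_elt (i : nat) (t : int) : U :=
  if 0 <= t then hX k (p ^ i) ^+ `|t|%N else hY k (p ^ i) ^+ `|t|%N.

Section Tuples.
Variable r : nat.

Definition Bt (th : r.-tuple bool) (ajs : r.-tuple (int * rat))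
    (t : r.-tuple int) : U :=
  (\prod_(i < r) u_elt i (tnth t i)) * Bvec th ajs.

Definition Bhat (ajs : r.-tuple (int * rat)) (e : r.-tuple bool) : set U :=
  [set Bt tht.1 ajs tht.2 | tht in Theta p ajs e].

End Tuples.
End Elements.

Arguments Bvec k p%_N es ajs.
Arguments Bhat k p%_N {r} ajs e.

Section Basis.
Variables (k : fieldType) (V : lmodType k).

Definition span_set (S : set V) : set V :=
  [set v | exists (s : seq V) (c : V -> k),
     (forall x, x \in s -> S x) /\ v = \sum_(x <- s) c x *: x].

Definition lin_indep (S : set V) : Prop :=
  forall (s : seq V) (c : V -> k), uniq s -> (forall x, x \in s -> S x) ->
    \sum_(x <- s) c x *: x = 0 -> forall x, x \in s -> c x = 0.

Definition is_basis (M S : set V) : Prop := span_set S = M /\ lin_indep S.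

End Basis.

(* Main.v *)
Require Import Defs.
From HB Require Import structures.
From mathcomp Require Import all_boot all_order all_algebra.
From mathcomp Require Import boolp classical_sets complex Rstruct mxtens.
From mathcomp Require Import zify ring lra.

Set Implicit Arguments.
Unset Strict Implicit.
Unset Printing Implicit Defensive.

Import Order.TTheory GRing.Theory Num.Theory.
Local Open Scope ring_scope.

(** The argument treats one p-adic digit at a time. On the summand cut out by [mu a] everything is
    governed by the operator [YX]. With [gam a i = i (a + i + 1)], the element [mu_a Y^m X^m] is the
    product of the [YX - gam a i] for [i < m], applied to [mu_a], and for [m = p] it vanishes. Write
    [n], [nt] for the integers n^(0), n~^(0) of a pair (a,j). Then n^(1) is [N = p-1-nt], n~^(1) is
    [Nt = p-1-n], and among the indices 0, ..., p-1 the value g = [gam a n] is taken exactly at [n]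
    and [N]. The polynomial in [YX] that defines B^(1) is the full product with one factor [YX - g]
    removed. The one that defines B^(0) has both removed and carries a cofactor that does not vanish
    at g ([psi_spec], [exists_datum]). So B^(1) is an eigenvector of [YX] and B^(0) a generalized
    one: (YX - g) B^(0) = beta B^(1) with beta nonzero. Condition (E) is the degenerate case
    [n = N], where only B^(1) occurs.

    The same holds for the maps Z^(0), Z^(1) in place of the two elements ([YX_Zm1], [YX_Zm0]).
    These maps intertwine [X^(c)], [Y^(c)] with [X^(cp)], [Y^(cp)] ([XFr_Zm], [YFr_Zm]); the shift
    s(a,j) is what makes this true for X. Moreover Z^(1) is injective ([Zm1_inj]). The 2p admissible
    pairs (theta, t) form two strings of length p, and suitable powers of X and Y isolate their
    members one after the other ([chain_free]). If W is a space stable under the divided powers of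
    degree below M, then the elements u^(0,t) Z^(theta)(w) with w in W span a space stable under
    those of degree below Mp ([spanM_hX], [spanM_hY]). These facts are packed into [layerP], and
    induction over the digits gives [list_basis]: independence, stability under the generators of
    U_r, and membership of every vector in U_r B.

    The foundation is the PBW theorem for the hyperalgebra, which is given here by a presentation.
    Spanning follows from Kostant's straightening formula, and independence from the action on
    twisted tensor products of two Weyl modules ([pbw_free]). The Cartan part is treated as an
    algebra of functions from integers to [k], so that Lucas' theorem describes both Fr'
    (composition with the floor of x/p) and [mu_a] (the indicator of a residue class). *)

Definition binz (x : int) (n : nat) : int :=
  match x with
  | Posz m => 'C(m, n)%:Z
  | Negz m => (-1) ^+ n * 'C(m + n, n)%:Z
  end.

Lemma binz0 x : binz x 0 = 1.
Proof. by case: x => m /=; rewrite ?bin0 ?mulr1. Qed.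

Lemma binz_nat m n : binz m%:Z n = 'C(m, n)%:Z.
Proof. by []. Qed.

Lemma binzS x n : binz (x + 1) n.+1 = binz x n.+1 + binz x n.
Proof.
case: x => m.
  by rewrite -PoszD addn1 /= binS PoszD.
case: m => [|m].
  rewrite (_ : Negz 0 + 1 = 0%:Z) // NegzE /= !add0n !binn !mulr1 bin0n /=.
  by rewrite exprS; ring.
rewrite (_ : Negz m.+1 + 1 = Negz m); last by rewrite !NegzE; lia.
rewrite /= addSnnS (addnS m n.+1) binS PoszD (addnS m n) exprS addSn.
by ring.
Qed.

(** Pascal's rule can be solved for the value at [x] as well as at [x + 1], so starting from [x = 0]
    it determines all integers in both directions. This is used for the evaluation of binomial
    polynomials and for Lucas' theorem. *)
Lemma binz_uniq (R : pzRingType) (g : int -> nat -> R) :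
    (forall x, g x 0%N = 1) -> (forall n, g 0 n.+1 = 0) ->
    (forall x n, g (x + 1) n.+1 = g x n.+1 + g x n) ->
  forall x n, g x n = (binz x n)%:~R.
Proof.
move=> g0 g1 gS x n; elim: n x => [|n IHn] x; first by rewrite g0 binz0.
elim: x => [|m IHm|m IHm]; first by rewrite g1.
  by rewrite -addn1 PoszD gS IHm IHn binzS rmorphD.
have eqm : - m.+1%:Z + 1 = - m%:Z by rewrite -addn1 PoszD; lia.
apply: (@addIr _ (g (- m.+1%:Z) n)).
by rewrite -gS eqm IHm IHn -eqm binzS rmorphD.
Qed.

(** * Binomial polynomials and integer-valued polynomials *)

Definition binP (c : int) (n : nat) : {poly CC} :=
  (n`!%:R : CC)^-1 *: \prod_(i < n) ('X + ((c - i%:Z)%:~R)%:P).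

Lemma fact_neq0 n : (n`!%:R : CC) != 0.
Proof. by rewrite pnatr_eq0 -lt0n fact_gt0. Qed.

Lemma binP0 c : binP c 0 = 1.
Proof. by rewrite /binP big_ord0 invr1 scale1r. Qed.

Lemma binPS c n :
  binP c n.+1 = (n.+1%:R : CC)^-1 *: (binP c n * ('X + ((c - n%:Z)%:~R)%:P)).
Proof.
rewrite /binP big_ord_recr /= -scalerAl scalerA; congr (_ *: _).
by rewrite factS natrM invfM.
Qed.

Lemma binP_shift c n : binP c n = binP 0 n \Po ('X + (c%:~R)%:P).
Proof.
elim: n => [|n IHn]; first by rewrite !binP0 comp_polyC.
rewrite !binPS comp_polyZ comp_polyM -IHn comp_polyD comp_polyX comp_polyC.
by congr (_ *: (_ * _)); rewrite sub0r rmorphB rmorphN /= !polyCD !polyCN addrA.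
Qed.

Lemma binPS_eval n x :
  (binP 0 n.+1).[x] = (n.+1%:R)^-1 * ((binP 0 n).[x] * (x - n%:R)).
Proof.
rewrite binPS hornerZ hornerM hornerD hornerX hornerC sub0r.
by rewrite rmorphN.
Qed.

Lemma binP_eval0 (x : int) n : (binP 0 n).[x%:~R] = (binz x n)%:~R.
Proof.
apply: (@binz_uniq _ (fun x n => (binP 0 n).[x%:~R])) => [y|m|y m].
- by rewrite binP0 hornerC.
- rewrite /binP hornerZ horner_prod (bigD1 ord0) //= hornerD hornerX hornerC.
  by rewrite subr0 addr0 mul0r mulr0.
elim: m => [|m IHm].
  rewrite binPS binP0 mul1r invr1 scale1r !hornerE /=.
  by rewrite rmorphD.
rewrite !(binPS_eval m.+1) IHm (binPS_eval m).
rewrite rmorphD /=.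
have m1 : m.+1%:R != 0 :> CC by rewrite pnatr_eq0.
have m2 : m.+2%:R != 0 :> CC by rewrite pnatr_eq0.
set b := (binP 0 m).[_].
move: m1 m2; rewrite -(natr1 m.+1) -(natr1 m) => m1 m2.
by field; rewrite m1 m2.
Qed.

Lemma size_binP c n : (size (binP c n) <= n.+1)%N.
Proof.
elim: n => [|n IHn]; first by rewrite binP0 size_poly1.
rewrite binPS (leq_trans (size_scale_leq _ _)) //.
rewrite (leq_trans (size_polyMleq _ _)) // size_XaddC addn2 /=.
by rewrite ltnS.
Qed.

Lemma binP_eval c (x : int) n : (binP c n).[x%:~R] = (binz (x + c) n)%:~R.
Proof.
by rewrite binP_shift horner_comp hornerD hornerX hornerC -rmorphD binP_eval0.
Qed.

Lemma poly_nat_eq (f g : {poly CC}) :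
  (forall m : nat, f.[m%:R] = g.[m%:R]) -> f = g.
Proof.
move=> fg; apply/eqP; rewrite -subr_eq0; apply/eqP.
apply: (@roots_geq_poly_eq0 _ _ [seq (i%:R : CC) | i <- iota 0 (size (f - g))]).
- by apply/allP => _ /mapP [i _ ->]; rewrite /root !hornerE fg subrr.
- by rewrite map_inj_uniq ?iota_uniq // => i j /eqP; rewrite eqr_nat => /eqP.
- by rewrite size_map size_iota.
Qed.

(** Interpolation at 0, 1, 2, ...: the matrix of the ['C(m, i)] is unitriangular, so the
    coefficients are integers, and as many values as the size of [f] determine [f]. *)
Lemma int_valued_binP (f : {poly CC}) :
  (forall m : nat, exists z : int, f.[m%:R] = z%:~R) ->
  exists d : nat -> int, f = \sum_(i < size f) (d i)%:~R *: binP 0 i.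
Proof.
move=> fz.
have pre M : exists d : nat -> int, forall m, (m < M)%N ->
    f.[m%:R] = (\sum_(i < M) (d i)%:~R *: binP 0 i).[m%:R].
  elim: M => [|M [d IHd]]; first by exists (fun=> 0).
  have [z zE] := fz M.
  have evalE (e : nat -> int) (n : nat) (m : nat) :
     (\sum_(i < n) (e i)%:~R *: binP 0 i).[m%:R] =
       (\sum_(i < n) e i * 'C(m, i)%:Z)%:~R :> CC.
    rewrite horner_sum rmorph_sum /=; apply: eq_bigr => i _.
    by rewrite hornerZ -[m%:R]/(m%:Z%:~R) binP_eval0 rmorphM.
  (* The new coefficient corrects the value at [M]; the new binomial vanishes at all smaller points,
     so the earlier interpolation is not disturbed. *)
  pose e i := if (i == M)%N then z - \sum_(i < M) d i * 'C(M, i)%:Z else d i.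
  have eE m : \sum_(i < M) e i * 'C(m, i)%:Z = \sum_(i < M) d i * 'C(m, i)%:Z.
    by apply: eq_bigr => i _; rewrite /e (ltn_eqF (ltn_ord i)).
  exists e => m; rewrite ltnS leq_eqVlt => /predU1P [->|mM].
    rewrite zE evalE big_ord_recr /= eE /e eqxx binn mulr1.
    by congr (_%:~R); ring.
  by rewrite IHd // !evalE big_ord_recr /= eE bin_small // mulr0 addr0.
have [d dE] := pre (size f).
exists d.
pose g := \sum_(i < size f) (d i)%:~R *: binP 0 i.
apply/eqP; rewrite -subr_eq0; apply/eqP.
apply: (@roots_geq_poly_eq0 _ _ [seq (i%:R : CC) | i <- iota 0 (size f)]).
- apply/allP => _ /mapP [i + ->]; rewrite mem_iota /= add0n => iM.
  by rewrite /root hornerD hornerN dE // subrr.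
- by rewrite map_inj_uniq ?iota_uniq // => i j /eqP; rewrite eqr_nat => /eqP.
rewrite size_map size_iota (leq_trans (size_polyD _ _)) // geq_max leqnn /=.
rewrite size_polyN (leq_trans (size_sum _ _ _)) //; apply/bigmax_leqP => i _.
by rewrite (leq_trans (size_scale_leq _ _)) // (leq_trans (size_binP _ _)).
Qed.

(** * Relations of the standard triple in the enveloping algebra *)

Lemma pres_gen_lin (K : comNzRingType) (L : lmodType K) (br : L -> L -> L)
    (a : K) (x y : L) :
  pres_gen (env_rel br) (a *: x + y)
    = a *: pres_gen (env_rel br) x + pres_gen (env_rel br) y.
Proof.
rewrite [RHS]/GRing.add /= [X in pres_add X _]pres_mulE pres_addE.
exact/pres_eq/cong_rel/env_rel_lin.
Qed.

Lemma pres_gen_br (K : comNzRingType) (L : lmodType K) (br : L -> L -> L)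
    (x y : L) :
  pres_gen (env_rel br) x * pres_gen (env_rel br) y
    = pres_gen (env_rel br) y * pres_gen (env_rel br) x
      + pres_gen (env_rel br) (br x y).
Proof.
rewrite [X in _ = X + _]pres_mulE [RHS]pres_addE [LHS]pres_mulE.
exact/pres_eq/cong_rel/env_rel_br.
Qed.

Lemma pres_genZ (K : comNzRingType) (L : lmodType K) (br : L -> L -> L)
    (a : K) (x : L) :
  pres_gen (env_rel br) (a *: x) = a *: pres_gen (env_rel br) x.
Proof.
have g0 : pres_gen (env_rel br) 0 = 0.
  have := pres_gen_lin br 1 0 0; rewrite !scale1r addr0.
  by move/eqP; rewrite addrC -subr_eq subrr => /eqP.
by rewrite -[a *: x]addr0 pres_gen_lin g0 addr0.
Qed.

Lemma sl2_ext (A B : sl2) :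
  (forall i j, sl2_val A i j = sl2_val B i j) -> A = B.
Proof. by move=> AB; apply/val_inj/matrixP. Qed.

Lemma sl2_XY : sl2_bracket (SL2 sl2_X_subproof) (SL2 sl2_Y_subproof)
  = SL2 sl2_H_subproof.
Proof.
by apply: sl2_ext => i j; rewrite /= !mul_delta_mx.
Qed.

Lemma sl2_HX : sl2_bracket (SL2 sl2_H_subproof) (SL2 sl2_X_subproof)
  = 2 *: SL2 sl2_X_subproof.
Proof.
apply: sl2_ext => i j /=; rewrite mulmxBl mulmxBr !mul_delta_mx.
rewrite !mul_delta_mx_0 // subr0 sub0r opprK.
by rewrite !mxE mulr_natl mulr2n.
Qed.

Lemma sl2_HY : sl2_bracket (SL2 sl2_H_subproof) (SL2 sl2_Y_subproof)
  = (- 2) *: SL2 sl2_Y_subproof.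
Proof.
apply: sl2_ext => i j /=; rewrite mulmxBl mulmxBr !mul_delta_mx.
rewrite !mul_delta_mx_0 // subr0 sub0r.
by rewrite !mxE mulNr mulr_natl mulr2n opprD.
Qed.

Lemma eXY : eX * eY = eY * eX + eH.
Proof. by rewrite [LHS]pres_gen_br sl2_XY. Qed.

Lemma eHX : eH * eX = eX * (eH + 2%:A).
Proof.
by rewrite [LHS]pres_gen_br sl2_HX pres_genZ mulrDr -scalerAr mulr1.
Qed.

Lemma eHY : eH * eY = eY * (eH - 2%:A).
Proof.
by rewrite [LHS]pres_gen_br sl2_HY pres_genZ mulrDr scaleNr mulrN -scalerAr mulr1.
Qed.

(** * Kostant's straightening formula for an sl2-triple *)

Section Triple.
Variables (A : algType CC) (eX eY eH : A).
Hypothesis eXY : eX * eY = eY * eX + eH.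
Hypothesis eHX : eH * eX = eX * (eH + 2%:A).
Hypothesis eHY : eH * eY = eY * (eH - 2%:A).

Definition divp (x : A) (n : nat) : A := (n`!%:R : CC)^-1 *: x ^+ n.
Definition pH (f : {poly CC}) : A := horner_alg eH f.

Lemma pHD f g : pH (f + g) = pH f + pH g. Proof. exact: rmorphD. Qed.
Lemma pHM f g : pH (f * g) = pH f * pH g. Proof. exact: rmorphM. Qed.
Lemma pHC a : pH a%:P = a%:A. Proof. exact: horner_algC. Qed.
Lemma pHZ a f : pH (a *: f) = a *: pH f.
Proof. by rewrite -mul_polyC pHM pHC -scalerAl mul1r. Qed.
Lemma pH1 : pH 1 = 1. Proof. exact: rmorph1. Qed.
Lemma pHX : pH 'X = eH. Proof. exact: horner_algX. Qed.
Lemma pH_sum (I : Type) (s : seq I) P F :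
  pH (\sum_(i <- s | P i) F i) = \sum_(i <- s | P i) pH (F i).
Proof. exact: raddf_sum. Qed.

Lemma pH_shift (a : CC) (e : A) : eH * e = e * (eH + a%:A) ->
  forall n f, pH f * e ^+ n = e ^+ n * pH (f \Po ('X + (n%:R * a)%:P)).
Proof.
move=> He; elim=> [|n IHn] f.
  by rewrite mul0r addr0 comp_polyXr !expr0 mul1r mulr1.
have step g : pH g * e = e * pH (g \Po ('X + a%:P)).
  elim/poly_ind: g => [|g c IHg].
    by rewrite comp_poly0 /pH !rmorph0 mul0r mulr0.
  rewrite comp_polyD comp_polyM comp_polyX comp_polyC !pHD !pHM pHD !pHC pHX.
  rewrite mulrDl mulrDr -!mulrA He !mulrA IHg -!mulrA; congr (_ + _).
  by rewrite -scalerAl mul1r -scalerAr mulr1.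
rewrite exprSr mulrA IHn -mulrA step -comp_polyA comp_polyD comp_polyX comp_polyC.
rewrite mulrA; congr (_ * pH (f \Po _)); rewrite -addrA -polyCD.
by rewrite -natr1 mulrDl mul1r [a + _]addrC.
Qed.

Lemma pH_divX f n :
  pH f * divp eX n = divp eX n * pH (f \Po ('X + ((n.*2)%:R)%:P)).
Proof.
rewrite /divp -scalerAr -scalerAl (pH_shift eHX); congr (_ *: (_ * pH (_ \Po (_ + _%:P)))).
by rewrite -natrM muln2.
Qed.

Lemma pH_divY f n :
  pH f * divp eY n = divp eY n * pH (f \Po ('X - ((n.*2)%:R)%:P)).
Proof.
have eHY' : eH * eY = eY * (eH + (- 2)%:A) by rewrite eHY scaleNr.
rewrite /divp -scalerAr -scalerAl (pH_shift eHY'); congr (_ *: (_ * pH (_ \Po (_ + _)))).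
by rewrite mulrN -natrM muln2 polyCN.
Qed.

Lemma divpM x m n : divp x m * divp x n = 'C(m + n, m)%:R *: divp x (m + n).
Proof.
rewrite /divp -scalerAl -scalerAr !scalerA -exprD; congr (_ *: _).
have /(congr1 (fun n => n%:R : CC)) := bin_fact (leq_addr n m).
rewrite addKn !natrM => <-.
have mn : 'C(m + n, m)%:R != 0 :> CC.
  by rewrite pnatr_eq0 -lt0n bin_gt0 leq_addr.
by field; rewrite mn !fact_neq0.
Qed.

Lemma divp0 x : divp x 0 = 1.
Proof. by rewrite /divp invr1 scale1r expr0. Qed.

Lemma divp1 x : divp x 1 = x.
Proof. by rewrite /divp invr1 scale1r expr1. Qed.

Lemma divpS x n : x * divp x n = n.+1%:R *: divp x n.+1.
Proof. by rewrite -{1}[x]divp1 divpM add1n bin1. Qed.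

Lemma eX_divY n : eX * divp eY n.+1
  = divp eY n.+1 * eX + divp eY n * pH ('X - (n%:R)%:P).
Proof.
elim: n => [|n IHn].
  by rewrite divp0 divp1 mul1r subr0 pHX eXY.
have nz : n.+2%:R != 0 :> CC by rewrite pnatr_eq0.
apply: (scalerI nz); rewrite scalerAr -divpS mulrA eXY mulrDl -mulrA IHn.
rewrite mulrDr !mulrA !divpS -pHX pH_divY comp_polyX scalerDr.
rewrite -?scalerAl -?scalerAr -addrA; congr (_ + _).
rewrite !scalerAr -!pHZ -mulrDr -pHD; congr (_ * pH _).
rewrite -!mul_polyC !polyC_natr -!(natr1 n.+1) -!(natr1 n) -addnn natrD -natr1.
by ring.
Qed.

(** Divided powers of negative degree are set to 0, so that the straightening sum can run over a
    range independent of [m] and [n] and its index can be shifted freely. *)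
Let dY (n i : nat) : A := if (i <= n)%N then divp eY (n - i) else 0.
Let dX (m i : nat) : A := if (i <= m)%N then divp eX (m - i) else 0.

Let X_dY n i :
  eX * dY n i = dY n i * eX + dY n i.+1 * pH ('X - ((n%:Z - i.+1%:Z)%:~R)%:P).
Proof.
rewrite /dY; have [lein|ltni] := leqP i n; last first.
  by rewrite ltnNge ltnW // mulr0 !mul0r addr0.
have [ltin|] := ltnP i n; last first.
  move=> leni; have -> : i = n by apply/eqP; rewrite eqn_leq lein.
  by rewrite subnn divp0 mul1r mulr1 mul0r addr0.
rewrite -(subnSK ltin) eX_divY; congr (_ + _ * pH (_ - _%:P)).
by rewrite subzn.
Qed.

Let X_dX m i : (i <= m.+1)%N ->
  eX * dX m i = (m.+1%:R - i%:R : CC) *: dX m.+1 i.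
Proof.
rewrite /dX => lei; rewrite lei; have [leim|ltmi] := leqP i m.
  by rewrite divpS subSn // -natrB ?leqW // subSn.
have -> : i = m.+1 by apply/eqP; rewrite eqn_leq lei.
by rewrite mulr0 subrr scale0r.
Qed.

(** Comparison of the coefficients of index [j + 1] in the induction on [m]. It combines Pascal's
    rule with the ratio of two consecutive binomials. *)
Let coef_rec (m n j : nat) (c := (2 * j)%:Z - m%:Z - n%:Z) :
  (m%:R - j%:R) *: binP c j.+1 + ('X - ((n%:Z - j.+1%:Z)%:~R)%:P) * binP c j
  = m.+1%:R *: binP (c + 1) j.+1.
Proof.
have jz : j.+1%:R != 0 :> CC by rewrite pnatr_eq0.
have pascal : binP (c + 1) j.+1 = binP c j.+1 + binP c j.
  apply: poly_nat_eq => l; rewrite hornerD -[l%:R]/(l%:Z%:~R) !binP_eval.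
  by rewrite addrA binzS rmorphD.
have bS : j.+1%:R *: binP c j.+1 = binP c j * ('X + ((c - j%:Z)%:~R)%:P).
  by rewrite binPS scalerA mulfV // scale1r.
apply: (scalerI jz); rewrite pascal !scalerDr scalerA mulrC -scalerA bS.
rewrite [X in _ = X + _]scalerA [X in _ = X *: _ + _]mulrC -scalerA bS.
rewrite /c !rmorphB /= !pmulrn -!mul_polyC !polyCB !polyC_natr -!(natr1 j).
rewrite -!(natr1 m) natrM.
by ring.
Qed.

(** Multiplying the formula for [m] by X on the left and moving X to the right makes the term of
    index [i] contribute to the indices [i] and [i + 1]; [coef_rec] recombines the two
    contributions. *)
Lemma divX_divY_bound m n M : (m < M)%N ->
  divp eX m * divp eY n =
  \sum_(i < M) dY n i * pH (binP ((2 * i)%:Z - m%:Z - n%:Z) i) * dX m i.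
Proof.
elim: m M => [|m IHm] M.
  case: M => // M _; rewrite big_ord_recl big1 ?addr0 => [|i _].
    by rewrite /dY /dX !subn0 !divp0 binP0 pH1 mul1r !mulr1.
  by rewrite /dX /= mulr0.
move=> ltmM; have mz : m.+1%:R != 0 :> CC by rewrite pnatr_eq0.
apply: (scalerI mz); rewrite scalerAl -divpS -mulrA (IHm M (ltnW ltmM)).
rewrite mulr_sumr scaler_sumr.
(* [G i] is the part in which X is absorbed by a power of Y, raising the index by one; [F i] below
   is the part in which X passes through to the right. *)
pose G i := dY n i.+1 * pH (('X - ((n%:Z - i.+1%:Z)%:~R)%:P) *
               binP ((2 * i)%:Z - m%:Z - n%:Z) i) * dX m.+1 i.+1.
pose F i := dY n i * pH ((m.+1%:R - i%:R) *:
               binP ((2 * i)%:Z - m%:Z - n%:Z - 2) i) * dX m.+1 i.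
transitivity (\sum_(i < M) (F i + G i)).
  apply: eq_bigr => i _; rewrite !mulrA X_dY mulrDl mulrDl.
  have -> : dX m i = dX m.+1 i.+1 by [].
  rewrite /G pHM !mulrA; congr (_ + _).
  rewrite -[dX m.+1 i.+1]/(dX m i) -[dY n i * eX * _]mulrA.
  have -> : eX * pH (binP ((2 * i)%:Z - m%:Z - n%:Z) i) =
            pH (binP ((2 * i)%:Z - m%:Z - n%:Z - 2) i) * eX.
    rewrite -{1}[eX]divp1 -[in RHS](divp1 eX) pH_divX; congr (_ * pH _).
    apply: poly_nat_eq => l; rewrite horner_comp !hornerD hornerX hornerC.
    rewrite -natrD -[(l + _)%:R]/((l + _)%:Z%:~R) -[l%:R]/(l%:Z%:~R).
    by rewrite !binP_eval; congr ((binz _ _)%:~R); rewrite -[1.*2]/2%N; lia.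
  rewrite /F (pHZ (_ - _)) -!mulrA.
  have [lei|lti] := leqP i m.+1.
    by rewrite X_dX // -!scalerAr -scalerAl -scalerAr.
  by rewrite /dX leqNgt (ltnW lti) leqNgt lti /= !mulr0.
case: M ltmM => // M ltmM; rewrite big_split /=.
rewrite big_ord_recl [X in _ + X]big_ord_recr [RHS]big_ord_recl /= /bump /=.
have -> : G M = 0 by rewrite /G /dX leqNgt ltmM mulr0.
rewrite addr0 -addrA -big_split; congr (_ + _).
  rewrite /F subr0 (pHZ m.+1%:R) !binP0.
  by rewrite -(scalerAr m.+1%:R) -(scalerAl m.+1%:R).
apply: eq_bigr => i _; rewrite -[LHS]/(F (1 + i)%N + G i) /F /G !add1n.
rewrite -mulrDl -mulrDr -pHD (scalerAl m.+1%:R) (scalerAr m.+1%:R).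
rewrite -(pHZ m.+1%:R); congr (_ * pH _ * _).
rewrite -[in LHS](natr1 m) -[in LHS](natr1 i) opprD addrACA subrr addr0.
have -> : (2 * i.+1)%:Z - m%:Z - n%:Z - 2 = (2 * i)%:Z - m%:Z - n%:Z by lia.
by rewrite coef_rec; congr (_ *: binP _ _); lia.
Qed.

Lemma divX_divY m n :
  divp eX m * divp eY n = \sum_(i < m.+1 | (i <= n)%N)
    divp eY (n - i) * pH (binP ((2 * i)%:Z - m%:Z - n%:Z) i) * divp eX (m - i).
Proof.
rewrite (@divX_divY_bound m n m.+1) // [RHS]big_mkcond /=.
apply: eq_bigr => i _; rewrite /dY /dX (leq_ord i).
by case: ifP => //; rewrite !mul0r.
Qed.

End Triple.

(** * Integer-valued polynomials in H lie in the Z-form *)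

Lemma binHE c n : binH c n = pH eH (binP c n).
Proof.
rewrite /binH /binP pHZ; congr (_ *: _).
rewrite /pH rmorph_prod; apply: eq_bigr => i _.
by rewrite -[RHS]/(pH eH _) pHD pHX pHC scaler_int.
Qed.

Lemma divpowE : divpow = @divp Usl2. Proof. by []. Qed.

Lemma inUZ_D x y : inUZ x -> inUZ y -> inUZ (x + y).
Proof.
move=> ux uy; have u0 : inUZ 0 by rewrite -(subrr 1); apply: inUZ_B; apply: inUZ_1.
by rewrite -[y]opprK; apply: inUZ_B => //; rewrite -[- y]sub0r; apply: inUZ_B.
Qed.

Lemma inUZ_0 : inUZ 0.
Proof. by rewrite -(subrr 1); apply: inUZ_B; apply: inUZ_1. Qed.

Lemma inUZ_N x : inUZ x -> inUZ (- x).
Proof. by move=> ux; rewrite -sub0r; apply: inUZ_B => //; apply: inUZ_0. Qed.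

Lemma inUZ_Z (n : int) x : inUZ x -> inUZ ((n%:~R : CC) *: x).
Proof.
have nat_case m : inUZ x -> inUZ ((m%:R : CC) *: x).
  move=> ux; elim: m => [|m IHm]; first by rewrite scale0r; apply: inUZ_0.
  by rewrite -natr1 scalerDl scale1r; apply: inUZ_D.
case: n => n ux; first exact: nat_case.
by rewrite NegzE mulrNz scaleNr; apply: inUZ_N; apply: nat_case.
Qed.

Lemma inUZ_sum (I : Type) (s : seq I) (P : pred I) (F : I -> Usl2) :
  (forall i, P i -> inUZ (F i)) -> inUZ (\sum_(i <- s | P i) F i).
Proof.
by move=> uF; apply: (big_ind inUZ) => //; [apply: inUZ_0|apply: inUZ_D].
Qed.

Lemma binP_int c n (m : nat) : exists z : int, (binP c n).[m%:R] = z%:~R.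
Proof. by exists (binz (m%:Z + c) n); rewrite -[m%:R]/(m%:Z%:~R) binP_eval. Qed.

Lemma inUZ_int_poly N (f : {poly CC}) : (size f <= N)%N ->
  (forall i, (i < N)%N -> inUZ (pH eH (binP 0 i))) ->
  (forall m : nat, exists z : int, f.[m%:R] = z%:~R) -> inUZ (pH eH f).
Proof.
move=> sf uN /int_valued_binP [d ->]; rewrite pH_sum; apply: inUZ_sum => i _.
rewrite pHZ; apply: inUZ_Z; apply: uN; exact: leq_trans (ltn_ord i) sf.
Qed.

(** The last term of the straightened product [X^(n) Y^(n)] is the binomial itself. The other terms
    involve binomials of smaller degree at shifted arguments, which are integer combinations of
    unshifted ones. *)
Lemma inUZ_binP0 n : inUZ (pH eH (binP 0 n)).
Proof.
have [m] := ubnP n; elim: m n => // m IHm n; rewrite ltnS => lenm.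
have := divX_divY eXY eHX eHY n n; rewrite big_mkcond /= big_ord_recr /= leqnn subnn.
rewrite !divp0 mul1r mulr1.
have -> : (2 * n)%:Z - n%:Z - n%:Z = 0 by lia.
move/eqP; rewrite addrC -subr_eq => /eqP <-.
apply: inUZ_B; first by apply: inUZ_M; [apply: inUZ_X | apply: inUZ_Y].
apply: inUZ_sum => i _; case: ifP => _; last exact: inUZ_0.
apply: inUZ_M; last exact: inUZ_X.
apply: inUZ_M; first exact: inUZ_Y.
apply: (@inUZ_int_poly i.+1) => [|j|]; first exact: size_binP.
  by rewrite ltnS => leji; apply/IHm/(leq_trans _ lenm)/(leq_ltn_trans leji).
exact: binP_int.
Qed.

Lemma inUZ_pH (f : {poly CC}) :
  (forall m : nat, exists z : int, f.[m%:R] = z%:~R) -> inUZ (pH eH f).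
Proof. by apply: inUZ_int_poly (leqnn _) _ => i _; apply: inUZ_binP0. Qed.

(** * Base change of the Z-form to [k] *)

Section Base.
Variable k : fieldType.
Local Notation U := (hyper k).
Local Notation gen := (pres_gen (@tens_rel UZ k)).

Lemma of_UZE x : inUZ x -> exists2 u : UZ, val u = x & of_UZ k x = gen (u, 1).
Proof.
move=> ux; have px : x \in UZ_pred by rewrite unfold_in; apply/asboolP.
by exists (MkUZ px) => //; rewrite /of_UZ insubT.
Qed.

Lemma gen_add u v c : gen (u + v, c) = gen (u, c) + gen (v, c).
Proof.
rewrite [RHS]pres_addE; exact/pres_eq/cong_rel/tens_rel_addl.
Qed.

Lemma gen_mul u v c d : gen (u * v, c * d) = gen (u, c) * gen (v, d).
Proof.
rewrite [RHS]pres_mulE; exact/pres_eq/cong_rel/tens_rel_mul.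
Qed.

Lemma gen_scale u c : gen (u, c) = c *: gen (u, 1).
Proof.
rewrite [RHS]pres_mulE -{1}[c]mulr1; exact/pres_eq/cong_rel/tens_rel_scale.
Qed.

Lemma gen_one : gen (1, 1) = 1.
Proof. exact/pres_eq/cong_rel/tens_rel_one. Qed.

Lemma of_UZ_gen (u : UZ) : of_UZ k (val u) = gen (u, 1).
Proof. by rewrite /of_UZ valK. Qed.

Lemma of_UZ_D x y : inUZ x -> inUZ y ->
  of_UZ k (x + y) = of_UZ k x + of_UZ k y.
Proof.
by move=> /of_UZE [u <- ->] /of_UZE [v <- ->]; rewrite -gen_add -of_UZ_gen.
Qed.

Lemma of_UZ_M x y : inUZ x -> inUZ y ->
  of_UZ k (x * y) = of_UZ k x * of_UZ k y.
Proof.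
move=> /of_UZE [u <- ->] /of_UZE [v <- ->].
by rewrite -gen_mul mulr1 -of_UZ_gen.
Qed.

Lemma of_UZ_1 : of_UZ k 1 = 1.
Proof. by rewrite -gen_one -of_UZ_gen. Qed.

Lemma of_UZ_0 : of_UZ k 0 = 0.
Proof.
have := of_UZ_D inUZ_0 inUZ_0; rewrite addr0.
by move/eqP; rewrite addrC -subr_eq subrr => /eqP.
Qed.

Lemma of_UZ_N x : inUZ x -> of_UZ k (- x) = - of_UZ k x.
Proof.
move=> ux; apply/eqP; rewrite -addr_eq0 -of_UZ_D ?addNr ?of_UZ_0 //.
exact: inUZ_N.
Qed.

Lemma of_UZ_sum (I : Type) (s : seq I) (P : pred I) (F : I -> Usl2) :
  (forall i, P i -> inUZ (F i)) ->
  of_UZ k (\sum_(i <- s | P i) F i) = \sum_(i <- s | P i) of_UZ k (F i).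
Proof.
move=> uF; elim: s => [|i s IHs]; first by rewrite !big_nil of_UZ_0.
rewrite !big_cons; case: ifP => // Pi; rewrite of_UZ_D ?IHs //; first exact: uF.
exact: inUZ_sum.
Qed.

Lemma of_UZ_Z (n : int) x : inUZ x ->
  of_UZ k ((n%:~R : CC) *: x) = (n%:~R : k) *: of_UZ k x.
Proof.
have nat_case m : inUZ x -> of_UZ k ((m%:R : CC) *: x) = (m%:R : k) *: of_UZ k x.
  move=> ux; elim: m => [|m IHm]; first by rewrite !scale0r of_UZ_0.
  rewrite -!natr1 !scalerDl !scale1r of_UZ_D ?IHm //.
  exact: (@inUZ_Z m).
case: n => n ux; first exact: nat_case.
rewrite NegzE !mulrNz !scaleNr of_UZ_N ?[in LHS]nat_case //.
exact: (@inUZ_Z n.+1).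
Qed.

Lemma of_UZ_ind (P : U -> Prop) :
    (forall u v, P u -> P v -> P (u + v)) ->
    (forall u v, P u -> P v -> P (u * v)) ->
    (forall c : k, P c%:A) -> (forall x, inUZ x -> P (of_UZ k x)) ->
  forall u, P u.
Proof.
move=> PD PM PC PG.
have PZ c (u : U) : P u -> P (c *: u).
  by move=> Pu; rewrite -[u]mul1r scalerAl; apply: PM.
elim/quotW; elim=> [[u c]|c|s IHs t IHt|s IHs t IHt].
- change (P (gen (u, c))); rewrite gen_scale; apply: PZ.
  by rewrite -of_UZ_gen; apply/PG/UZ_inUZ.
- change (P (pres_cst (@tens_rel UZ k) c : U)).
  by rewrite -[pres_cst _ c](mulr1 (_ : U)); apply: PC.
- by rewrite -pres_addE; apply: PD.
- by rewrite -pres_mulE; apply: PM.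
Qed.

End Base.

(** * Functions spanned by binomial coefficients *)

Section IntegerValued.
Variable k : fieldType.

(** These are the functions through which the span of the binomials in H acts on integral weights.
    For functions, products, translations and the passage to the floor of x/p are transparent. *)
Definition Phi (f : int -> k) : Prop :=
  exists N (c : nat -> k), forall x, f x = \sum_(i < N) c i * (binz x i)%:~R.

(** Evaluation at 0, 1, 2, ... gives a unitriangular system. *)
Lemma binz_free N (c : nat -> k) :
  (forall m : nat, \sum_(i < N) c i * (binz m%:Z i)%:~R = 0) ->
  forall i, (i < N)%N -> c i = 0.
Proof.
move=> c0 i; have [n] := ubnP i; elim: n i => // n IHn i; rewrite ltnS => lein ltiN.
have := c0 i; rewrite (bigD1 (Ordinal ltiN)) //= big1 => [|j nj].
  by rewrite binn mulr1 addr0.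
have [ltji|] := ltnP j i; first by rewrite IHn ?mul0r //; apply: leq_trans lein.
rewrite leq_eqVlt => /predU1P [eij|ltij]; last by rewrite bin_small // mulr0.
by case/eqP: nj; apply/val_inj.
Qed.

Variables (U : lmodType k) (b : nat -> U).

(** The linear extension of [binz x i] going to [b i]. By [binz_free] the value does not depend on
    the chosen expansion ([Phi_eltE]); outside [Phi] it is the default 0. *)
Definition Phi_elt (f : int -> k) : U :=
  xget 0 [set u : U | exists N (c : nat -> k),
    (forall x, f x = \sum_(i < N) c i * (binz x i)%:~R)
    /\ u = \sum_(i < N) c i *: b i]%classic.

Let ext N M (c : nat -> k) (V : zmodType) (g : k -> nat -> V) :
    (forall i, g 0 i = 0) -> (N <= M)%N ->
  \sum_(i < N) g (c i) i = \sum_(i < M) g (if (i < N)%N then c i else 0) i.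
Proof.
move=> g0 NM; rewrite (big_ord_widen M (fun i => g (c i) i)) // [LHS]big_mkcond /=.
by apply: eq_bigr => i _; case: ifP.
Qed.

Lemma Phi_eltE (f : int -> k) N (c : nat -> k) :
  (forall x, f x = \sum_(i < N) c i * (binz x i)%:~R) ->
  Phi_elt f = \sum_(i < N) c i *: b i.
Proof.
move=> fE; rewrite /Phi_elt; case: xgetP => [u -> [N' [c' [fE' ->]]]|]; last first.
  by move/(_ (\sum_(i < N) c i *: b i)); case; exists N, c.
pose M := maxn N N'.
pose e i := (if (i < N')%N then c' i else 0) - (if (i < N)%N then c i else 0).
have e0 i : (i < M)%N -> e i = 0.
  apply: binz_free => m; under eq_bigr do rewrite mulrBl.
  rewrite sumrB.
  rewrite -(@ext N' M c' _ (fun a i => a * (binz m%:Z i)%:~R)) ?leq_maxr //; last first.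
    by move=> i'; rewrite mul0r.
  rewrite -(@ext N M c _ (fun a i => a * (binz m%:Z i)%:~R)) ?leq_maxl //; last first.
    by move=> i'; rewrite mul0r.
  by rewrite -fE -fE' subrr.
rewrite (@ext N' M c' _ (fun a i => a *: b i)) ?leq_maxr //; last first.
  by move=> i; rewrite scale0r.
rewrite (@ext N M c _ (fun a i => a *: b i)) ?leq_maxl //; last first.
  by move=> i; rewrite scale0r.
by apply: eq_bigr => i _; congr (_ *: _); apply/eqP; rewrite -subr_eq0; apply/eqP/e0.
Qed.

Lemma Phi_lin2 (f g : int -> k) (a : k) : Phi f -> Phi g ->
  Phi (fun x => a * f x + g x) /\
  Phi_elt (fun x => a * f x + g x) = a *: Phi_elt f + Phi_elt g.
Proof.
move=> [N [c fE]] [N' [c' gE]]; pose M := maxn N N'.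
pose e i := a * (if (i < N)%N then c i else 0) + (if (i < N')%N then c' i else 0).
have eE (V : lmodType k) (v : nat -> V) :
   a *: (\sum_(i < N) c i *: v i) + \sum_(i < N') c' i *: v i = \sum_(i < M) e i *: v i.
  rewrite (@ext N M c _ (fun a i => a *: v i)) ?leq_maxl //; last first.
    by move=> i; rewrite scale0r.
  rewrite (@ext N' M c' _ (fun a i => a *: v i)) ?leq_maxr //; last first.
    by move=> i; rewrite scale0r.
  rewrite scaler_sumr -big_split; apply: eq_bigr => i _.
  by rewrite /e scalerDl scalerA.
have fgE x : a * f x + g x = \sum_(i < M) e i * (binz x i)%:~R.
  by rewrite -[RHS](eE k^o (fun i => (binz x i)%:~R)) fE gE.
split; first by exists M, e.
by rewrite (Phi_eltE fgE) (Phi_eltE fE) (Phi_eltE gE) eE.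
Qed.

Lemma Phi_ext (f g : int -> k) : f =1 g -> Phi f -> Phi g.
Proof. by move=> /funext ->. Qed.

Lemma Phi_bin0 n : Phi (fun x => (binz x n)%:~R) /\
  Phi_elt (fun x => (binz x n)%:~R) = b n.
Proof.
have E x : (binz x n)%:~R = \sum_(i < n.+1) (i == n :> nat)%:R * (binz x i)%:~R :> k.
  rewrite big_ord_recr /= eqxx mul1r big1 ?add0r // => i _.
  by rewrite ltn_eqF // mul0r.
split; first by exists n.+1, (fun i => (i == n)%:R).
rewrite (Phi_eltE (c := fun i => (i == n)%:R) E) big_ord_recr /= eqxx scale1r.
by rewrite big1 ?add0r // => i _; rewrite ltn_eqF // scale0r.
Qed.

Lemma Phi_ind (P : (int -> k) -> Prop) :
    (forall n, P (fun x => (binz x n)%:~R)) ->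
    P (fun=> 0) ->
    (forall a f g, Phi f -> Phi g -> P f -> P g -> P (fun x => a * f x + g x)) ->
  forall f, Phi f -> P f.
Proof.
move=> Pb P0 PD f [N [c /funext ->]]; elim: N => [|N IHN].
  by rewrite (_ : (fun x => _) = (fun=> 0)) //; apply/funext => x; rewrite big_ord0.
rewrite (_ : (fun x => _) = (fun x => c N * (binz x N)%:~R
    + \sum_(i < N) c i * (binz x i)%:~R)).
  apply: PD => //; first by case: (Phi_bin0 N).
  by exists N, c.
by apply/funext => x; rewrite big_ord_recr addrC.
Qed.

End IntegerValued.

(** The structural arguments on weights, Frobenius and strings see the hyperalgebra only through
    this interface. [E] embeds the function algebra as the Cartan part; the last two fields are the
    two halves of PBW, with a whole function as coefficient of each pair of exponents. *)
Record hyper_axioms (k : fieldType) (U : algType k) (hX hY : nat -> U)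
    (E : (int -> k) -> U) : Prop := HyperAxioms {
  hax_X0 : hX 0%N = 1;
  hax_Y0 : hY 0%N = 1;
  hax_XX : forall m n, hX m * hX n = 'C(m + n, m)%:R *: hX (m + n)%N;
  hax_YY : forall m n, hY m * hY n = 'C(m + n, m)%:R *: hY (m + n)%N;
  hax_Elin : forall f g a, Phi f -> Phi g ->
    E (fun x => a * f x + g x) = a *: E f + E g;
  hax_E1 : E (fun=> 1) = 1;
  hax_EM : forall f g, Phi f -> Phi g -> E (fun x => f x * g x) = E f * E g;
  hax_EX : forall f n, Phi f -> E f * hX n = hX n * E (fun x => f (x + n.*2%:Z));
  hax_EY : forall f n, Phi f -> E f * hY n = hY n * E (fun x => f (x - n.*2%:Z));
  hax_XY : forall m n, hX m * hY n = \sum_(i < m.+1 | (i <= n)%N)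
    hY (n - i)%N * E (fun x => (binz (x + i.*2%:Z - m%:Z - n%:Z) i)%:~R)
      * hX (m - i)%N;
  hax_span : forall u, exists M (f : nat -> nat -> int -> k),
    (forall m l, Phi (f m l)) /\
    u = \sum_(m < M) \sum_(l < M) hY m * E (f m l) * hX l;
  hax_free : forall (s : seq (nat * nat)) (f : nat * nat -> int -> k),
    uniq s -> (forall i, Phi (f i)) ->
    \sum_(i <- s) hY i.1 * E (f i) * hX i.2 = 0 ->
    forall i x, i \in s -> f i x = 0
}.

(** * The Cartan part of the hyperalgebra as an algebra of functions *)

Section Poly.
Variable k : fieldType.
Local Notation U := (hyper k).
Definition hE : (int -> k) -> U := Phi_elt (fun n => hbin k 0 n).

(** Expanding [f] in binomials with integer coefficients carries an identity between polynomials
    over the complex numbers into the hyperalgebra over [k]. *)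
Lemma hE_poly (f : {poly CC}) (g : int -> int) :
    (forall x, f.[x%:~R] = (g x)%:~R) ->
  [/\ inUZ (pH eH f), Phi (fun x => (g x)%:~R : k)
    & of_UZ k (pH eH f) = hE (fun x => (g x)%:~R)].
Proof.
move=> fg; have fz (m : nat) : exists z : int, f.[m%:R] = z%:~R.
  by exists (g m); rewrite -fg.
have [d dE] := int_valued_binP fz.
have gE x : (g x)%:~R = \sum_(i < size f) (d i)%:~R * (binz x i)%:~R :> k.
  under eq_bigr do rewrite -rmorphM /=.
  rewrite -rmorph_sum /=; congr (_%:~R); apply/eqP.
  rewrite -(eqr_int CC) -fg {1}dE horner_sum rmorph_sum /=; apply/eqP.
  by apply: eq_bigr => i _; rewrite hornerZ binP_eval0 rmorphM.
split; first exact: inUZ_pH.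
  by exists (size f), (fun i => (d i)%:~R).
rewrite /hE (Phi_eltE _ (c := fun i => (d i)%:~R) gE) {1}dE pH_sum.
rewrite of_UZ_sum => [|i _]; last by rewrite (pHZ _ (d i)%:~R); apply/inUZ_Z/inUZ_binP0.
apply: eq_bigr => i _; rewrite (pHZ _ (d i)%:~R) of_UZ_Z; last exact: inUZ_binP0.
by rewrite /hbin binHE.
Qed.

Lemma hE_bin (c : int) n :
  Phi (fun x => (binz (x + c) n)%:~R : k) /\
  hbin k c n = hE (fun x => (binz (x + c) n)%:~R).
Proof.
have [|_ ? <-] := @hE_poly (binP c n) (fun x => binz (x + c) n).
  by move=> x; rewrite binP_eval.
by rewrite /hbin binHE.
Qed.

End Poly.

Section PhiClosure.
Variable k : fieldType.
Implicit Types f g : int -> k.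

Lemma Phi_bin (c : int) n : Phi (fun x => (binz (x + c) n)%:~R : k).
Proof. by case: (hE_bin k c n). Qed.

Lemma Phi_lin (a : k) f g : Phi f -> Phi g -> Phi (fun x => a * f x + g x).
Proof. by move=> Pf Pg; case: (@Phi_lin2 k k^o (fun=> 0) f g a Pf Pg). Qed.

Lemma Phi_const (a : k) : Phi (fun=> a).
Proof.
exists 1%N, (fun=> a) => x; rewrite big_ord_recl big_ord0.
by rewrite binz0 mulr1 addr0.
Qed.

Lemma PhiZ a f : Phi f -> Phi (fun x => a * f x).
Proof.
by move=> Pf; apply: Phi_ext (Phi_lin a Pf (Phi_const 0)) => x; rewrite addr0.
Qed.

Lemma Phi_shift (c : int) f : Phi f -> Phi (fun x => f (x + c)).
Proof.
elim/(@Phi_ind k k^o (fun=> 0)): f / => [n||a f g _ _ Pf Pg].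
- exact: Phi_bin.
- exact: Phi_const.
exact: Phi_lin.
Qed.

Lemma PhiM f g : Phi f -> Phi g -> Phi (fun x => f x * g x).
Proof.
move=> Pf Pg; elim/(@Phi_ind k k^o (fun=> 0)): f / Pf => [i||a f h Pf Ph Pfg Phg].
- elim/(@Phi_ind k k^o (fun=> 0)): g / Pg => [j||a g h Pg Ph Pig Pih].
  + have [|_ + _] := @hE_poly k (binP 0 i * binP 0 j) (fun x => binz x i * binz x j).
      by move=> x; rewrite hornerM !binP_eval0 rmorphM.
    by apply: Phi_ext => x; rewrite rmorphM.
  + by apply: Phi_ext (Phi_const 0) => x; rewrite mulr0.
  + by apply: Phi_ext (Phi_lin a Pig Pih) => x; rewrite mulrDr mulrCA.
- by apply: Phi_ext (Phi_const 0) => x; rewrite mul0r.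
- by apply: Phi_ext (Phi_lin a Pfg Phg) => x; rewrite mulrDl mulrA.
Qed.

End PhiClosure.

(** Padding with zero functions brings two PBW expansions to a common range. *)
Lemma box_widen (A : Type) (V W : zmodType) (T : nat -> nat -> (A -> V) -> W)
    M M' (f : nat -> nat -> A -> V) :
  (forall m l, T m l (fun=> 0) = 0) -> (M <= M')%N ->
  \sum_(m < M) \sum_(l < M) T m l (f m l) =
  \sum_(m < M') \sum_(l < M')
    T m l (if (m < M)%N && (l < M)%N then f m l else fun=> 0).
Proof.
move=> T0 leM.
rewrite (big_ord_widen M' (fun m => \sum_(l < M) T m l (f m l))) //.
rewrite big_mkcond /=; apply: eq_bigr => m _; case: ifP => mM; last first.
  by rewrite big1 // => l _; rewrite T0.
rewrite (big_ord_widen M' (fun l => T m l (f m l))) //.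
by rewrite big_mkcond /=; apply: eq_bigr => l _; case: ifP => // _; rewrite T0.
Qed.

(** * Relations in the hyperalgebra and the spanning half of PBW *)

Section Relations.
Variable k : fieldType.
Local Notation U := (hyper k).
Local Notation E := (@hE k).
Local Notation Phi_rec := (@Phi_ind k k^o (fun=> 0)).

Lemma hE_lin f g (a : k) : Phi f -> Phi g ->
  E (fun x => a * f x + g x) = a *: E f + E g.
Proof. by move=> Pf Pg; case: (Phi_lin2 (fun n => hbin k 0 n) a Pf Pg). Qed.

Lemma hE0 : E (fun=> 0) = 0.
Proof.
rewrite /hE (Phi_eltE _ (N := 0) (c := fun=> 0)) ?big_ord0 // => x.
by rewrite big_ord0.
Qed.

Lemma hE_bin0 n : E (fun x => (binz x n)%:~R) = hbin k 0 n.
Proof. by case: (Phi_bin0 (fun n => hbin k 0 n) n). Qed.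

Lemma hE1 : E (fun=> 1) = 1.
Proof.
rewrite (_ : (fun=> 1) = (fun x => (binz x 0)%:~R)); last first.
  by apply/funext => x; rewrite binz0.
by rewrite hE_bin0 /hbin binHE binP0 pH1 of_UZ_1.
Qed.

Lemma hEM f g : Phi f -> Phi g -> E (fun x => f x * g x) = E f * E g.
Proof.
move=> Pf Pg; elim/Phi_rec: f / Pf => [i||a f h Pf Ph Pfg Phg].
- elim/Phi_rec: g / Pg => [j||a g h Pg Ph Pig Pih].
  + have [|_ _] := @hE_poly k (binP 0 i * binP 0 j) (fun x => binz x i * binz x j).
      by move=> x; rewrite hornerM !binP_eval0 rmorphM.
    rewrite pHM of_UZ_M; [|exact: inUZ_binP0..].
    rewrite !hE_bin0 /hbin !binHE => ->; congr E.
    by apply/funext => x; rewrite rmorphM.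
  + rewrite hE0 mulr0 -hE0; congr E.
    by apply/funext => x; rewrite mulr0.
  + have Pi : Phi (fun x => (binz x i)%:~R : k).
      by case: (Phi_bin0 (fun n => hbin k 0 n) i).
    rewrite hE_lin // mulrDr -scalerAr -Pig -Pih -hE_lin; [|exact: PhiM..].
    by congr E; apply/funext => x; rewrite mulrDr mulrCA.
- rewrite hE0 mul0r -hE0; congr E.
  by apply/funext => x; rewrite mul0r.
- rewrite hE_lin // mulrDl -scalerAl -Pfg -Phg -hE_lin; [|exact: PhiM..].
  by congr E; apply/funext => x; rewrite mulrDl mulrA.
Qed.

Lemma inUZ_divX n : inUZ (divp eX n). Proof. exact: inUZ_X. Qed.
Lemma inUZ_divY n : inUZ (divp eY n). Proof. exact: inUZ_Y. Qed.

Lemma inUZ_binP c n : inUZ (pH eH (binP c n)).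
Proof. by apply: inUZ_pH; apply: binP_int. Qed.

Lemma of_UZ_binP c n :
  of_UZ k (pH eH (binP c n)) = E (fun x => (binz (x + c) n)%:~R).
Proof. by case: (hE_bin k c n) => _ <-; rewrite /hbin binHE. Qed.

Lemma hEX f n : Phi f -> E f * hX k n = hX k n * E (fun x => f (x + n.*2%:Z)).
Proof.
elim/Phi_rec: f / => [i||a f g Pf Pg Hf Hg].
- rewrite -of_UZ_binP hE_bin0 /hbin binHE -[hX k n]/(of_UZ k (divp eX n)).
  rewrite -!of_UZ_M; try by [exact: inUZ_binP|exact: inUZ_divX|exact: inUZ_binP0].
  rewrite (pH_divX eHX); congr (of_UZ k (_ * pH _ _)).
  apply: poly_nat_eq => l; rewrite horner_comp hornerD hornerX hornerC -natrD.
  by rewrite -[(l + _)%:R]/((l + _)%:Z%:~R) -[l%:R]/(l%:Z%:~R) !binP_eval addr0 PoszD.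
- by rewrite hE0 mul0r mulr0.
- rewrite !hE_lin //; [|exact: Phi_shift..].
  by rewrite mulrDl mulrDr -scalerAl -scalerAr Hf Hg.
Qed.

Lemma hEY f n : Phi f -> E f * hY k n = hY k n * E (fun x => f (x - n.*2%:Z)).
Proof.
elim/Phi_rec: f / => [i||a f g Pf Pg Hf Hg].
- rewrite -of_UZ_binP hE_bin0 /hbin binHE -[hY k n]/(of_UZ k (divp eY n)).
  rewrite -!of_UZ_M; try by [exact: inUZ_binP|exact: inUZ_divY|exact: inUZ_binP0].
  rewrite (pH_divY eHY); congr (of_UZ k (_ * pH _ _)).
  rewrite (binP_shift (- _)); congr (_ \Po (_ + _)).
  by rewrite rmorphN polyCN.
- by rewrite hE0 mul0r mulr0.
- rewrite !hE_lin //; [|exact: Phi_shift..].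
  by rewrite mulrDl mulrDr -scalerAl -scalerAr Hf Hg.
Qed.

Lemma of_UZ_natZ n x : inUZ x -> of_UZ k ((n%:R : CC) *: x) = (n%:R : k) *: of_UZ k x.
Proof. exact: (@of_UZ_Z k n). Qed.

Lemma hXX m n : hX k m * hX k n = 'C(m + n, m)%:R *: hX k (m + n).
Proof.
rewrite -of_UZ_M; [|exact: inUZ_X..].
by rewrite divpowE divpM of_UZ_natZ //; apply: inUZ_X.
Qed.

Lemma hYY m n : hY k m * hY k n = 'C(m + n, m)%:R *: hY k (m + n).
Proof.
rewrite -of_UZ_M; [|exact: inUZ_Y..].
by rewrite divpowE divpM of_UZ_natZ //; apply: inUZ_Y.
Qed.

Lemma hX0 : hX k 0 = 1.
Proof. by rewrite /hX divpowE divp0 of_UZ_1. Qed.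

Lemma hY0 : hY k 0 = 1.
Proof. by rewrite /hY divpowE divp0 of_UZ_1. Qed.

Lemma hXY m n : hX k m * hY k n = \sum_(i < m.+1 | (i <= n)%N)
    hY k (n - i)%N * E (fun x => (binz (x + i.*2%:Z - m%:Z - n%:Z) i)%:~R)
      * hX k (m - i)%N.
Proof.
rewrite -of_UZ_M; [|exact: inUZ_X|exact: inUZ_Y].
rewrite (divX_divY eXY eHX eHY) of_UZ_sum => [|i _]; last first.
  apply: inUZ_M; last exact: inUZ_X.
  by apply: inUZ_M; [exact: inUZ_Y | exact: inUZ_binP].
apply: eq_bigr => i _; rewrite of_UZ_M; last exact: inUZ_X; last first.
  by apply: inUZ_M; [exact: inUZ_Y | exact: inUZ_binP].
rewrite of_UZ_M; [|exact: inUZ_Y | exact: inUZ_binP].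
congr (_ * _ * _); rewrite of_UZ_binP; congr E.
by apply/funext => x; congr (binz _ _)%:~R; rewrite mul2n; lia.
Qed.

Definition pbw_form (u : U) := exists M (f : nat -> nat -> int -> k),
    (forall m l, Phi (f m l)) /\
    u = \sum_(m < M) \sum_(l < M) hY k m * E (f m l) * hX k l.

Lemma pbw_form_lin (a : k) u v : pbw_form u -> pbw_form v -> pbw_form (a *: u + v).
Proof.
move=> [M [f [Pf ->]]] [N [g [Pg ->]]].
pose T m l h := hY k m * E h * hX k l.
have T0 m l : T m l (fun=> 0) = 0 by rewrite /T hE0 mulr0 mul0r.
rewrite (box_widen f T0 (leq_maxl M N)) (box_widen g T0 (leq_maxr M N)) /T.
set f' := fun m l : nat => if (m < M)%N && (l < M)%N then f m l else fun=> 0.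
set g' := fun m l : nat => if (m < N)%N && (l < N)%N then g m l else fun=> 0.
have Pf' m l : Phi (f' m l) by rewrite /f'; case: ifP => _ //; apply: Phi_const.
have Pg' m l : Phi (g' m l) by rewrite /g'; case: ifP => _ //; apply: Phi_const.
exists (maxn M N), (fun m l x => a * f' m l x + g' m l x); split.
  by move=> m l; apply: Phi_lin.
rewrite scaler_sumr -big_split; apply: eq_bigr => m _ /=.
rewrite scaler_sumr -big_split; apply: eq_bigr => l _ /=.
by rewrite (hE_lin _ (Pf' m l) (Pg' m l)) mulrDr mulrDl -scalerAr -scalerAl.
Qed.

Lemma pbw_form_mono m f l : Phi f -> pbw_form (hY k m * E f * hX k l).
Proof.
move=> Pf; pose M := (maxn m l).+1.
have mM : (m < M)%N by rewrite ltnS leq_maxl.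
have lM : (l < M)%N by rewrite ltnS leq_maxr.
exists M, (fun i j => if (i == m) && (j == l) then f else fun=> 0); split.
  by move=> i j; case: ifP => _ //; apply: Phi_const.
rewrite (bigD1 (Ordinal mM)) //= (bigD1 (Ordinal lM)) //= !eqxx /=.
rewrite big1 => [|j nj]; last first.
  rewrite -val_eqE /= in nj; rewrite (negbTE nj).
  by rewrite hE0 mulr0 mul0r.
rewrite big1 ?addr0 // => i ni; rewrite -val_eqE /= in ni.
by rewrite big1 // => j _; rewrite (negbTE ni) /= hE0 mulr0 mul0r.
Qed.

Lemma pbw_form0 : pbw_form 0.
Proof. by exists 0%N, (fun _ _ _ => 0); split; [move=> *; apply: Phi_const|rewrite big_ord0]. Qed.

Lemma pbw_formZ a u : pbw_form u -> pbw_form (a *: u).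
Proof. by move=> fu; rewrite -[_ *: _]addr0; apply: pbw_form_lin pbw_form0. Qed.

Lemma pbw_formD u v : pbw_form u -> pbw_form v -> pbw_form (u + v).
Proof. by move=> fu fv; rewrite -[u]scale1r; apply: pbw_form_lin. Qed.

Lemma pbw_form_sum (I : Type) (s : seq I) (P : pred I) (F : I -> U) :
  (forall i, P i -> pbw_form (F i)) -> pbw_form (\sum_(i <- s | P i) F i).
Proof.
by move=> fF; apply: big_ind fF; [exact: pbw_form0 | exact: pbw_formD].
Qed.

Lemma pbw_form_lmul (u : U) :
    (forall m f l, Phi f -> pbw_form (u * (hY k m * E f * hX k l))) ->
  forall v, pbw_form v -> pbw_form (u * v).
Proof.
move=> uM v [M [f [Pf ->]]]; rewrite mulr_sumr; apply: pbw_form_sum => m _.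
by rewrite mulr_sumr; apply: pbw_form_sum => l _; apply: uM.
Qed.

Lemma pbw_form_hY n v : pbw_form v -> pbw_form (hY k n * v).
Proof.
apply: pbw_form_lmul => m f l Pf; rewrite !mulrA hYY -!scalerAl.
by apply/pbw_formZ/pbw_form_mono.
Qed.

(** Straighten [X^(n) Y^(m)], then move the remaining [X^(n-i)] to the right through the function,
    which only translates it. *)
Lemma pbw_form_hX n v : pbw_form v -> pbw_form (hX k n * v).
Proof.
apply: pbw_form_lmul => m f l Pf; rewrite !mulrA hXY !mulr_suml.
apply: pbw_form_sum => i _; set g := fun x => _.
have Pg : Phi g.
  by apply: Phi_ext (Phi_bin k (i.*2%:Z - n%:Z - m%:Z) i) => x; rewrite /g !addrA.
rewrite -[_ * E f]mulrA -[hX k (n - i)]mulr1.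
pose f' x := f (x - (n - i).*2%:Z).
have Pf' : Phi f' by exact: Phi_shift.
have -> : f = fun x => f' (x + (n - i).*2%:Z).
  by apply/funext => x; rewrite /f' addrK.
rewrite mulr1 -hEX // !mulrA -[_ * E g * _]mulrA -hEM // -[_ * _ * hX k l]mulrA hXX.
by rewrite -scalerAr; apply/pbw_formZ/pbw_form_mono/PhiM.
Qed.

(** PBW expressions are preserved by left multiplication with the generators; apply this to 1. *)
Lemma pbw_span u : pbw_form u.
Proof.
suff uP v : forall w, pbw_form w -> pbw_form (v * w).
  rewrite -[u]mulr1; apply: uP.
  have -> : 1 = hY k 0 * E (fun=> 1) * hX k 0 by rewrite hY0 hE1 hX0 !mulr1.
  exact/pbw_form_mono/Phi_const.
elim/of_UZ_ind: v => [v v' IH IH'|v v' IH IH'|c|x].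
- by move=> w fw; rewrite mulrDl; apply: pbw_formD; auto.
- by move=> w fw; rewrite -mulrA; auto.
- by move=> w fw; rewrite -scalerAl mul1r; apply: pbw_formZ.
elim=> {x} [m|m||x y ux IHx uy IHy|x y ux IHx uy IHy].
- exact: pbw_form_hX.
- exact: pbw_form_hY.
- by rewrite of_UZ_1 => w; rewrite mul1r.
- move=> w fw; rewrite of_UZ_D ?of_UZ_N //; last exact: inUZ_N.
  rewrite mulrDl mulNr -scaleN1r; apply: pbw_formD; first exact: IHx.
  by apply/pbw_formZ/IHy.
- by move=> w fw; rewrite of_UZ_M // -mulrA; auto.
Qed.

End Relations.

(** * Integral forms of Weyl modules *)

Section SingleWeyl.
Variable a : nat.

(** The divided powers on the lattice of the Weyl module of highest weight [a], in the basis of the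
    [Y^(i) v] with [v] a highest weight vector: index [i] has weight [a - 2i]. *)
Definition wX (n : nat) : 'M[int]_a.+1 :=
  \matrix_(i, j) ((j == i + n :> nat)%N%:R * 'C(a - i, n)%:R).
Definition wY (n : nat) : 'M[int]_a.+1 :=
  \matrix_(i, j) ((i == j + n :> nat)%N%:R * 'C(i, n)%:R).
Definition wH : 'M[int]_a.+1 := \matrix_(i, j) ((i == j)%:R * (a%:Z - i.*2%:Z)).

Lemma sum_ord_eq (V : pzRingType) N m (g : nat -> V) :
  \sum_(l < N) (l == m :> nat)%:R * g l = (m < N)%:R * g m.
Proof.
have [mN|Nm] := ltnP m N.
  rewrite (bigD1 (Ordinal mN)) //= eqxx !mul1r big1 ?addr0 // => l nl.
  by rewrite -val_eqE /= in nl; rewrite (negbTE nl) mul0r.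
rewrite mul0r big1 // => l _; rewrite ltn_eqF ?mul0r //.
exact: leq_trans (ltn_ord l) Nm.
Qed.

Lemma wX0 : wX 0 = 1.
Proof. by apply/matrixP=> i j; rewrite !mxE addn0 bin0 mulr1 eq_sym. Qed.

Lemma wY0 : wY 0 = 1.
Proof. by apply/matrixP=> i j; rewrite !mxE addn0 bin0 mulr1. Qed.

Lemma wXS n : wX 1 * wX n = n.+1%:R *: wX n.+1.
Proof.
apply/matrixP=> i j; rewrite !mxE.
pose g (l : nat) : int := 'C(a - i, 1)%:R * ((j == l + n :> nat)%N%:R * 'C(a - l, n)%:R).
under eq_bigr do rewrite !mxE -mulrA -[_ * (_ * _)]/(_ * g _).
rewrite sum_ord_eq /g; case: (eqVneq (j : nat) (i + n.+1)%N) => [E|nE]; last first.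
  by rewrite addn1 addSnnS (negbTE nE) !(mul0r, mulr0).
rewrite addn1 addSnnS E eqxx !mul1r.
have -> : (i.+1 < a.+1)%N by have := ltn_ord j; rewrite E; lia.
rewrite mul1r -!natrM bin1; congr (_%:R).
by rewrite subnS mul_bin_diag.
Qed.

Lemma wYS n : wY 1 * wY n = n.+1%:R *: wY n.+1.
Proof.
apply/matrixP=> i j; rewrite !mxE.
case: (posnP i) => [i0|ip].
  rewrite big1 => [|l _]; last by rewrite !mxE i0 addn1 /= mul0r.
  by rewrite i0 addnS /= mul0r mulr0.
pose g (l : nat) : int := 'C(i, 1)%:R * ((l == j + n :> nat)%N%:R * 'C(l, n)%:R).
have gE (l : 'I_a.+1) : wY 1 i l * wY n l j = (l == i.-1 :> nat)%:R * g l.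
  rewrite !mxE -mulrA; congr (_%:R * _); apply/eqP/eqP; lia.
under eq_bigr do rewrite gE.
rewrite sum_ord_eq /g prednK // (ltnW (ltn_ord i)) mul1r.
have -> : (i.-1 == j + n)%N = (i == (j + n.+1)%N :> nat) by apply/eqP/eqP; lia.
rewrite mulrCA [RHS]mulrCA; congr (_ * _).
by rewrite -!natrM bin1 mul_bin_diag.
Qed.

Lemma wXY : wX 1 * wY 1 = wY 1 * wX 1 + wH.
Proof.
apply/matrixP=> i j; rewrite !mxE.
pose g (l : nat) : int := 'C(a - i, 1)%:R * ((l == j + 1 :> nat)%N%:R * 'C(l, 1)%:R).
under eq_bigr do rewrite !mxE -mulrA -[_ * (_ * _)]/(_ * g _).
rewrite sum_ord_eq /g !bin1.
case: (posnP i) => [i0|ip].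
  rewrite big1 => [|l _]; last by rewrite !mxE i0 addn1 /= mul0r.
  rewrite add0r -val_eqE /= i0 !add0n addn1 eqSS subn0 subr0.
  case: (eqVneq 0%N j) => _; last by rewrite !(mul0r, mulr0).
  by rewrite !mul1r mulr1 ltnS lt0n; case: eqP => [E|_]; rewrite ?mul1r ?mul0r //; lia.
pose h (l : nat) : int := 'C(i, 1)%:R * ((j == l + 1 :> nat)%N%:R * 'C(a - l, 1)%:R).
have hE (l : 'I_a.+1) : wY 1 i l * wX 1 l j = (l == i.-1 :> nat)%:R * h l.
  rewrite !mxE -mulrA; congr (_%:R * _); apply/eqP/eqP; lia.
under eq_bigr do rewrite hE.
rewrite sum_ord_eq /h !bin1 !addn1 prednK // (ltnW (ltn_ord i)) mul1r.
rewrite eqSS -val_eqE /= [(j == i :> nat)%N]eq_sym.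
case: (eqVneq (i : nat) j) => _; last by rewrite !(mul0r, mulr0).
rewrite !mul1r ltnS.
move: ip (ltn_ord i); move: (nat_of_ord i) => l l0.
rewrite ltnS leq_eqVlt => /predU1P [la|ltla].
  rewrite la ltnn mul0r (_ : (a - a.-1)%N = 1%N); last lia.
  by rewrite mulr1 -addnn PoszD; lia.
rewrite ltla mul1r -addnn PoszD (_ : (a - l.-1)%N = (a - l + 1)%N); last lia.
by rewrite -natrM mulnS natrD natrM natrD; lia.
Qed.

Lemma wHX : wH * wX 1 = wX 1 * (wH + 2%:M).
Proof.
apply/matrixP=> i j; rewrite !mxE (bigD1 i) //= big1 => [|l nl]; last first.
  by rewrite !mxE eq_sym (negbTE nl) !mul0r.
rewrite (bigD1 j) //= [in RHS]big1 => [|l nl]; last first.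
  by rewrite !mxE (negbTE nl) mul0r mulr0n addr0 mulr0.
rewrite !mxE !eqxx mulr1n !mul1r; case: eqP => [->|_]; last by rewrite !mul0r mulr0.
by rewrite !mul1r; lia.
Qed.

Lemma wHY : wH * wY 1 = wY 1 * (wH - 2%:M).
Proof.
apply/matrixP=> i j; rewrite !mxE (bigD1 i) //= big1 => [|l nl]; last first.
  by rewrite !mxE eq_sym (negbTE nl) !mul0r.
rewrite (bigD1 j) //= [in RHS]big1 => [|l nl]; last first.
  by rewrite !mxE (negbTE nl) mul0r mulr0n subr0 mulr0.
rewrite !mxE !eqxx mulr1n !mul1r; case: eqP => [->|_]; last by rewrite !mul0r mulr0.
by rewrite !mul1r; lia.
Qed.

End SingleWeyl.

Lemma wX_exp a n : wX a 1 ^+ n = n`!%:R *: wX a n.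
Proof.
elim: n => [|n IHn]; first by rewrite wX0 scale1r.
by rewrite exprS IHn -scalerAr wXS scalerA factS natrM mulrC.
Qed.

Lemma wY_exp a n : wY a 1 ^+ n = n`!%:R *: wY a n.
Proof.
elim: n => [|n IHn]; first by rewrite wY0 scale1r.
by rewrite exprS IHn -scalerAr wYS scalerA factS natrM mulrC.
Qed.

(** * Representations of the enveloping algebra from sl2-triples *)

Section LiftTriple.
Variables (A : algType CC) (x y h : A).
Hypothesis xy : x * y = y * x + h.
Hypothesis hx : h * x = x * (h + 2%:A).
Hypothesis hy : h * y = y * (h - 2%:A).

Definition triple_gen (g : sl2) : A :=
  sl2_val g 0 1 *: x + sl2_val g 1 0 *: y + sl2_val g 0 0 *: h.

Lemma triple_rel s t : env_rel sl2_bracket s t ->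
  eval triple_gen s = eval triple_gen t.
Proof.
case=> [c u v|u v] /=.
  rewrite /triple_gen !mxE !scalerDl -!scalerA -scalerAl mul1r !scalerDr.
  by rewrite [X in X + _ = _]addrACA [LHS]addrACA.
have tr (w : sl2) : sl2_val w 1 1 = - sl2_val w 0 0.
  apply/eqP; rewrite -addr_eq0; have := valP w; rewrite unfold_in /mxtrace.
  rewrite big_ord_recl big_ord1 addrC.
  by rewrite (_ : lift ord0 ord0 = 1 :> 'I_2) //; apply: val_inj.
have E (i j : 'I_2) : sl2_val (sl2_bracket u v) i j =
    (sl2_val u i 0 * sl2_val v 0 j + sl2_val u i 1 * sl2_val v 1 j)
    - (sl2_val v i 0 * sl2_val u 0 j + sl2_val v i 1 * sl2_val u 1 j).
  by rewrite /= !mxE !big_ord_recl !big_ord0 !addr0; congr (_ + _ - (_ + _));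
     congr (_ * _); congr (fun_of_matrix _ _ _); apply/val_inj.
rewrite /triple_gen !E !tr.
move: (sl2_val u 0 1) (sl2_val u 1 0) (sl2_val u 0 0) => p q r.
move: (sl2_val v 0 1) (sl2_val v 1 0) (sl2_val v 0 0) => p' q' r'.
have hx' : h * x = x * h + 2 *: x by rewrite hx mulrDr -scalerAr mulr1.
have hy' : h * y = y * h - 2 *: y by rewrite hy mulrBr -scalerAr mulr1.
(* Both sides of the bracket relation are combinations of these ordered monomials. Storing the
   coefficients in a polynomial turns the comparison into a commutative identity that [ring]
   decides. *)
pose m : seq A := [:: x; y; h; x * x; y * x; y * y; x * h; y * h; h * h].
pose F (P : {poly CC}) := \sum_(i < 9) P`_i *: m`_i.
have FD P Q : F P + F Q = F (P + Q).
  by rewrite /F -big_split; apply: eq_bigr => i _; rewrite /= coefD scalerDl.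
have FZ c P : c *: F P = F (c *: P).
  by rewrite /F scaler_sumr; apply: eq_bigr => i _; rewrite coefZ scalerA.
have FX i : (i < 9)%N -> m`_i = F 'X^i.
  move=> i9; rewrite /F (bigD1 (Ordinal i9)) //= coefXn eqxx scale1r big1 ?addr0 // => j nj.
  by rewrite -val_eqE /= in nj; rewrite coefXn (negbTE nj) scale0r.
have := FX 0%N isT; have := FX 1%N isT; have := FX 2%N isT; have := FX 3%N isT.
have := FX 4%N isT; have := FX 5%N isT; have := FX 6%N isT; have := FX 7%N isT.
have := FX 8%N isT; rewrite /m /=.
move=> F8 F7 F6 F5 F4 F3 F2 F1 F0.
rewrite !mulrDl !mulrDr -!scalerAl -!scalerAr xy hx' hy'.
rewrite -!scaleNr F8 F7 F6 F5 F4 F3 F2 F1 F0 !(FZ, FD).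
by congr F; rewrite -!mul_polyC !(polyCD, polyCB, polyCM, polyCN); ring.
Qed.

Definition triple_rep : Usl2 -> A := pres_lift triple_gen.

Lemma triple_rep_X : triple_rep eX = x.
Proof.
rewrite /triple_rep pres_lift_gen; last exact: triple_rel.
by rewrite /triple_gen /= !mxE /= !scale0r scale1r !addr0.
Qed.

Lemma triple_rep_Y : triple_rep eY = y.
Proof.
rewrite /triple_rep pres_lift_gen; last exact: triple_rel.
by rewrite /triple_gen /= !mxE /= !scale0r scale1r addr0 add0r.
Qed.

Lemma triple_rep_H : triple_rep eH = h.
Proof.
rewrite /triple_rep pres_lift_gen; last exact: triple_rel.
by rewrite /triple_gen /= !mxE /= !subr0 !scale0r scale1r !add0r.
Qed.

Lemma triple_rep1 : triple_rep 1 = 1.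
Proof. by apply: pres_lift1; apply: triple_rel. Qed.
Lemma triple_repD : {morph triple_rep : u v / u + v}.
Proof. by apply: pres_liftD; apply: triple_rel. Qed.
Lemma triple_repM : {morph triple_rep : u v / u * v}.
Proof. by apply: pres_liftM; apply: triple_rel. Qed.
Lemma triple_repZ a : {morph triple_rep : u / a *: u}.
Proof. by apply: pres_liftZ; apply: triple_rel. Qed.
Lemma triple_repN : {morph triple_rep : u / - u}.
Proof. by apply: pres_liftN; apply: triple_rel. Qed.

Lemma triple_rep_exp u n : triple_rep (u ^+ n) = triple_rep u ^+ n.
Proof.
by elim: n => [|n IHn]; rewrite ?triple_rep1 // !exprS triple_repM IHn.
Qed.

Lemma triple_rep_divp u n : triple_rep (divp u n) = divp (triple_rep u) n.
Proof. by rewrite /divp triple_repZ triple_rep_exp. Qed.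

Lemma triple_rep_pH f : triple_rep (pH eH f) = pH h f.
Proof.
elim/poly_ind: f => [|f c IHf].
  by rewrite /pH !rmorph0 -(scale0r (0 : Usl2)) triple_repZ scale0r.
by rewrite !(pHD, pHM, pHX, pHC) triple_repD triple_repM IHf triple_rep_H triple_repZ triple_rep1.
Qed.

End LiftTriple.

(** * Twisted tensor products of two Weyl modules *)

Section TensorWeyl.
Variables a b : nat.
Local Notation N := (b + a * b.+1)%N.+1.
Local Notation T A B := (@tensmx int a.+1 a.+1 b.+1 b.+1 A B : 'M[int]_N).

(** X and Y are exchanged on the second factor, so the vector of index (0,0) is a highest weight
    vector tensor a lowest weight vector. Its weight is [a - b], and it is killed neither by [X^(n)]
    for [n <= b] nor by [Y^(m)] for [m <= a]; this lets it separate PBW monomials. *)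
Definition tX (n : nat) : 'M[int]_N := \sum_(i < n.+1) T (wX a (n - i)) (wY b i).
Definition tY (n : nat) : 'M[int]_N := \sum_(i < n.+1) T (wY a (n - i)) (wX b i).
Definition tH : 'M[int]_N := T (wH a) 1%:M - T 1%:M (wH b).

Let TM (A A' : 'M[int]_a.+1) (B B' : 'M[int]_b.+1) :
  T A B * T A' B' = T (A * A') (B * B').
Proof. exact: (@tensmx_mul int a.+1 a.+1 b.+1 b.+1 a.+1 b.+1). Qed.

Let TDl (A A' : 'M[int]_a.+1) (B : 'M[int]_b.+1) : T (A + A') B = T A B + T A' B.
Proof. by apply/matrixP=> i j; rewrite !mxE mulrDl. Qed.
Let TDr (A : 'M[int]_a.+1) (B B' : 'M[int]_b.+1) : T A (B + B') = T A B + T A B'.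
Proof. by apply/matrixP=> i j; rewrite !mxE mulrDr. Qed.
Let TNl (A : 'M[int]_a.+1) (B : 'M[int]_b.+1) : T (- A) B = - T A B.
Proof. by apply/matrixP=> i j; rewrite !mxE mulNr. Qed.
Let TNr (A : 'M[int]_a.+1) (B : 'M[int]_b.+1) : T A (- B) = - T A B.
Proof. by apply/matrixP=> i j; rewrite !mxE mulrN. Qed.
Let TZl c (A : 'M[int]_a.+1) (B : 'M[int]_b.+1) : T (c *: A) B = c *: T A B.
Proof. by apply/matrixP=> i j; rewrite !mxE mulrA. Qed.
Let TZr c (A : 'M[int]_a.+1) (B : 'M[int]_b.+1) : T A (c *: B) = c *: T A B.
Proof. by apply/matrixP=> i j; rewrite !mxE mulrCA. Qed.
Let T1 : T 1%:M 1%:M = 1.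
Proof.
apply/matrixP=> i j; rewrite !mxE -natrM mulnb; congr (_%:R).
rewrite -!val_eqE /=; congr nat_of_bool.
apply/andP/eqP => [[/eqP ij1 /eqP ij2]|->//].
by rewrite (divn_eq i b.+1) (divn_eq j b.+1) ij1 ij2.
Qed.

Let tX1 : tX 1 = T (wX a 1) 1 + T 1 (wY b 1).
Proof. by rewrite /tX big_ord_recl big_ord1 /= wX0 wY0. Qed.
Let tY1 : tY 1 = T (wY a 1) 1 + T 1 (wX b 1).
Proof. by rewrite /tY big_ord_recl big_ord1 /= wX0 wY0. Qed.

Let exp_gen (A : 'M[int]_a.+1) (B : 'M[int]_b.+1) (An : nat -> 'M[int]_a.+1)
    (Bn : nat -> 'M[int]_b.+1) :
  (forall n, A ^+ n = n`!%:R *: An n) -> (forall n, B ^+ n = n`!%:R *: Bn n) ->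
  forall n, (T A 1 + T 1 B) ^+ n = n`!%:R *: \sum_(i < n.+1) T (An (n - i)%N) (Bn i).
Proof.
move=> AE BE n; have cAB : GRing.comm (T A 1) (T 1 B).
  by rewrite /GRing.comm !TM !mulr1 !mul1r.
have TAX m : T A 1 ^+ m = T (A ^+ m) 1.
  by elim: m => [|m IHm]; rewrite ?T1 // exprS IHm TM mulr1 exprS.
have TBX m : T 1 B ^+ m = T 1 (B ^+ m).
  by elim: m => [|m IHm]; rewrite ?T1 // exprS IHm TM mulr1 exprS.
rewrite exprDn_comm // scaler_sumr; apply: eq_bigr => i _.
rewrite TAX TBX TM mulr1 mul1r AE BE TZl TZr scalerA -scaler_nat scalerA.
congr (_ *: _); rewrite -!natrM; congr (_%:R).
by rewrite -(bin_fact (leq_ord i)); ring.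
Qed.

Lemma tX_exp n : tX 1 ^+ n = n`!%:R *: tX n.
Proof. by rewrite tX1 (exp_gen (@wX_exp a) (@wY_exp b)). Qed.
Lemma tY_exp n : tY 1 ^+ n = n`!%:R *: tY n.
Proof. by rewrite tY1 (exp_gen (@wY_exp a) (@wX_exp b)). Qed.

Lemma tXY : tX 1 * tY 1 = tY 1 * tX 1 + tH.
Proof.
rewrite tX1 tY1 !mulrDl !mulrDr !TM !(mulr1, mul1r) wXY (TDl (_ * _)).
rewrite -[T 1 (wY b 1 * wX b 1)](addrK (T 1 (wH b))) -TDr -wXY.
rewrite /tH; have aux (V : zmodType) (p q r s t u : V) :
    p + q + r + (s + (t - u)) = p + s + (r + t) + (q - u).
  rewrite -!addrA; congr (_ + _).
  rewrite [t + (q - u)]addrCA [r + (q + _)]addrCA [s + (q + _)]addrCA.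
  by congr (_ + _); rewrite addrCA.
exact: aux.
Qed.

Lemma tHX : tH * tX 1 = tX 1 * (tH + 2%:M).
Proof.
have cx : T 1%:M (wH b) * T 1 (wY b 1) = T 1 (wY b 1) * T 1%:M (wH b) - 2 *: T 1 (wY b 1).
  rewrite !TM !mul1r wHY mulrBr TDr TNr; congr (_ - _).
  by rewrite -[X in _ * X]scalemx1 -scalerAr mulr1 TZr.
have ch : T (wH a) 1%:M * T (wX a 1) 1 = T (wX a 1) 1 * T (wH a) 1%:M + 2 *: T (wX a 1) 1.
  rewrite !TM !mul1r wHX mulrDr TDl; congr (_ + _).
  by rewrite -[X in _ * X]scalemx1 -scalerAr mulr1 TZl.
have c1 : T (wH a) 1%:M * T 1 (wY b 1) = T 1 (wY b 1) * T (wH a) 1%:M.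
  by rewrite !TM !mulr1 !mul1r.
have c2 : T 1%:M (wH b) * T (wX a 1) 1 = T (wX a 1) 1 * T 1%:M (wH b).
  by rewrite !TM !mulr1 !mul1r.
rewrite tX1 /tH !mulrDl !mulrDr !mulNr !mulrN ch cx c1 c2.
rewrite -[2%:M]scalemx1 -!scalerAr !mulr1.
have aux (V : zmodType) (p q r s t u : V) :
    p + u + r + (- s - (t - q)) = p - s + u + (r - t + q).
  rewrite opprB -!addrA; congr (_ + _).
  rewrite [r + (- s + _)]addrCA [u + (- s + _)]addrCA; do 3!congr (_ + _).
  by rewrite addrC.
exact: aux.
Qed.

Lemma tHY : tH * tY 1 = tY 1 * (tH - 2%:M).
Proof.
have cx : T 1%:M (wH b) * T 1 (wX b 1) = T 1 (wX b 1) * T 1%:M (wH b) + 2 *: T 1 (wX b 1).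
  rewrite !TM !mul1r wHX mulrDr TDr; congr (_ + _).
  by rewrite -[X in _ * X]scalemx1 -scalerAr mulr1 TZr.
have ch : T (wH a) 1%:M * T (wY a 1) 1 = T (wY a 1) 1 * T (wH a) 1%:M - 2 *: T (wY a 1) 1.
  rewrite !TM !mul1r wHY mulrBr TDl TNl; congr (_ - _).
  by rewrite -[X in _ * X]scalemx1 -scalerAr mulr1 TZl.
have c1 : T (wH a) 1%:M * T 1 (wX b 1) = T 1 (wX b 1) * T (wH a) 1%:M.
  by rewrite !TM !mulr1 !mul1r.
have c2 : T 1%:M (wH b) * T (wY a 1) 1 = T (wY a 1) 1 * T 1%:M (wH b).
  by rewrite !TM !mulr1 !mul1r.
rewrite tY1 /tH !mulrDl !mulrDr !mulNr !mulrN ch cx c1 c2.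
rewrite -[2%:M]scalemx1 -!scalerAr !mulr1.
have aux (V : zmodType) (p q r s t u : V) :
    p - u + r + (- s - (t + q)) = p - s - u + (r - t - q).
  rewrite opprD -!addrA; congr (_ + _).
  by rewrite [r + (- s + _)]addrCA [- u + (- s + _)]addrCA.
exact: aux.
Qed.

Definition twt (i j : nat) : int := (a%:Z - i.*2%:Z) - (b%:Z - j.*2%:Z).

Definition tvec (R : pzSemiRingType) (i j : nat) : 'cV[R]_N :=
  \col_q (((q %/ b.+1)%N == i) && ((q %% b.+1)%N == j))%:R.

Lemma tHE (q q' : 'I_N) : tH q q' = (q == q')%:R * twt (q %/ b.+1) (q %% b.+1).
Proof.
rewrite !mxE /= -!val_eqE /=.
have -> : (q == q' :> nat) = ((q %/ b.+1 == q' %/ b.+1) && (q %% b.+1 == q' %% b.+1))%N.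
  apply/eqP/andP => [->//|[/eqP e1 /eqP e2]].
  by rewrite (divn_eq q b.+1) (divn_eq q' b.+1) e1 e2.
by case: eqP => _; case: eqP => _; rewrite /= !(mul1r, mul0r, mulr1, mulr0) ?subrr.
Qed.

Lemma tX_tvec (R : pzRingType) n : (n <= b)%N ->
  map_mx (intr : int -> R) (tX n) *m tvec R 0 0 = tvec R 0 n.
Proof.
move=> nb; apply/matrixP=> q z; rewrite !mxE.
rewrite (bigD1 ord0) //= big1 ?addr0 => [|q' nq']; last first.
  rewrite !mxE; case: andP => [[/eqP e1 /eqP e2]|]; rewrite ?mulr0 //.
  by case/eqP: nq'; apply: val_inj; rewrite /= (divn_eq q' b.+1) e1 e2.
rewrite !mxE div0n mod0n /= mulr1 summxE.
rewrite (bigD1 (Ordinal (ltnSn n))) //= big1 ?addr0 => [|i ni]; last first.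
  rewrite !mxE /= div0n -[(_ == _ + _)%N](_ : false = _) ?mul0r //.
  apply/esym/negbTE; rewrite eq_sym addn_eq0 subn_eq0 negb_and -ltnNge.
  rewrite -val_eqE /= in ni; rewrite [X in _ || X]ltn_neqAle ni.
  by rewrite -ltnS ltn_ord orbT.
rewrite !mxE /= div0n mod0n subnn !addn0 add0n bin0 mulr1 [(0 == _)%N]eq_sym.
case: (eqVneq (q %/ b.+1)%N 0%N) => _; rewrite ?mul0r // mul1r /=.
by case: (eqVneq (q %% b.+1)%N n) => [->|_]; rewrite ?mul0r // binn mul1r.
Qed.

Lemma tY_tvec (R : pzRingType) m l (q : 'I_N) : (l <= b)%N ->
  (map_mx (intr : int -> R) (tY m) *m tvec R 0 l) q 0 =
  (((q %/ b.+1) <= m) && (l == q %% b.+1 + (m - (q %/ b.+1))))%N%:R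
    * 'C(b - q %% b.+1, m - (q %/ b.+1))%:R.
Proof.
move=> lb; rewrite !mxE.
have lN : (l < N)%N by apply: leq_trans (_ : b.+1 <= _)%N => //; rewrite ltnS leq_addr.
rewrite (bigD1 (Ordinal lN)) //= big1 ?addr0 => [|q' nq']; last first.
  rewrite !mxE; case: andP => [[/eqP e1 /eqP e2]|]; rewrite ?mulr0 //.
  by case/eqP: nq'; apply: val_inj; rewrite /= (divn_eq q' b.+1) e1 e2.
have e1 : (l %/ b.+1 = 0)%N by rewrite divn_small.
have e2 : (l %% b.+1 = l)%N by rewrite modn_small.
rewrite !mxE /= e1 e2 !eqxx mulr1 summxE.
set q1 := (q %/ b.+1)%N; set q2 := (q %% b.+1)%N.
have TE (i : 'I_m.+1) : (T (wY a (m - i)) (wX b i)) q (Ordinal lN) =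
   ((q1 == m - i) && (l == q2 + i))%N%:R * 'C(b - q2, i)%:R.
  rewrite !mxE /= e1 e2 add0n -/q1 -/q2.
  case: eqP => [->|_]; last by rewrite !mul0r.
  by rewrite binn !mul1r.
under eq_bigr do rewrite TE.
have [q1m|mq1] := leqP q1 m; last first.
  rewrite big1 ?mul0r // => i _.
  by rewrite gtn_eqF ?mul0r //; apply: leq_ltn_trans mq1; apply: leq_subr.
have mq : (m - q1 < m.+1)%N by rewrite ltnS leq_subr.
rewrite (bigD1 (Ordinal mq)) //= big1 ?addr0 => [|i ni]; last first.
  rewrite -val_eqE /= in ni; have -> : (q1 == m - i)%N = false; last by rewrite mul0r.
  by apply/negbTE; apply: contraNneq ni => ->; rewrite subKn // -ltnS.
rewrite subKn // eqxx /=.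
by rewrite rmorphM /= !rmorph_nat.
Qed.

End TensorWeyl.

Lemma map_mx_mul (aR rR : pzSemiRingType) (f : {rmorphism aR -> rR}) n (A B : 'M[aR]_n) :
  map_mx f (A * B) = map_mx f A * map_mx f B.
Proof. exact: map_mxM. Qed.

(** * Reduction of the tensor representations to [k] *)

Section HyperRep.
Variables (k : fieldType) (a b : nat).
Local Notation N := (b + a * b.+1)%N.+1.
Local Notation intC := (map_mx (intr : int -> CC)).
Local Notation intk := (map_mx (intr : int -> k)).

Let x : 'M[CC]_N := intC (tX a b 1).
Let y : 'M[CC]_N := intC (tY a b 1).
Let h : 'M[CC]_N := intC (tH a b).

Let xy : x * y = y * x + h.
Proof. by rewrite -!map_mx_mul -map_mxD; congr intC; apply: tXY. Qed.

Let hx : h * x = x * (h + 2%:A).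
Proof.
rewrite (_ : 2%:A = intC 2%:M); last by rewrite map_scalar_mx scalemx1.
by rewrite -map_mxD -!map_mx_mul; congr intC; apply: tHX.
Qed.

Let hy : h * y = y * (h - 2%:A).
Proof.
rewrite (_ : 2%:A = intC 2%:M); last by rewrite map_scalar_mx scalemx1.
by rewrite -map_mxB -!map_mx_mul; congr intC; apply: tHY.
Qed.

Let rho := triple_rep x y h.

Let intC_inj : injective (fun A : 'M[int]_N => intC A).
Proof.
move=> A B /matrixP AB; apply/matrixP=> i j; have := AB i j; rewrite !mxE.
by move/eqP; rewrite eqr_int => /eqP.
Qed.

Let divp_map (A : 'M[int]_N) (An : nat -> 'M[int]_N) n :
  A ^+ n = n`!%:R *: An n -> divp (intC A) n = intC (An n).
Proof.
move=> AE; have -> : divp (intC A) n = (n`!%:R : CC)^-1 *: intC (A ^+ n).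
  congr (_ *: _); elim: (n) => [|l IHl]; first by rewrite map_mx1.
  by rewrite !exprS IHl map_mx_mul.
rewrite AE.
have -> : intC (n`!%:R *: An n) = n`!%:R *: intC (An n).
  by apply/matrixP=> i j; rewrite !mxE rmorphM /= rmorph_nat.
by rewrite scalerA mulVf ?scale1r // fact_neq0.
Qed.

Let rho_X n : rho (divpow eX n) = intC (tX a b n).
Proof.
by rewrite divpowE /rho triple_rep_divp ?triple_rep_X //; apply/divp_map/tX_exp.
Qed.

Let rho_Y n : rho (divpow eY n) = intC (tY a b n).
Proof.
by rewrite divpowE /rho triple_rep_divp ?triple_rep_Y //; apply/divp_map/tY_exp.
Qed.

Let rho_int u : inUZ u -> exists A : 'M[int]_N, rho u = intC A.
Proof.
elim=> {u} [m|m||u v _ [A EA] _ [B EB]|u v _ [A EA] _ [B EB]].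
- by eexists; apply: rho_X.
- by eexists; apply: rho_Y.
- by exists 1; rewrite /rho triple_rep1 // map_mx1.
- exists (A - B); rewrite /rho triple_repD // triple_repN //.
  by rewrite -/rho EA EB map_mxB.
- exists (A * B); rewrite /rho triple_repM // -/rho EA EB.
  by rewrite map_mx_mul.
Qed.

(** The divided powers act by integer matrices, hence so does the whole Z-form. The integer matrix
    is unique because integers embed in [CC], so its reduction to [k] is compatible with sums and
    products. *)
Let rhoZ (u : UZ) : 'M[int]_N := projT1 (cid (rho_int (UZ_inUZ u))).
Let rhoZE u : intC (rhoZ u) = rho (val u).
Proof. by rewrite -(projT2 (cid (rho_int (UZ_inUZ u)))). Qed.

Let gen (uc : UZ * k) : 'M[k]_N := uc.2 *: intk (rhoZ uc.1).

Let gen_rel s t : tens_rel s t -> eval gen s = eval gen t.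
Proof.
case=> [u v c|u c d|u c d|u v c d|]; rewrite /= /gen /=.
- rewrite -scalerDr -map_mxD; congr (_ *: intk _); apply: intC_inj.
  by rewrite map_mxD !rhoZE /rho triple_repD.
- by rewrite scalerDl.
- by rewrite -scalerAl mul1r scalerA.
- rewrite -scalerAl -scalerAr scalerA -[X in _ = _ *: X](map_mx_mul intr).
  congr (_ *: intk _); apply: intC_inj.
  by rewrite [X in _ = X]map_mx_mul !rhoZE /rho triple_repM.
- congr (_ *: _); rewrite (_ : rhoZ 1 = 1%:M); first exact: map_mx1.
  by apply: intC_inj; rewrite rhoZE map_mx1 /rho triple_rep1.
Qed.

Definition tens_rep : hyper k -> 'M[k]_N := pres_lift gen.

Let rep_of_UZ u A : inUZ u -> rho u = intC A -> tens_rep (of_UZ k u) = intk A.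
Proof.
move=> uu; have [v <- ->] := of_UZE k uu; move=> EA.
rewrite /tens_rep pres_lift_gen; last exact: gen_rel.
rewrite /gen /= scale1r; congr (intk _); apply: intC_inj.
by rewrite rhoZE.
Qed.

Lemma tens_repX n : tens_rep (hX k n) = intk (tX a b n).
Proof. by apply: rep_of_UZ; [exact: inUZ_X | exact: rho_X]. Qed.

Lemma tens_repY n : tens_rep (hY k n) = intk (tY a b n).
Proof. by apply: rep_of_UZ; [exact: inUZ_Y | exact: rho_Y]. Qed.

Lemma tens_repD : {morph tens_rep : u v / u + v}.
Proof. by apply: pres_liftD; apply: gen_rel. Qed.
Lemma tens_repM : {morph tens_rep : u v / u * v}.
Proof. by apply: pres_liftM; apply: gen_rel. Qed.
Lemma tens_repZ c : {morph tens_rep : u / c *: u}.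
Proof. by apply: pres_liftZ; apply: gen_rel. Qed.

Lemma tens_rep0 : tens_rep 0 = 0.
Proof. by rewrite -(scale0r (0 : hyper k)) tens_repZ scale0r. Qed.

Let tbin n : 'M[int]_N := \matrix_(q, q') ((q == q')%:R *
   binz (twt a b (q %/ b.+1) (q %% b.+1)) n).

Let rho_bin n : rho (pH eH (binP 0 n)) = intC (tbin n).
Proof.
rewrite /rho triple_rep_pH //.
have E f : pH h f = \matrix_(q, q') ((q == q')%:R *
     f.[(twt a b (q %/ b.+1) (q %% b.+1))%:~R]).
  elim/poly_ind: f => [|f c IHf].
    by apply/matrixP=> q q'; rewrite /pH rmorph0 !mxE horner0 mulr0.
  rewrite !(pHD, pHM, pHX, pHC) IHf; apply/matrixP=> q q'.
  rewrite mxE [X in X + _]mxE (bigD1 q) //= big1 ?addr0 => [|q'' nq]; last first.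
    by rewrite mxE eq_sym (negbTE nq) !mul0r.
  have hqE : h q q' = ((q == q')%:R * twt a b (q %/ b.+1) (q %% b.+1))%:~R.
    by rewrite mxE tHE.
  rewrite hqE !mxE eqxx mul1r !hornerE rmorphM /=.
  by case: eqP => _; rewrite ?(mul1r, mul0r, mulr1, mulr0, addr0).
rewrite E; apply/matrixP=> q q'; rewrite !mxE binP_eval0 rmorphM /=.
by case: eqP.
Qed.

Lemma tens_rep_E f i j : Phi f ->
  tens_rep (hE f) *m tvec a b k i j = f (twt a b i j) *: tvec a b k i j.
Proof.
elim/(@Phi_ind k k^o (fun=> 0)): f / => [n||c f g Pf Pg Hf Hg].
- rewrite hE_bin0 /hbin binHE (rep_of_UZ (inUZ_binP0 n) (rho_bin n)).
  apply/matrixP=> q z; rewrite !mxE (bigD1 q) //= big1 ?addr0 => [|q' nq]; last first.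
    by rewrite !mxE eq_sym (negbTE nq) mul0r mul0r.
  rewrite !mxE eqxx mul1r.
  by case: andP => [[/eqP -> /eqP ->]//|_]; rewrite !mulr0.
- by rewrite hE0 tens_rep0 mul0mx scale0r.
- rewrite hE_lin // tens_repD tens_repZ mulmxDl -scalemxAl Hf Hg scalerDl.
  by rewrite scalerA.
Qed.

End HyperRep.

(** * The independence half of PBW *)

Section Free.
Variable k : fieldType.

(** Descending induction on the exponent of Y. Applied to the vector of index (0,0), the monomial
    with exponents [(m, l)] has a nonzero coordinate at [(m0, l0)] only if [m = m0 + (l - l0)] with
    [l >= l0]. Those with [m > m0] are zero by induction, so the coordinate is the value of
    [f (m0, l0)] at one weight. *)
Lemma pbw_free (s : seq (nat * nat)) (f : nat * nat -> int -> k) :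
    uniq s -> (forall i, Phi (f i)) ->
    \sum_(i <- s) hY k i.1 * hE (f i) * hX k i.2 = 0 ->
  forall i x, i \in s -> f i x = 0.
Proof.
move=> us Pf s0.
suff H m : forall i x, i \in s -> (m <= i.1)%N -> f i x = 0.
  by move=> i x si; apply: (H 0%N).
pose M := \max_(i <- s) i.1.
have [n] := ubnP (M.+1 - m); elim: n m => // n IHn m; rewrite ltnS => lem.
move=> [m0 l0] x si /= lemm.
have mM : (m0 <= M)%N by rewrite /M (big_rem (m0, l0)) //= leq_max leqnn.
have IH i z : i \in s -> (m0 < i.1)%N -> f i z = 0.
  by move=> si' lt; apply: (IHn m.+1) => //; [lia | apply: leq_trans lt].
pose L := \max_(i <- s) i.2.
have lL i : i \in s -> (i.2 <= L)%N.
  by move=> si'; rewrite /L (big_rem i) //= leq_max leqnn.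
(* [b] is large enough for all [X^(l)] that occur to act without killing the vector, and [a] is then
   adjusted so that index [(0, l0)] has weight exactly [x]. *)
pose b := (L + m0 + `|(x - l0.*2%:Z)%R|)%N.
have Lb : (L <= b)%N by rewrite /b -addnA leq_addr.
pose a := `|(x - l0.*2%:Z + b%:Z)%R|%N.
have aE : a%:Z = x - l0.*2%:Z + b%:Z by rewrite /a /b; lia.
have m0a : (m0 <= a)%N by move: aE; rewrite /b; lia.
have l0b : (l0 <= b)%N by have /= := lL _ si; rewrite /b; lia.
have qN : (m0 * b.+1 + l0 < (b + a * b.+1).+1)%N.
  have : (m0 * b.+1 <= a * b.+1)%N by rewrite leq_mul2r m0a orbT.
  by move: l0b; lia.
have q1 : ((m0 * b.+1 + l0) %/ b.+1 = m0)%N by rewrite divnMDl // divn_small ?addn0.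
have q2 : ((m0 * b.+1 + l0) %% b.+1 = l0)%N by rewrite modnMDl modn_small.
have : (tens_rep a b (\sum_(i <- s) hY k i.1 * hE (f i) * hX k i.2)
         *m tvec a b k 0 0) (Ordinal qN) 0 = 0.
  by rewrite s0 tens_rep0 mul0mx mxE.
have -> : tens_rep a b (\sum_(i <- s) hY k i.1 * hE (f i) * hX k i.2)
  = \sum_(i <- s) tens_rep a b (hY k i.1 * hE (f i) * hX k i.2).
  by apply: (big_morph _ (@tens_repD k a b) (tens_rep0 k a b)).
rewrite mulmx_suml summxE (bigD1_seq (m0, l0)) //= big1_seq => [|i /andP [ni si']].
  rewrite addr0 !tens_repM tens_repX tens_repY -!mulmxA tX_tvec // tens_rep_E //.
  rewrite -scalemxAr mxE tY_tvec //= q1 q2 leqnn subnn addn0 eqxx bin0 !mulr1.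
  by rewrite /twt aE => <-; congr f; lia.
rewrite !tens_repM tens_repX tens_repY -!mulmxA tX_tvec; last first.
  exact: leq_trans (lL _ si') Lb.
rewrite tens_rep_E // -scalemxAr mxE tY_tvec /= ?q1 ?q2; last first.
  exact: leq_trans (lL _ si') Lb.
case: (ltnP m0 i.1) => [lt|]; first by rewrite IH // mul0r.
rewrite leq_eqVlt => /predU1P [ei|lt].
  rewrite ei leqnn subnn addn0; case: eqP => [el|_]; last by rewrite mul0r mulr0.
  by case/eqP: ni; rewrite -ei -el; case: (i).
by rewrite [(m0 <= _)%N]leqNgt lt mul0r mulr0.
Qed.

Lemma hyper_is_hyper : hyper_axioms (hX k) (hY k) (@hE k).
Proof.
split.
- exact: hX0.
- exact: hY0.
- exact: hXX.
- exact: hYY.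
- exact: hE_lin.
- exact: hE1.
- exact: hEM.
- exact: hEX.
- exact: hEY.
- exact: hXY.
- exact: pbw_span.
- exact: pbw_free.
Qed.

End Free.

(** * Lucas' theorem and residue classes modulo p *)

Section Lucas.
Variables (k : fieldType) (p : nat).
Hypothesis hp : p \in [pchar k].

Let pP : prime p := pcharf_prime hp.
Let p0 : (0 < p)%N := prime_gt0 pP.
Let pz : p%:Z != 0. Proof. by rewrite -lt0n. Qed.

Lemma divz_digit (q : int) y : (y < p)%N -> ((q * p%:Z + y%:Z) %/ p%:Z)%Z = q.
Proof. by move=> yp; rewrite divzMDl // divz_small ?addr0 //= ltz_nat absz_nat. Qed.

Lemma hat_digit (q : int) y : (y < p)%N -> hat p (q * p%:Z + y%:Z) = y.
Proof. by move=> yp; rewrite /hat modzMDl modz_small //= ltz_nat absz_nat. Qed.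

Lemma hat_lt (x : int) : (hat p x < p)%N.
Proof. by rewrite /hat -ltz_nat gez0_abs ?modz_ge0 // ltz_pmod. Qed.

Lemma divz_hat (x : int) : x = (x %/ p%:Z)%Z * p%:Z + (hat p x)%:Z.
Proof. by rewrite /hat gez0_abs ?modz_ge0 // -divz_eq. Qed.

(** The right-hand side satisfies the recursion of [binz_uniq]; Pascal's rule is checked according
    to whether the last digits of [x] and [n] roll over from p-1 to 0. *)
Lemma binz_lucas (x : int) n : (binz x n)%:~R =
  (binz (x %/ p%:Z)%Z (n %/ p))%:~R * 'C(hat p x, n %% p)%:R :> k.
Proof.
symmetry; move: x n; apply: binz_uniq => [x|n|x n].
- by rewrite div0n mod0n binz0 bin0 mulr1.
- rewrite div0z /hat mod0z /=; case E : (n.+1 %% p)%N => [|s]; last by rewrite mulr0.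
  case E' : (n.+1 %/ p)%N => [|m]; last by rewrite mul0r.
  by have := divn_eq n.+1 p; rewrite E E'.
rewrite (divz_hat x); move: (x %/ p%:Z)%Z (hat p x) (hat_lt x) => q y yp.
rewrite -addrA -PoszD addn1 (divn_eq n p).
move: (n %/ p)%N (n %% p)%N (ltn_pmod n p0) => m s sp.
have dn m' s' : (s' < p)%N -> ((m' * p + s') %/ p = m')%N.
  by move=> s'p; rewrite divnMDl // divn_small ?addn0.
have mn m' s' : (s' < p)%N -> ((m' * p + s') %% p = s')%N.
  by move=> s'p; rewrite modnMDl modn_small.
rewrite -addnS !(divz_digit q yp) !(hat_digit q yp) !(dn m s sp) !(mn m s sp).
have pE : p.-1.+1 = p by rewrite prednK.
have [yp1|yp1] := ltnP y p.-1.
  have yp' : (y.+1 < p)%N by rewrite -pE ltnS.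
  rewrite (divz_digit q yp') (hat_digit q yp').
  have [sp1|sp1] := ltnP s p.-1.
    have sp' : (s.+1 < p)%N by rewrite -pE ltnS.
    by rewrite (dn _ _ sp') (mn _ _ sp') binS natrD mulrDr.
  have -> : s = p.-1 by apply/eqP; rewrite eqn_leq sp1 -ltnS pE sp.
  rewrite pE -mulSnr -[(m.+1 * p)%N]addn0 (dn _ _ p0) (mn _ _ p0) !bin0.
  by rewrite [X in _ + _ * X%:R]bin_small // mulr0 addr0.
have -> : y = p.-1 by apply/eqP; rewrite eqn_leq yp1 -ltnS pE yp.
rewrite pE -[X in (X %/ _)%Z](_ : (q + 1) * p%:Z + 0%:Z = _); last by ring.
rewrite -[X in hat _ X](_ : (q + 1) * p%:Z + 0%:Z = _); last by ring.
rewrite (divz_digit _ p0) (hat_digit _ p0).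
have [sp1|sp1] := ltnP s p.-1.
  have sp' : (s.+1 < p)%N by rewrite -pE ltnS.
  rewrite (dn _ _ sp') (mn _ _ sp') bin_small // mulr0 -mulrDr -natrD -binS pE.
  suff -> : 'C(p, s.+1)%:R = 0 :> k by rewrite mulr0.
  by apply/eqP; rewrite -(dvdn_pcharf hp) prime_dvd_bin.
have -> : s = p.-1 by apply/eqP; rewrite eqn_leq sp1 -ltnS pE sp.
rewrite pE -mulSnr -[(m.+1 * p)%N]addn0 (dn _ _ p0) (mn _ _ p0) !bin0 binn.
by rewrite !mulr1 binzS rmorphD.
Qed.

Lemma bin_lucas m n m' n' : (m' < p)%N -> (n' < p)%N ->
  'C(m * p + m', n * p + n')%:R = 'C(m, n)%:R * 'C(m', n')%:R :> k.
Proof.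
move=> m'p n'p; have := binz_lucas (m * p + m')%N%:Z (n * p + n').
rewrite binz_nat PoszD PoszM (divz_digit _ m'p) (hat_digit _ m'p).
by rewrite divnMDl // divn_small // addn0 modnMDl modn_small // binz_nat.
Qed.

(** By Lucas, the binomial of lower index [n * p] at [x] is that of lower index [n] at the floor of
    x/p. This is Fr' on the Cartan part. *)
Lemma Phi_floor (f : int -> k) : Phi f -> Phi (fun x => f (x %/ p%:Z)%Z).
Proof.
elim/(@Phi_ind k k^o (fun=> 0)): f / => [n||a f g _ _ Pf Pg].
- apply: Phi_ext (Phi_bin k 0 (n * p)) => x.
  by rewrite addr0 binz_lucas mulnK // modnMl bin0 mulr1.
- exact: Phi_const.
exact: Phi_lin.
Qed.

Definition ind_mod (a x : int) : k := (p%:Z %| x - a)%Z%:R.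

(** By Lucas, the binomial with lower index p-1 is 1 when the last digit of its upper argument is
    p-1, and 0 otherwise. So [mu_a] is a weight projector. *)
Lemma chE a x : ind_mod a x = (binz (x - a - 1) p.-1)%:~R.
Proof.
have p1 : (p.-1 < p)%N by rewrite prednK.
rewrite binz_lucas divn_small // modn_small // binz0 mul1r /ind_mod.
rewrite [in LHS](divz_hat (x - a)) [in RHS](divz_hat (x - a)).
move: ((x - a) %/ p%:Z)%Z (hat p (x - a)) (hat_lt (x - a)) => q y yp.
rewrite rpredDl ?dvdz_mull //; case: y yp => [|y] yp.
  rewrite dvdz0 (_ : _ - 1 = (q - 1) * p%:Z + p.-1%:Z); last first.
    have pE : p%:Z = p.-1%:Z + 1 by lia.
    by set w := p.-1%:Z in pE *; rewrite pE; ring.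
  by rewrite (hat_digit _ p1) binn.
rewrite (_ : _ - 1 = q * p%:Z + y%:Z) ?(hat_digit _ (ltnW yp)); last by lia.
rewrite bin_small; last by rewrite -ltnS prednK.
by rewrite dvdzE /= gtnNdvd.
Qed.

Lemma Phi_ch a : Phi (ind_mod a).
Proof. by apply: Phi_ext (Phi_bin k (- a - 1) p.-1) => x; rewrite chE addrA. Qed.

Definition periodic (f : int -> k) := forall x y, (p%:Z %| x - y)%Z -> f x = f y.

Lemma pper_bin c i : (i < p)%N -> periodic (fun x => (binz (x + c) i)%:~R).
Proof.
move=> ip x y xy; rewrite (binz_lucas (x + c)) (binz_lucas (y + c)) divn_small // !binz0 !mul1r.
congr ('C(_, _)%:R); rewrite /hat; congr (`|_|%N); apply/eqP.
by rewrite eqz_mod_dvd opprD addrACA subrr addr0.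
Qed.

Lemma pper_ch f a x : periodic f -> f x * ind_mod a x = f a * ind_mod a x.
Proof.
move=> pf; rewrite /ind_mod; case: (boolP (_ %| _)%Z) => [xa|]; last by rewrite !mulr0.
by rewrite (pf _ _ xa).
Qed.

Lemma ch_per a b : (p%:Z %| a - b)%Z -> ind_mod a = ind_mod b.
Proof.
move=> ab; apply/funext => x; rewrite /ind_mod; congr (_%:R); congr nat_of_bool.
by rewrite -[x - b](subrKA a) (rpredDr _ ab).
Qed.

Lemma ch_shift a c x : ind_mod a (x + c) = ind_mod (a - c) x.
Proof. by rewrite /ind_mod; congr (_%:R); congr nat_of_bool; congr (_ %| _)%Z; ring. Qed.

Lemma ch_idem a x : ind_mod a x * ind_mod a x = ind_mod a x.
Proof. by rewrite /ind_mod; case: (_ %| _)%Z; rewrite !(mulr1, mulr0). Qed.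

Lemma fact_unit n : (n < p)%N -> n`!%:R != 0 :> k.
Proof.
move=> np; rewrite -(dvdn_pcharf hp).
elim: n np => [|n IHn] np; first by rewrite dvdn1 neq_ltn prime_gt1 // orbT.
by rewrite factS Euclid_dvdM // negb_or IHn 1?ltnW // andbT gtnNdvd.
Qed.

End Lucas.

(** * Weights modulo p and the operator [YX] *)

Section Hyper.
Variables (k : fieldType) (p : nat).
Hypothesis hp : p \in [pchar k].
Variables (U : algType k) (hX hY : nat -> U) (E : (int -> k) -> U).
Hypothesis HA : hyper_axioms hX hY E.
Local Notation ch := (@ind_mod k p).
Local Notation pper := (@periodic k p).

Let pP : prime p := pcharf_prime hp.
Let p0 : (0 < p)%N := prime_gt0 pP.

Lemma E_ext f g : f =1 g -> E f = E g.
Proof. by move=> /funext ->. Qed.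

Lemma E0 : E (fun=> 0) = 0.
Proof.
have := hax_Elin HA (-1) (Phi_const (0 : k)) (Phi_const (0 : k)).
by rewrite scaleN1r addNr; under eq_fun do rewrite mulr0 addr0.
Qed.

Lemma EZ c f : Phi f -> E (fun x => c * f x) = c *: E f.
Proof.
move=> Pf; have := hax_Elin HA c Pf (Phi_const 0); rewrite E0 addr0 => <-.
by apply: E_ext => x; rewrite addr0.
Qed.

Lemma XE f n : Phi f -> hX n * E f = E (fun x => f (x - n.*2%:Z)) * hX n.
Proof.
move=> Pf; rewrite (hax_EX HA); last exact: Phi_shift.
by congr (_ * _); apply: E_ext => x; rewrite addrK.
Qed.

Lemma YE f n : Phi f -> hY n * E f = E (fun x => f (x + n.*2%:Z)) * hY n.
Proof.
move=> Pf; rewrite (hax_EY HA); last exact: Phi_shift.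
by congr (_ * _); apply: E_ext => x; rewrite subrK.
Qed.

Lemma X_exp n : hX 1 ^+ n = n`!%:R *: hX n.
Proof.
elim: n => [|n IHn]; first by rewrite (hax_X0 HA) scale1r.
by rewrite exprS IHn -scalerAr (hax_XX HA) scalerA add1n bin1 factS natrM mulrC.
Qed.

Lemma Y_exp n : hY 1 ^+ n = n`!%:R *: hY n.
Proof.
elim: n => [|n IHn]; first by rewrite (hax_Y0 HA) scale1r.
by rewrite exprS IHn -scalerAr (hax_YY HA) scalerA add1n bin1 factS natrM mulrC.
Qed.

Lemma X_fact n : (n < p)%N -> hX n = (n`!%:R)^-1 *: hX 1 ^+ n.
Proof. by move=> np; rewrite X_exp scalerA mulVf ?scale1r // (fact_unit hp). Qed.

Lemma Y_fact n : (n < p)%N -> hY n = (n`!%:R)^-1 *: hY 1 ^+ n.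
Proof. by move=> np; rewrite Y_exp scalerA mulVf ?scale1r // (fact_unit hp). Qed.

Let fact_p : p`!%:R = 0 :> k.
Proof. by apply/eqP; rewrite -(dvdn_pcharf hp) dvdn_fact // p0 leqnn. Qed.

Lemma X_p n : (p <= n)%N -> hX 1 ^+ n = 0.
Proof. by move=> /subnKC <-; rewrite exprD X_exp fact_p scale0r mul0r. Qed.

Lemma Y_p n : (p <= n)%N -> hY 1 ^+ n = 0.
Proof. by move=> /subnKC <-; rewrite exprD Y_exp fact_p scale0r mul0r. Qed.

Lemma bin_carry m n : (p <= m %% p + n %% p)%N -> 'C(m + n, m)%:R = 0 :> k.
Proof.
move=> le; have mp := ltn_pmod m p0; have np := ltn_pmod n p0.
have lt : (m %% p + n %% p - p < p)%N by lia.
have -> : (m + n = (m %/ p + n %/ p).+1 * p + (m %% p + n %% p - p))%N.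
  by rewrite {1}(divn_eq m p) {1}(divn_eq n p) mulSn mulnDl; lia.
rewrite [X in 'C(_, X)](divn_eq m p) (bin_lucas hp) // [X in _ * X%:R]bin_small ?mulr0 //.
by lia.
Qed.

Lemma bin_nocarry m n : (m %% p + n %% p < p)%N ->
  'C(m + n, m)%:R = 'C(m %/ p + n %/ p, m %/ p)%:R * 'C(m %% p + n %% p, m %% p)%:R :> k.
Proof.
move=> lt; have mp := ltn_pmod m p0.
have -> : (m + n = (m %/ p + n %/ p) * p + (m %% p + n %% p))%N.
  by rewrite {1}(divn_eq m p) {1}(divn_eq n p) mulnDl; lia.
by rewrite [X in 'C(_, X)](divn_eq m p) (bin_lucas hp).
Qed.

Lemma XX_carry m n : (p <= m %% p + n %% p)%N -> hX m * hX n = 0.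
Proof. by move=> le; rewrite (hax_XX HA) bin_carry // scale0r. Qed.

Lemma YY_carry m n : (p <= m %% p + n %% p)%N -> hY m * hY n = 0.
Proof. by move=> le; rewrite (hax_YY HA) bin_carry // scale0r. Qed.

Lemma bin_pp m n : 'C(m * p + n * p, m * p)%:R = 'C(m + n, m)%:R :> k.
Proof. by rewrite bin_nocarry ?modnMl ?addn0 // !mulnK // bin0 mulr1. Qed.

Lemma X_digit m l : (l < p)%N -> hX (m * p + l) = hX (m * p) * hX l.
Proof.
move=> lp; rewrite (hax_XX HA) bin_nocarry ?modnMl ?modn_small // mulnK // divn_small //.
by rewrite addn0 binn bin0 mulr1 scale1r.
Qed.

Lemma Y_digit m l : (l < p)%N -> hY (m * p + l) = hY (m * p) * hY l.
Proof.
move=> lp; rewrite (hax_YY HA) bin_nocarry ?modnMl ?modn_small // mulnK // divn_small //.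
by rewrite addn0 binn bin0 mulr1 scale1r.
Qed.

Lemma XXC m n : hX m * hX n = hX n * hX m.
Proof.
rewrite !(hax_XX HA) addnC; congr (_%:R *: _).
by rewrite -[in LHS]bin_sub ?leq_addl ?addnK.
Qed.

Lemma YYC m n : hY m * hY n = hY n * hY m.
Proof.
rewrite !(hax_YY HA) addnC; congr (_%:R *: _).
by rewrite -[in LHS]bin_sub ?leq_addl ?addnK.
Qed.

(** The abstract form of [mu_a]: the idempotent selecting weights congruent to [a] modulo p. It is
    identified with the concrete element in [mu_wmu]. *)
Definition proj_mu a : U := E (ch a).
Local Notation mu := proj_mu.
Definition has_wt a v := mu a * v = v.
Local Notation wt := has_wt.

Let Pch := @Phi_ch _ _ hp.
Local Hint Resolve Pch : core.

Lemma mu_idem a : mu a * mu a = mu a.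
Proof. by rewrite /mu -(hax_EM HA) //; apply: E_ext => x; rewrite ch_idem. Qed.

Lemma mu_E f a : Phi f -> mu a * E f = E f * mu a.
Proof.
move=> Pf; rewrite /mu -!(hax_EM HA) //.
by apply: E_ext => x; rewrite mulrC.
Qed.

Lemma mu_per a b : (p%:Z %| a - b)%Z -> mu a = mu b.
Proof. by move=> ab; rewrite /mu (ch_per _ ab). Qed.

Lemma E_mu f a : Phi f -> pper f -> E f * mu a = f a *: mu a.
Proof.
move=> Pf pf; rewrite /mu -(hax_EM HA) // -EZ //.
by apply: E_ext => x; apply: pper_ch.
Qed.

Lemma mu_X a n : mu a * hX n = hX n * mu (a - n.*2%:Z).
Proof. by rewrite /mu (hax_EX HA) //; congr (_ * _); apply: E_ext => x; rewrite ch_shift. Qed.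

Lemma mu_Y a n : mu a * hY n = hY n * mu (a + n.*2%:Z).
Proof.
by rewrite /mu (hax_EY HA) //; congr (_ * _); apply: E_ext => x; rewrite ch_shift opprK.
Qed.

Lemma wt_E f a v : Phi f -> pper f -> wt a v -> E f * v = f a *: v.
Proof. by move=> Pf pf wv; rewrite -{1}wv mulrA E_mu // -scalerAl wv. Qed.

Lemma wt_X a n v : wt a v -> wt (a + n.*2%:Z) (hX n * v).
Proof. by move=> wv; rewrite /wt mulrA mu_X addrK -mulrA wv. Qed.

Lemma wt_Y a n v : wt a v -> wt (a - n.*2%:Z) (hY n * v).
Proof. by move=> wv; rewrite /wt mulrA mu_Y subrK -mulrA wv. Qed.

Lemma wt_per a b v : (p%:Z %| a - b)%Z -> wt a v -> wt b v.
Proof. by move=> ab; rewrite /wt (mu_per ab). Qed.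

Lemma wt_mu a : wt a (mu a).
Proof. exact: mu_idem. Qed.

Lemma wtZ a c v : wt a v -> wt a (c *: v).
Proof. by move=> wv; rewrite /wt -scalerAr wv. Qed.

Lemma wtD a u v : wt a u -> wt a v -> wt a (u + v).
Proof. by move=> wu wv; rewrite /wt mulrDr wu wv. Qed.

Lemma wt_Xn a n v : wt a v -> wt (a + n.*2%:Z) (hX 1 ^+ n * v).
Proof. by move=> wv; rewrite X_exp -scalerAl; apply/wtZ/wt_X. Qed.

Lemma wt_Yn a n v : wt a v -> wt (a - n.*2%:Z) (hY 1 ^+ n * v).
Proof. by move=> wv; rewrite Y_exp -scalerAl; apply/wtZ/wt_Y. Qed.

Lemma binz1 x : binz x 1 = x.
Proof.
by case: x => m; rewrite /binz ?bin1 // addn1 NegzE expr1 mulN1r.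
Qed.

Lemma X1_Y a n v : wt a v -> hX 1 * (hY n.+1 * v) =
  hY n.+1 * (hX 1 * v) + (a - n%:Z)%:~R *: (hY n * v).
Proof.
move=> wv; rewrite mulrA (hax_XY HA) big_mkcond big_ord_recl big_ord1 /= /bump /=.
rewrite mulrDl !subn0 !subn1 /= (hax_X0 HA) mulr1; congr (_ + _).
  rewrite -mulrA; under eq_fun do rewrite binz0.
  by rewrite (hax_E1 HA) mulr1.
rewrite -mulrA (wt_E _ _ wv); first last.
- move=> x y xy; have := pper_bin hp (1.*2%:Z - 1%N%:Z - n.+1%:Z) (prime_gt1 pP) xy.
  by rewrite !addrA.
- apply: Phi_ext (Phi_bin k (1.*2%:Z - 1%N%:Z - n.+1%:Z) 1) => x.
  by rewrite !addrA.
by rewrite -scalerAr binz1; congr (_%:~R *: _); rewrite -[1.*2]/2%N; lia.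
Qed.

Lemma X1_Yn a n v : wt a v -> hX 1 * (hY 1 ^+ n * v) =
  hY 1 ^+ n * (hX 1 * v) + (n%:R * (a - n%:Z + 1)%:~R) *: (hY 1 ^+ n.-1 * v).
Proof.
case: n => [|n] wv; first by rewrite !expr0 !mul1r mul0r scale0r addr0.
rewrite !Y_exp -!scalerAl -scalerAr (X1_Y _ wv) scalerDr; congr (_ + _).
rewrite !scalerA; congr (_ *: _); rewrite factS natrM.
by have -> : a - n.+1%:Z + 1 = a - n%:Z by [lia]; ring.
Qed.

Lemma hXn_Y a n v : wt a v -> hX n.+1 * (hY 1 * v) =
  hY 1 * (hX n.+1 * v) + (a + n%:Z)%:~R *: (hX n * v).
Proof.
move=> wv; rewrite mulrA (hax_XY HA) big_mkcond /= 2!big_ord_recl big1 /= => [|i _]; last first.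
  by [].
rewrite addr0 /bump /= !subn0 !subn1 /= (hax_Y0 HA) mul1r mulrDl; congr (_ + _).
  rewrite -!mulrA; under eq_fun do rewrite binz0.
  by rewrite (hax_E1 HA) mul1r.
rewrite -mulrA (wt_E _ _ (wt_X n wv)); first last.
- move=> x y xy; have := pper_bin hp (1.*2%:Z - n.+1%:Z - 1%N%:Z) (prime_gt1 pP) xy.
  by rewrite !addrA.
- apply: Phi_ext (Phi_bin k (1.*2%:Z - n.+1%:Z - 1%N%:Z) 1) => x.
  by rewrite !addrA.
by rewrite binz1; congr (_%:~R *: _); rewrite -[1.*2]/2%N -addnn; lia.
Qed.

Lemma hYn_X a n v : wt a v -> hY n.+1 * (hX 1 * v) =
  hX 1 * (hY n.+1 * v) - (a - n%:Z)%:~R *: (hY n * v).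
Proof. by move=> wv; rewrite (X1_Y _ wv) addrK. Qed.

(* The eigenvalues of YX along the weight string: on a vector [v] of weight [a],
   [Y^(m+1) X^(m+1) v = Y^m X^m (YX - gam m) v], and similarly for [X^m Y^m]. *)
Definition gam (a i : int) : k := (i * (a + i + 1))%:~R.

Definition yx_act (f : {poly k}) : U := horner_alg (hY 1 * hX 1) f.

Local Notation act := yx_act.

Lemma act1 : act 1 = 1. Proof. exact: rmorph1. Qed.
Lemma actD f g : act (f + g) = act f + act g. Proof. exact: rmorphD. Qed.
Lemma actM f g : act (f * g) = act f * act g. Proof. exact: rmorphM. Qed.
Lemma actC c : act c%:P = c%:A. Proof. exact: horner_algC. Qed.
Lemma actX : act 'X = hY 1 * hX 1. Proof. exact: horner_algX. Qed.
Lemma actZ c f : act (c *: f) = c *: act f.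
Proof. by rewrite -mul_polyC actM actC -scalerAl mul1r. Qed.
Lemma act_sum (I : Type) (s : seq I) P F :
  act (\sum_(i <- s | P i) F i) = \sum_(i <- s | P i) act (F i).
Proof. exact: raddf_sum. Qed.

Lemma wt_act a f v : wt a v -> wt a (act f * v).
Proof.
elim/poly_ind: f v => [|f c IHf] v wv; first by rewrite /act rmorph0 mul0r /wt mulr0.
rewrite actD actM actX actC mulrDl; apply: wtD; last first.
  by rewrite -scalerAl mul1r; apply: wtZ.
rewrite -mulrA; apply: IHf; rewrite -mulrA.
apply: (@wt_per (a + 1.*2%:Z - 1.*2%:Z)); first by rewrite addrK subrr.
exact/wt_Y/wt_X.
Qed.

Lemma YX_Xn_Yn a m v : wt (a + m.*2%:Z) v ->
  hY 1 * (hX 1 * (hY 1 ^+ m * v)) =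
  hY 1 ^+ m.+1 * (hX 1 * v) + gam a m *: (hY 1 ^+ m * v).
Proof.
move=> wv; rewrite (X1_Yn _ wv) mulrDr mulrA -exprS; congr (_ + _).
case: m wv => [|m] wv /=; first by rewrite mul0r scale0r mulr0 /gam mul0r scale0r.
rewrite -scalerAr mulrA -exprS; congr (_ *: _).
rewrite /gam -[m.+1%:R]/(m.+1%:Z%:~R) -rmorphM; congr (_%:~R).
by rewrite -addnn; lia.
Qed.

Lemma XY_Yj a j v : wt a v ->
  hX 1 * (hY 1 ^+ j.+1 * v) = hY 1 ^+ j * ((act ('X - (gam a (- j.+1%:Z))%:P)) * v).
Proof.
move=> wv; rewrite (X1_Yn _ wv) actD actX -polyCN actC /= exprSr mulrDl mulrDr -!mulrA.
congr (_ + _); rewrite -scalerAl mul1r -scalerAr; congr (_ *: _).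
rewrite -[j.+1%:R]/(j.+1%:Z%:~R) -rmorphM -rmorphN; congr (_%:~R).
by lia.
Qed.

Lemma XjYj a j v : wt a v ->
  hX 1 ^+ j * (hY 1 ^+ j * v) = act (\prod_(i < j) ('X - (gam a (- i.+1%:Z))%:P)) * v.
Proof.
elim: j v => [|j IHj] v wv; first by rewrite big_ord0 act1 !mul1r.
rewrite exprSr -mulrA (XY_Yj _ wv) IHj; last exact: wt_act.
by rewrite mulrA -actM big_ord_recr.
Qed.

Lemma YX_Xq a q v : wt a v ->
  hY 1 * (hX 1 ^+ q.+1 * v) = hX 1 ^+ q * (act ('X - (gam a q)%:P) * v).
Proof.
elim: q v => [|q IHq] v wv.
  by rewrite expr0 expr1 !mul1r actD actX -polyCN actC /gam mul0r oppr0 scale0r addr0 mulrA.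
have := X1_Yn 1 (wt_Xn q.+1 wv); rewrite expr1 expr0 !mul1r [hX 1 ^+ q.+2]exprS -mulrA.
move/eqP; rewrite -subr_eq => /eqP <-.
have aE g : act ('X - g%:P) * v = act 'X * v - g *: v.
  by rewrite actD -polyCN actC mulrDl -scalerAl mul1r scaleNr.
rewrite (IHq _ wv) !aE mulrA -exprS !mulrBr -!scalerAr -addrA -opprD -scalerDl.
congr (_ - _ *: _); rewrite /gam -rmorphD; congr (_%:~R).
by rewrite -addnn; lia.
Qed.

End Hyper.

(** * The map Fr' and its commutation with divided powers *)

Section Frobenius.
Variables (k : fieldType) (p : nat).
Hypothesis hp : p \in [pchar k].
Variables (U : algType k) (hX hY : nat -> U) (E : (int -> k) -> U).
Hypothesis HA : hyper_axioms hX hY E.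

Definition flr (f : int -> k) (x : int) : k := f (x %/ p%:Z)%Z.

Lemma Phi_flr f : Phi f -> Phi (flr f).
Proof. exact: Phi_floor hp f. Qed.

Lemma box_free M (f : nat -> nat -> int -> k) : (forall m l, Phi (f m l)) ->
  \sum_(m < M) \sum_(l < M) hY m * E (f m l) * hX l = 0 ->
  forall m l, (m < M)%N -> (l < M)%N -> f m l = fun=> 0.
Proof.
move=> Pf s0 m l mM lM; apply/funext => x.
pose s := [seq (m', l') | m' <- index_iota 0 M, l' <- index_iota 0 M].
have H := @hax_free _ _ _ _ _ HA s (fun i => f i.1 i.2).
apply: (H _ _ _ (m, l) x) => //.
- by rewrite /s allpairs_uniq ?iota_uniq // => -[? ?] [? ?].
- rewrite big_allpairs big_mkord -[RHS]s0; apply: eq_bigr => i _.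
  by rewrite big_mkord.
- by apply/allpairsP; exists (m, l); rewrite !mem_index_iota.
Qed.

(** By PBW an element determines the functions in its expansion, so prescribing the image of each
    monomial is consistent once two expansions are padded to the same range. *)
Lemma Fr_exists : exists F : U -> U, linear F /\
  forall m f l, Phi f ->
    F (hY m * E f * hX l) = hY (m * p) * E (flr f) * hX (l * p).
Proof.
pose T m l f := hY m * E f * hX l.
pose T' m l f := hY (m * p) * E (flr f) * hX (l * p).
have T0 m l : T m l (fun=> 0) = 0 by rewrite /T (E0 HA) mulr0 mul0r.
have T0' m l : T' m l (fun=> 0) = 0.
  by rewrite /T' (_ : flr _ = fun=> 0) // (E0 HA) mulr0 mul0r.
have Tlin m l a f g : Phi f -> Phi g ->
    T m l (fun x => a * f x + g x) = a *: T m l f + T m l g.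
  move=> Pf Pg; rewrite /T (hax_Elin HA) // mulrDr mulrDl.
  by rewrite -scalerAr -scalerAl.
have Tlin' m l a f g : Phi f -> Phi g ->
    T' m l (fun x => a * f x + g x) = a *: T' m l f + T' m l g.
  move=> Pf Pg; rewrite /T' (hax_Elin HA a (Phi_flr Pf) (Phi_flr Pg)) mulrDr mulrDl.
  by rewrite -scalerAr -scalerAl.
pose S M (f : nat -> nat -> int -> k) := \sum_(m < M) \sum_(l < M) T m l (f m l).
pose S' M (f : nat -> nat -> int -> k) := \sum_(m < M) \sum_(l < M) T' m l (f m l).
pose wid M (f : nat -> nat -> int -> k) (m l : nat) :=
  if (m < M)%N && (l < M)%N then f m l else fun=> 0.
have Pwid M f : (forall m l, Phi (f m l)) -> forall m l, Phi (wid M f m l).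
  by move=> Pf m l; rewrite /wid; case: ifP => _; [exact: Pf | exact: Phi_const].
have comb a M N f g : (forall m l, Phi (f m l)) -> (forall m l, Phi (g m l)) ->
  exists K h, [/\ forall m l, Phi (h m l), a *: S M f + S N g = S K h
     & a *: S' M f + S' N g = S' K h].
  move=> Pf Pg; exists (maxn M N), (fun m l x => a * wid M f m l x + wid N g m l x).
  split; first by move=> m l; apply: Phi_lin; apply: Pwid.
    rewrite /S (box_widen f T0 (leq_maxl M N)) (box_widen g T0 (leq_maxr M N)).
    rewrite scaler_sumr -big_split; apply: eq_bigr => m _ /=.
    rewrite scaler_sumr -big_split; apply: eq_bigr => l _ /=.
    by rewrite -Tlin //; apply: Pwid.
  rewrite /S' (box_widen f T0' (leq_maxl M N)) (box_widen g T0' (leq_maxr M N)).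
  rewrite scaler_sumr -big_split; apply: eq_bigr => m _ /=.
  rewrite scaler_sumr -big_split; apply: eq_bigr => l _ /=.
  by rewrite -Tlin' //; apply: Pwid.
have SE M N f g : (forall m l, Phi (f m l)) -> (forall m l, Phi (g m l)) ->
    S M f = S N g -> S' M f = S' N g.
  move=> Pf Pg SS; have [K [h [Ph e e']]] := comb (-1) M N f g Pf Pg.
  apply/esym/eqP; rewrite -subr_eq0 addrC -scaleN1r e'; apply/eqP.
  have h0 : S K h = 0 by rewrite -e SS scaleN1r addNr.
  rewrite /S' big1 // => m _; rewrite big1 // => l _.
  by rewrite (box_free Ph h0) ?T0'.
pose F u := xget 0 [set w : U | exists M f,
  [/\ forall m l, Phi (f m l), u = S M f & w = S' M f]]%classic.
have FS M f : (forall m l, Phi (f m l)) -> F (S M f) = S' M f.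
  move=> Pf; rewrite /F; case: xgetP => [w -> [N [g [Pg e ->]]]|].
    exact: SE.
  by move/(_ (S' M f)); case; exists M, f.
exists F; split=> [a u v|m f l Pf].
  have [M [f [Pf ->]]] := hax_span HA u; have [N [g [Pg ->]]] := hax_span HA v.
  rewrite -/(S M f) -/(S N g).
  have [K [h [Ph e e']]] := comb a M N f g Pf Pg.
  by rewrite e !FS // e'.
pose K := (maxn m l).+1.
have mK : (m < K)%N by rewrite ltnS leq_maxl.
have lK : (l < K)%N by rewrite ltnS leq_maxr.
pose h i j := if (i == m) && (j == l) then f else fun=> 0.
have Ph i j : Phi (h i j) by rewrite /h; case: ifP => _ //; apply: Phi_const.
have SK (R : nat -> nat -> (int -> k) -> U) : (forall i j, R i j (fun=> 0) = 0) ->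
    \sum_(i < K) \sum_(j < K) R i j (h i j) = R m l f.
  move=> R0; rewrite (bigD1 (Ordinal mK)) //= (bigD1 (Ordinal lK)) //=.
  rewrite /h !eqxx /= big1 => [|j nj]; last first.
    by rewrite -val_eqE /= in nj; rewrite (negbTE nj) R0.
  rewrite big1 ?addr0 // => i ni; rewrite -val_eqE /= in ni.
  by rewrite big1 // => j _; rewrite (negbTE ni) /= R0.
by rewrite -[LHS](congr1 F (SK T T0)) [LHS]FS // [LHS](SK T' T0').
Qed.

Variable Fr : U -> U.
Hypothesis Fr_lin : linear Fr.
Hypothesis FrE : forall m f l, Phi f ->
  Fr (hY m * E f * hX l) = hY (m * p) * E (flr f) * hX (l * p).

Lemma Fr0 : Fr 0 = 0.
Proof. by have := Fr_lin (-1) 0 0; rewrite scaler0 addr0 scaleN1r addNr. Qed.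
Lemma FrD u v : Fr (u + v) = Fr u + Fr v.
Proof. by have := Fr_lin 1 u v; rewrite !scale1r. Qed.
Lemma FrZ a u : Fr (a *: u) = a *: Fr u.
Proof. by have := Fr_lin a u 0; rewrite !addr0 Fr0 addr0. Qed.
Lemma Fr_sum (I : Type) (s : seq I) P F :
  Fr (\sum_(i <- s | P i) F i) = \sum_(i <- s | P i) Fr (F i).
Proof. exact: (big_morph _ FrD Fr0). Qed.

Lemma span_ind (P : U -> Prop) : P 0 ->
    (forall a u v, P u -> P v -> P (a *: u + v)) ->
    (forall m f l, Phi f -> P (hY m * E f * hX l)) -> forall u, P u.
Proof.
move=> P0 Pl Pm u; have [M [f [Pf ->]]] := hax_span HA u.
have PD v w : P v -> P w -> P (v + w) by move=> Pv Pw; rewrite -[v]scale1r; apply: Pl.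
apply: (big_ind P) => // m _; apply: (big_ind P) => // l _; exact: Pm.
Qed.

Lemma Fr_lin_ext (A B A' B' : U) :
    (forall m f l, Phi f ->
      A * (hY (m * p) * E (flr f) * hX (l * p)) * B
        = A' * (hY (m * p) * E (flr f) * hX (l * p)) * B') ->
  forall z, A * Fr z * B = A' * Fr z * B'.
Proof.
move=> H; elim/span_ind => [|a u v IHu IHv|m f l Pf].
- by rewrite Fr0 !mulr0 !mul0r.
- by rewrite Fr_lin !mulrDr !mulrDl -!scalerAr -!scalerAl IHu IHv.
- by rewrite FrE // H.
Qed.

Local Notation mu := (@proj_mu k p U E).
Local Notation wt := (@has_wt k p U E).

Let pP : prime p := pcharf_prime hp.
Let p0 : (0 < p)%N := prime_gt0 pP.
Let Pch := @Phi_ch _ _ hp.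

(** The image of Fr' changes weights by multiples of 2p only. *)
Lemma mu_Fr a z : mu a * Fr z = Fr z * mu a.
Proof.
have H z' : mu a * Fr z' * 1 = 1 * Fr z' * mu a; last first.
  by have := H z; rewrite mulr1 mul1r.
apply: Fr_lin_ext => m f l Pf; rewrite mulr1 mul1r.
rewrite !mulrA (mu_Y hp HA) -[_ * mu _ * E _]mulrA (mu_E hp HA _ (Phi_flr Pf)).
rewrite -!mulrA (mu_X hp HA); congr (_ * (_ * (_ * _))).
apply: mu_per; apply/dvdzP; exists (2 * m%:Z - 2 * l%:Z).
by rewrite -!muln2 !PoszM; ring.
Qed.

Lemma YFr c z : hY (c * p) * Fr z = Fr (hY c * z).
Proof.
elim/span_ind: z => [|a u v IHu IHv|m f l Pf].
- by rewrite Fr0 !mulr0 Fr0.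
- by rewrite mulrDr -scalerAr !Fr_lin mulrDr -scalerAr IHu IHv.
by rewrite FrE // !mulrA !(hax_YY HA) -!scalerAl FrZ FrE // (bin_pp hp) mulnDl.
Qed.

Lemma sum_multiples (V : nmodType) (T : nat -> V) c :
  (forall i, ~~ (p %| i)%N -> T i = 0) ->
  \sum_(i < (c * p).+1) T i = \sum_(i < c.+1) T (i * p)%N.
Proof.
move=> T0; elim: c => [|c IHc]; first by rewrite mul0n !big_ord1 mul0n.
rewrite [RHS]big_ord_recr -IHc /= -!(big_mkord xpredT T).
rewrite (big_cat_nat _ _ (n := (c * p).+1)) //=; last by rewrite ltnS mulSn leq_addl.
congr (_ + _); rewrite big_nat_recr /=; last first.
  by rewrite mulSn -[X in (X < _)%N]add0n ltn_add2r.
rewrite big_nat_cond big1 ?add0r // => i /andP [/andP [ci ic] _].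
apply: T0; apply/negP => /dvdnP [q iq]; move: ci ic; rewrite iq !ltn_mul2r p0 /=.
by lia.
Qed.

Lemma modn_subMl c i : (i <= c * p)%N -> (0 < i %% p)%N ->
  ((c * p - i) %% p = p - i %% p)%N.
Proof.
move=> ic i0; have lt : (i %/ p < c)%N.
  rewrite ltnNge; apply/negP => ci; move: ic; rewrite {1}(divn_eq i p).
  by apply/negP; rewrite -ltnNge; apply: leq_ltn_trans (leq_mul ci (leqnn p)) _; lia.
have -> : (c * p - i = (c - (i %/ p).+1) * p + (p - i %% p))%N.
  have : ((i %/ p).+1 * p <= c * p)%N by rewrite leq_mul2r lt orbT.
  have := ltn_pmod i p0; rewrite {3}(divn_eq i p) mulnBl mulSn; lia.
by rewrite modnMDl modn_small // ltn_subrL i0 p0.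
Qed.

Lemma wt_E0 f a v : Phi f -> wt a v ->
  (forall x, (p%:Z %| x - a)%Z -> f x = 0) -> E f * v = 0.
Proof.
move=> Pf wv f0; rewrite -wv mulrA -(hax_EM HA) //.
rewrite (E_ext _ (g := fun=> 0)) ?(E0 HA) ?mul0r // => x.
rewrite /ind_mod; case: (boolP (p%:Z %| _)%Z) => [/f0 ->|_]; rewrite ?mul0r ?mulr0 //.
Qed.

Lemma wt_Ef f a v : Phi f -> wt a v -> wt a (E f * v).
Proof. by move=> Pf wv; rewrite /has_wt mulrA (mu_E hp HA) // -mulrA wv. Qed.

(* [b] behaves like a vector of weight [a0] in [0, p) killed by [X^(p)]. *)
Lemma XFr a0 b c z : (a0 < p)%N -> wt a0%:Z b ->
    (forall K, (p - a0 <= K %% p)%N -> hX K * b = 0) ->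
  hX (c * p) * (Fr z * b) = Fr (hX c * z) * b.
Proof.
move=> a0p wb Xb; elim/span_ind: z => [|a u v IHu IHv|m f l Pf].
- by rewrite mulr0 Fr0 !mul0r mulr0.
- by rewrite mulrDr -scalerAr !Fr_lin !mulrDl mulrDr -!scalerAl -scalerAr IHu IHv.
rewrite FrE // !mulrA !(hax_XY HA) !mulr_suml Fr_sum mulr_suml.
pose g c m i x : k := (binz (x + i.*2%:Z - c%:Z - m%:Z) i)%:~R.
have Pg c' m' i : Phi (g c' m' i).
  by apply: Phi_ext (Phi_bin k (i.*2%:Z - c'%:Z - m'%:Z) i) => x; rewrite /g !addrA.
pose T i := if (i <= c * p)%N && (i <= m * p)%N then
   hY (m * p - i) * E (g (c * p)%N (m * p)%N i) * hX (c * p - i) * E (flr f) * hX (l * p) * b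
   else 0.
transitivity (\sum_(i < (c * p).+1) T i).
  by rewrite big_mkcond; apply: eq_bigr => i _; rewrite /T leq_ord.
rewrite sum_multiples => [|i pi]; last first.
  rewrite /T; case: ifP => // /andP [ic im].
  have i0 : (0 < i %% p)%N by rewrite lt0n.
  have ii : (i %% p < p)%N by rewrite ltn_mod.
  have wX : wt (a0%:Z + (l * p).*2%:Z) (hX (l * p) * b) by exact: (wt_X hp HA (l * p) wb).
  (* Indices not divisible by p contribute nothing. If the last digit of [i] is at most [a0], then
     [X^(cp-i)] has last digit at least [p - a0] and, moved to the right, kills [b]. Otherwise the
     upper argument of the binomial has last digit [a0], smaller than that of [i], and Lucas gives
     0. *)
  rewrite -!mulrA; have [si|is_] := leqP (i %% p) a0.
    rewrite (mulrA (hX (c * p - i)) (E _)) (XE HA _ (Phi_flr Pf)) -mulrA.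
    rewrite (mulrA (hX (c * p - i))) (XXC HA) -mulrA Xb ?mulr0 //.
    by rewrite modn_subMl //; lia.
  rewrite [E _ * _](wt_E0 (Pg _ _ _) (wt_X hp HA _ (wt_Ef (Phi_flr Pf) wX))) ?mulr0 // => x xa.
  rewrite /g (binz_lucas hp) [X in _ * X%:R]bin_small ?mulr0 //.
  suff -> : hat p (x + i.*2 - (c * p)%N%:Z - (m * p)%N%:Z) = a0 by [].
  case/dvdzP: xa => q xq; have -> : x + i.*2%:Z - (c * p)%N%:Z - (m * p)%N%:Z =
      (q + 2 * l%:Z + c%:Z - m%:Z) * p%:Z + a0%:Z.
    have -> : x = q * p%:Z + (a0%:Z + (l * p).*2%:Z + (c * p - i).*2%:Z) by rewrite -xq; lia.
    by rewrite -!addnn !PoszD !PoszM -subzn // PoszM; ring.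
  exact: hat_digit.
rewrite [RHS]big_mkcond; apply: eq_bigr => i _.
rewrite /T !leq_pmul2r // leq_ord /=; case: ifP => // im.
have Pf' : Phi (fun x => f (x - (c - i).*2%:Z)) by exact: Phi_shift.
rewrite -[_ * hX (c - i) * _]mulrA (XE HA _ Pf) mulrA.
rewrite -[fun x => (binz (x + i.*2%:Z - c%:Z - m%:Z) i)%:~R]/(g c m i).
rewrite -[_ * E (g c m i) * E _]mulrA -(hax_EM HA) // -[_ * hX (c - i) * _]mulrA (hax_XX HA) -scalerAr FrZ FrE; last exact: PhiM.
rewrite -[_ * hX (c * p - _) * _]mulrA (XE HA _ (Phi_flr Pf)) mulrA.
rewrite -[_ * E (g (c * p)%N _ _) * E _]mulrA -(hax_EM HA) //; last by apply: Phi_shift; apply: Phi_flr.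
rewrite -[_ * hX (c * p - _) * hX _]mulrA -!mulnBl (hax_XX HA) (bin_pp hp) -mulnDl -!scalerAr.
congr (_ *: (_ * _ * _) * _); apply: E_ext => x; rewrite /flr /g.
have -> : x + (i * p).*2%:Z - (c * p)%N%:Z - (m * p)%N%:Z =
    (2 * i%:Z - c%:Z - m%:Z) * p%:Z + x by rewrite -addnn PoszD !PoszM; ring.
have -> : x - ((c - i) * p).*2%:Z = (- (2 * (c - i)%N%:Z)) * p%:Z + x.
  by rewrite -addnn PoszD !PoszM; ring.
have pz : p%:Z != 0 by rewrite -lt0n.
rewrite !divzMDl //; congr (_ * f _); last by rewrite -addnn PoszD; ring.
rewrite (binz_lucas hp) mulnK // modnMl bin0 mulr1 divzMDl //.
by congr (binz _ _)%:~R; rewrite -addnn PoszD; ring.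
Qed.

Lemma XY_comm c m v :
    (forall i, (0 < i)%N -> (i <= m)%N -> (i <= c * p)%N ->
      E (fun x => (binz (x + i.*2%:Z - (c * p)%N%:Z - m%:Z) i)%:~R)
        * (hX (c * p - i) * v) = 0) ->
  hX (c * p) * (hY m * v) = hY m * (hX (c * p) * v).
Proof.
move=> H; rewrite mulrA (hax_XY HA) big_mkcond big_ord_recl /= subn0 mulrDl.
rewrite mulr_suml big1 => [|i _]; last first.
  case: ifP => im; rewrite ?mul0r // -!mulrA H ?mulr0 //.
rewrite addr0 subn0 -!mulrA; under eq_fun do rewrite binz0.
by rewrite (hax_E1 HA) mul1r.
Qed.

(** The correction terms contain [X^(cp-i) X^(n)] with [0 < i <= m <= n]; adding these exponents
    produces a carry, so the product is zero. *)
Lemma XY_comm_carry c m n v : (m <= n)%N -> (n < p)%N ->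
  hX (c * p) * (hY m * (hX n * v)) = hY m * (hX (c * p) * (hX n * v)).
Proof.
move=> mn np; apply: XY_comm => i i0 im ic; rewrite (mulrA (hX _)) (XX_carry hp HA).
  by rewrite mul0r mulr0.
have ip : (i %% p = i)%N by rewrite modn_small //; lia.
rewrite modn_subMl ?ip // (modn_small np); lia.
Qed.

Lemma YX_comm c m n : (n <= m)%N -> (m < p)%N ->
  hY m * hX n * hY (c * p) = hY m * hY (c * p) * hX n.
Proof.
move=> nm mp; rewrite -mulrA (hax_XY HA) big_mkcond big_ord_recl /= !subn0 mulrDr.
rewrite mulr_sumr big1 => [|i _]; last first.
  have ilt := ltn_ord i; case: ifP => im; rewrite ?mulr0 // !mulrA (YY_carry hp HA) ?mul0r //.
  have ip : ((bump 0 i) %% p = bump 0 i)%N by rewrite modn_small // /bump /=; lia.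
  rewrite modn_subMl ?ip // (modn_small mp) /bump /=; lia.
rewrite addr0 !mulrA; under eq_fun do rewrite binz0.
by rewrite (hax_E1 HA) mulr1.
Qed.

Lemma YX_E m f : Phi f -> hY m * hX m * E f = E f * (hY m * hX m).
Proof.
move=> Pf; rewrite -mulrA (XE HA _ Pf) mulrA (YE HA); last exact: Phi_shift.
by rewrite -mulrA; congr (_ * _); apply: E_ext => x; rewrite addrK.
Qed.

Lemma YX_Fr m z : (m < p)%N -> hY m * hX m * Fr z = Fr z * (hY m * hX m).
Proof.
move=> mp.
have H z' : hY m * hX m * Fr z' * 1 = 1 * Fr z' * (hY m * hX m); last first.
  by have := H z; rewrite mulr1 mul1r.
apply: Fr_lin_ext => m' f l Pf; rewrite mulr1 mul1r !mulrA YX_comm // (YYC HA).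
have := XY_comm_carry l 1 (leqnn m) mp; rewrite !mulr1 => H.
rewrite -[RHS]mulrA -[X in _ = X * _]mulrA -!mulrA (mulrA (hY m)) H.
rewrite -!mulrA; congr (_ * _); rewrite !mulrA YX_E; last exact: Phi_flr.
by rewrite -!mulrA (XXC HA).
Qed.

End Frobenius.

(** * Newton interpolation with arbitrary nodes *)

Section Newton.
Variables (R : comNzRingType) (g : nat -> R).

Definition rprod (i j : nat) : {poly R} := \prod_(i <= l < j) ('X - (g l)%:P).

Lemma rprod_cat i j l : (i <= j)%N -> (j <= l)%N -> rprod i j * rprod j l = rprod i l.
Proof. by move=> ij jl; rewrite /rprod -big_cat_nat. Qed.

Lemma rprod_nil i : rprod i i = 1.
Proof. by rewrite /rprod big_geq. Qed.

Lemma rprodS i j : (i <= j)%N -> rprod i j.+1 = rprod i j * ('X - (g j)%:P).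
Proof. by move=> ij; rewrite /rprod big_nat_recr. Qed.

Lemma rprod_recl i j : (i < j)%N -> rprod i j = ('X - (g i)%:P) * rprod i.+1 j.
Proof. by move=> ij; rewrite /rprod big_ltn. Qed.

(** Divide successively by the linear factors at the nodes of index [n], [n + 1], and so on; the
    remainders are the coefficients. *)
Lemma newton (h : {poly R}) n M : (n <= M)%N -> exists (c : nat -> R) h',
  h = \sum_(n <= m < M) c m *: rprod n m + h' * rprod n M.
Proof.
move=> /subnKC <-; elim: (M - n)%N => [|d [c [h' IHd]]].
  by exists (fun=> 0), h; rewrite addn0 big_geq // rprod_nil mulr1 add0r.
have [q [r rE]] : exists q (r : R), h' = q * ('X - (g (n + d))%:P) + r%:P.
  have /factor_theorem [q qE] : root (h' - (h'.[g (n + d)])%:P) (g (n + d)).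
    by rewrite /root !hornerE subrr.
  by exists q, h'.[g (n + d)]; rewrite -qE subrK.
exists (fun m => if m == (n + d)%N then r else c m), q.
rewrite addnS big_nat_recr ?leq_addr //= eqxx rprodS ?leq_addr //.
rewrite {1}IHd {1}rE [in RHS](eq_big_nat _ _ (F2 := fun m => c m *: rprod n m)); last first.
  by move=> m /andP [_ mlt]; rewrite ltn_eqF.
by rewrite -!mul_polyC; ring.
Qed.

Lemma newton_lead (h h' : {poly R}) (c : nat -> R) n M : (n < M)%N ->
  h = \sum_(n <= m < M) c m *: rprod n m + h' * rprod n M -> c n = h.[g n].
Proof.
move=> nM ->; have E m : (n < m)%N -> (rprod n m).[g n] = 0.
  by move=> nm; rewrite rprod_recl // hornerM !hornerE subrr mul0r.
rewrite hornerD hornerM E // mulr0 addr0 big_ltn // hornerD hornerZ rprod_nil hornerC mulr1.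
rewrite horner_sum big_nat_cond big1 ?addr0 // => m /andP [/andP [nm _] _].
by rewrite hornerZ E // mulr0.
Qed.

End Newton.

(** * The summands of Z^(epsilon) under [YX] *)

Section ZMap.
Variables (k : fieldType) (p : nat).
Hypothesis hp : p \in [pchar k].
Variables (U : algType k) (hX hY : nat -> U) (E : (int -> k) -> U).
Hypothesis HA : hyper_axioms hX hY E.
Variable Fr : U -> U.
Hypothesis Fr_lin : linear Fr.
Hypothesis FrE : forall m f l, Phi f ->
  Fr (hY m * E f * hX l) = hY (m * p) * E (flr p f) * hX (l * p).

Local Notation mu := (@proj_mu k p U E).
Local Notation wt := (@has_wt k p U E).
Local Notation act := (yx_act hX hY).
Local Notation X := (hX 1).
Local Notation Y := (hY 1).
Let pP : prime p := pcharf_prime hp.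

Variables (a : int) (s : nat).
Local Notation gm := (fun i : nat => gam k a i).
Local Notation e := (rprod gm).

(** The summand of index [m] in the definition of Z^(epsilon), with the idempotent moved to the
    right (see [mu_Wz]). *)
Definition Wz m z : U := Y ^+ m * (X ^+ (m - s) * (Fr z * (X ^+ s * mu a))).

Lemma wt_Fr b z v : wt b v -> wt b (Fr z * v).
Proof. by move=> wv; rewrite /has_wt mulrA (mu_Fr hp HA Fr_lin FrE) -mulrA wv. Qed.

Lemma wt_XFr m z : (s <= m)%N -> wt (a + m.*2%:Z) (X ^+ (m - s) * (Fr z * (X ^+ s * mu a))).
Proof.
move=> sm; have := wt_Xn hp HA (m - s) (wt_Fr z (wt_Xn hp HA s (wt_mu hp HA a))).
by congr (has_wt _ _ _); rewrite -!addnn; lia.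
Qed.

Lemma wt_Wz m z : (s <= m)%N -> wt a (Wz m z).
Proof. by move=> sm; have := wt_Yn hp HA m (wt_XFr z sm); rewrite addrK. Qed.

Lemma Wz_lin m c z z' : Wz m (c *: z + z') = c *: Wz m z + Wz m z'.
Proof. by rewrite /Wz Fr_lin mulrDl !mulrDr -scalerAl -!scalerAr. Qed.

Lemma YX_Wz m z : (s <= m)%N -> Y * (X * Wz m z) = Wz m.+1 z + gm m *: Wz m z.
Proof.
move=> sm; rewrite /Wz (YX_Xn_Yn hp HA (wt_XFr z sm)); congr (_ * _ + _).
by rewrite mulrA -exprS -subSn.
Qed.

(** Iterating [YX_Wz]. Hence every combination of the [Wz m z] is a polynomial in [YX] applied to
    [Wz s z], and the vanishing of [Wz p z] makes the product over the whole range from [s] to [p]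
    act as zero. *)
Lemma act_Wz i m z : (s <= i)%N -> (i <= m)%N -> act (e i m) * Wz i z = Wz m z.
Proof.
move=> si /subnKC <-; elim: (m - i)%N => [|d IHd]; first by rewrite addn0 rprod_nil act1 mul1r.
rewrite addnS rprodS ?leq_addr // mulrC actM -mulrA IHd actD actX -polyCN actC mulrDl.
rewrite -mulrA YX_Wz ?(leq_trans si) ?leq_addr // -scalerAl mul1r.
by rewrite scaleNr addrK.
Qed.

Lemma Wz_p m z : (p <= m)%N -> Wz m z = 0.
Proof. by move=> pm; rewrite /Wz (Y_p hp HA) // mul0r. Qed.

Lemma act_Wz_sum (h : {poly k}) i : (s <= i)%N -> (i <= p)%N ->
  exists c : nat -> k, (forall z, act h * Wz i z = \sum_(i <= m < p) c m *: Wz m z) /\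
    ((i < p)%N -> c i = h.[gm i]).
Proof.
move=> si ip; have [c [h' hE]] := newton gm h ip.
exists c; split=> [z|ip']; last exact: newton_lead ip' hE.
rewrite {1}hE actD actM mulrDl -mulrA act_Wz // (Wz_p z (leqnn p)) mulr0 addr0 act_sum mulr_suml.
rewrite big_nat_cond [RHS]big_nat_cond; apply: eq_bigr => m /andP [/andP [im _] _].
by rewrite (actZ _ _ (c m)) -scalerAl act_Wz.
Qed.

Lemma Y_kill (h : {poly k}) i q z : (s <= i)%N -> (i <= p)%N -> (p <= q + i)%N ->
  Y ^+ q * (act h * Wz i z) = 0.
Proof.
move=> si ip le; have [c [-> _]] := act_Wz_sum h si ip.
rewrite mulr_sumr big_nat_cond big1 // => m /andP [/andP [im _] _].
by rewrite -scalerAr /Wz (mulrA (Y ^+ q)) -exprD (Y_p hp HA) ?mul0r ?scaler0 //; lia.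
Qed.

Lemma gam_per i j : (p%:Z %| i - j)%Z -> gam k a i = gam k a j.
Proof.
case/dvdzP => q ij; apply/eqP; rewrite -subr_eq0 /gam -rmorphB.
have -> : i = q * p%:Z + j by lia.
have -> : (q * p%:Z + j) * (a + (q * p%:Z + j) + 1) - j * (a + j + 1) =
  (q * (a + q * p%:Z + j + 1) + j * q) * p%:Z by ring.
by rewrite rmorphM /= -[p%:Z%:~R]/(p%:R) (pcharf0 hp) mulr0.
Qed.

(** [gam] is p-periodic, so the roots at -1, ..., -j belonging to [X^j Y^j] are those at the last
    [j] indices below p. A polynomial containing these factors thus yields a left multiple of [X^j],
    which bounds the powers of X that survive ([X_kill]). *)
Lemma XY_e j w : wt a w -> (j <= p)%N ->
  X ^+ j * (Y ^+ j * w) = act (e (p - j) p) * w.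
Proof.
move=> ww jp; rewrite (XjYj hp HA _ ww); congr (act _ * _).
rewrite /rprod -{1}[(p - j)%N]add0n big_addn subKn // big_mkord.
rewrite (reindex_inj rev_ord_inj) /=; apply: eq_bigr => i _; congr (_ - _%:P).
apply: gam_per; have ij := ltn_ord i; apply/dvdzP; exists (-1).
by lia.
Qed.

Lemma X_kill (h : {poly k}) j q w : wt a w -> (j <= p)%N -> (p <= q + j)%N ->
  X ^+ q * (act (e (p - j) p * h) * w) = 0.
Proof.
move=> ww jp le; rewrite actM -mulrA -XY_e //; last exact: (wt_act hp HA _ ww).
by rewrite mulrA -exprD (X_p hp HA) ?mul0r.
Qed.

End ZMap.

(** * The maps Z^(0) and Z^(1) of a single pair *)

Section ZData.
Variables (k : fieldType) (p : nat).
Hypothesis hp : p \in [pchar k].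
Variables (U : algType k) (hX hY : nat -> U) (E : (int -> k) -> U).
Hypothesis HA : hyper_axioms hX hY E.
Variable Fr : U -> U.
Hypothesis Fr_lin : linear Fr.
Hypothesis FrE : forall m f l, Phi f ->
  Fr (hY m * E f * hX l) = hY (m * p) * E (flr p f) * hX (l * p).

Local Notation mu := (@proj_mu k p U E).
Local Notation wt := (@has_wt k p U E).
Local Notation act := (yx_act hX hY).
Local Notation X := (hX 1).
Local Notation Y := (hY 1).
Let pP : prime p := pcharf_prime hp.
Let p0 : (0 < p)%N := prime_gt0 pP.

Variables (a : int) (n nt s : nat) (l : {poly k}).
Local Notation gm := (fun i : nat => gam k a i).
Local Notation e := (rprod gm).
Local Notation N := (p.-1 - nt)%N.
Local Notation Nt := (p.-1 - n)%N.
Hypothesis ntp : (n + nt < p)%N.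
Hypothesis ant : (p%:Z %| a + n%:Z - nt%:Z)%Z.
(** The two situations in which [X^(cp)] passes through Z. Cases (B), (D) use no shift; in cases
    (A), (C) the shift moves the weight [hat p a] to [hat p a + 2s - p], again in the range from 0
    to p-1. *)
Definition shift_ok : bool :=
  ((s == 0)%N && (hat p a <= nt)%N) ||
  [&& p - hat p a <= n, s <= p - hat p a & p - hat p a <= s.*2]%N.
Hypothesis hs : shift_ok.

Local Notation W := (Wz p hX hY E Fr a s).
(** The polynomials defining B^(1) and B^(0), divided by the factors of index below [s]. The index
    [n], respectively both [n] and [N], is omitted from the product up to p; by [gam_N] the omitted
    factors coincide. The cofactor [l] is later chosen with nonzero value at [gam a n]. *)
Definition Zg (b : bool) : {poly k} :=
  if b then e s n * e n.+1 p else l * (e s n * e n.+1 N * e N.+1 p).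
Definition Zm (b : bool) (z : U) : U := act (Zg b) * W s z.

Let sn : (s <= n)%N.
Proof. by case/orP: hs => [/andP [/eqP -> //]|/and3P [? ? _]]; lia. Qed.
Let nN : (n <= N)%N. Proof. by move: ntp p0; lia. Qed.
Let np : (n < p)%N. Proof. by move: ntp; lia. Qed.
Let Np : (N < p)%N. Proof. by move: p0; lia. Qed.

Let actWz := act_Wz hp HA Fr_lin FrE a.
Let Wzp := Wz_p hp HA Fr a s.
Let wtW := wt_Wz hp HA Fr_lin FrE a.
Let Ykill := Y_kill hp HA Fr_lin FrE a.

Lemma gam_refl i : gam k a i = gam k a (- a - 1 - i).
Proof. by rewrite /gam; congr (_%:~R); ring. Qed.

(** [gam a] is symmetric under [i -> -a-1-i], which exchanges [n] and [N] modulo p. *)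
Lemma gam_N : gam k a N = gam k a n.
Proof.
rewrite [LHS]gam_refl; apply: (gam_per hp).
case/dvdzP: ant => q aE; apply/dvdzP; exists (- q - 1).
have -> : a = q * p%:Z + nt%:Z - n%:Z by lia.
have : N%:Z = p%:Z - 1 - nt%:Z by move: ntp; lia.
by move=> ->; ring.
Qed.

Lemma gam_eqP i : gam k a i = gam k a n ->
  (p%:Z %| i - n%:Z)%Z || (p%:Z %| i + nt%:Z + 1)%Z.
Proof.
move/eqP; rewrite -subr_eq0 /gam -rmorphB.
have -> : i * (a + i + 1) - n%:Z * (a + n%:Z + 1) = (i - n%:Z) * (a + i + n%:Z + 1) by ring.
have [q aE] := dvdzP ant.
rewrite -(dvdz_pcharf hp) dvdzE abszM Euclid_dvdM //; case/orP => H'; apply/orP; [left|right]; rewrite dvdzE //.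
have : (p%:Z %| a + i + n%:Z + 1)%Z by rewrite dvdzE.
case/dvdzP => q' qE; rewrite -dvdzE; apply/dvdzP; exists (q' - q).
by rewrite mulrBl -aE -qE; ring.
Qed.

Lemma Zg1E : Zg true = e s N * e N.+1 p.
Proof.
rewrite /Zg; move: nN; rewrite leq_eqVlt => /predU1P [<-//|nlN].
rewrite -(@rprod_cat _ gm n.+1 N p) // 1?ltnW // (@rprod_recl _ gm N p) //.
rewrite -(@rprod_cat _ gm s n N) // (@rprod_recl _ gm n N) // /= gam_N.
by ring.
Qed.

Lemma Zg1_gam : Zg true * ('X - (gam k a n)%:P) = e s p.
Proof.
rewrite /Zg -(@rprod_cat _ gm s n p) // 1?ltnW // (@rprod_recl _ gm n p) //.
by ring.
Qed.

Lemma Zg0_gam : (n < N)%N -> Zg false * ('X - (gam k a n)%:P) = l * Zg true.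
Proof.
move=> nlN; rewrite /Zg -(@rprod_cat _ gm n.+1 N p) // 1?ltnW // (@rprod_recl _ gm N p) // /= gam_N.
by ring.
Qed.

Lemma Zm_lin b : linear (Zm b).
Proof. by move=> c z z'; rewrite /Zm (Wz_lin _ _ _ _ Fr_lin) mulrDr -scalerAr. Qed.

Lemma wt_Zm b z : wt a (Zm b z).
Proof. exact: (wt_act hp HA _ (wtW z (leqnn s))). Qed.

Let YX_act (g : {poly k}) c w :
  Y * (X * (act g * w)) = act (g * ('X - c%:P)) * w + c *: (act g * w).
Proof.
rewrite scalerAl -actZ -mulrDl -actD (_ : _ + _ = 'X * g).
  by rewrite actM actX -!mulrA.
by rewrite -mul_polyC; ring.
Qed.

(** Restoring the omitted factor completes the product from [s] to [p], which kills [Wz s z]. *)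
Lemma YX_Zm1 z : Y * (X * Zm true z) = gam k a n *: Zm true z.
Proof.
rewrite (YX_act _ (gam k a n)) Zg1_gam (actWz z (leqnn s)); last exact: leq_trans sn (ltnW np).
by rewrite Wzp // add0r.
Qed.

(** Restoring one of the two omitted factors turns [Zg false] into [l * Zg true], and [l] acts on
    the eigenvector by its value at the eigenvalue. *)
Lemma YX_Zm0 z : (n < N)%N ->
  Y * (X * Zm false z) = gam k a n *: Zm false z + l.[gam k a n] *: Zm true z.
Proof.
move=> nlN; rewrite (YX_act _ (gam k a n)) Zg0_gam // addrC; congr (_ + _).
have /factor_theorem [q qE] : root (l - (l.[gam k a n])%:P) (gam k a n).
  by rewrite /root !hornerE subrr.
have -> : l * Zg true = q * (Zg true * ('X - (gam k a n)%:P)) + l.[gam k a n] *: Zg true.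
  by rewrite -[l in LHS](subrK (l.[gam k a n])%:P) qE -mul_polyC; ring.
rewrite Zg1_gam actD actM mulrDl -mulrA (actWz z (leqnn s)); last exact: leq_trans sn (ltnW np).
by rewrite Wzp // mulr0 add0r (actZ _ _ l.[_]) -scalerAl.
Qed.

(** In this and the next three lemmas the unbroken tail of the product supplies a power of X on the
    left ([XY_e]), and its unbroken head a power of Y (through [Wz n] or [Wz N]); together with the
    given power the exponent reaches p. *)
Lemma X_Zm1 q z : (p <= q + Nt)%N -> X ^+ q * Zm true z = 0.
Proof.
move=> le; have nE : n.+1 = (p - Nt)%N by move: np; lia.
rewrite /Zm /Zg mulrC nE; apply: (X_kill hp HA (a := a)) => //; last by move: np; lia.
exact: wtW.
Qed.

Lemma X_Zm0 q z : (p <= q + nt)%N -> X ^+ q * Zm false z = 0.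
Proof.
move=> le; have nE : N.+1 = (p - nt)%N by move: ntp p0; lia.
rewrite /Zm /Zg (mulrA l) mulrC nE; apply: (X_kill hp HA (a := a)) => //; last by move: ntp; lia.
exact: wtW.
Qed.

Lemma Y_Zm1 q z : (p <= q + N)%N -> Y ^+ q * Zm true z = 0.
Proof.
move=> le; rewrite /Zm Zg1E mulrC actM -mulrA actWz //; last exact: leq_trans nN.
by apply: Ykill => //; [exact: leq_trans nN | exact: ltnW].
Qed.

Lemma Y_Zm0 q z : (p <= q + n)%N -> Y ^+ q * Zm false z = 0.
Proof.
move=> le; have -> : Zm false z = act (l * (e n.+1 N * e N.+1 p)) * W n z.
  rewrite -(actWz z (leqnn s) sn) mulrA -actM /Zm /Zg.
  by congr (act _ * _); ring.
by apply: Ykill => //; exact: ltnW.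
Qed.

Lemma Zm_sum b : exists c : nat -> k, forall z,
  Zm b z = \sum_(n <= m < p) c m *: W m z.
Proof.
have [h hE] : exists h, Zg b = e s n * h.
  case: b; [by exists (e n.+1 p) | exists (l * (e n.+1 N * e N.+1 p))].
  by rewrite /Zg; ring.
have [c [cE _]] := act_Wz_sum hp HA Fr_lin FrE a h sn (ltnW np).
by exists c => z; rewrite -cE /Zm hE mulrC actM -mulrA actWz.
Qed.

Lemma wt_hat v : wt a v -> wt (hat p a)%:Z v.
Proof.
apply: wt_per; apply/dvdzP; exists (a %/ p%:Z)%Z.
by rewrite {1}(divz_hat hp a); ring.
Qed.

Lemma YFr_Zm b c z : hY (c * p) * Zm b z = Zm b (hY c * z).
Proof.
have [d dE] := Zm_sum b; rewrite !dE mulr_sumr big_nat_cond [RHS]big_nat_cond.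
apply: eq_bigr => m /andP [/andP [nm mp] _]; rewrite -scalerAr; congr (_ *: _).
rewrite /Wz (Y_exp HA) (X_exp HA (m - s)) -!scalerAl -!scalerAr; do 2!congr (_ *: _).
rewrite !mulrA (YYC HA) -(YX_comm hp HA) // ?leq_subr //.
by rewrite -(YFr hp HA Fr_lin FrE) !mulrA.
Qed.

Lemma Fr_1 : Fr 1 = 1.
Proof.
have e1 : 1 = hY 0 * E (fun=> 1) * hX 0.
  by rewrite (hax_Y0 HA) (hax_X0 HA) (hax_E1 HA) !mulr1.
rewrite {1}e1 FrE; last exact: Phi_const.
by rewrite !mul0n -[flr p _]/(fun=> 1) -e1.
Qed.

Lemma Zm_s0 b z : s = 0%N -> Zm b z = Fr z * Zm b 1.
Proof.
move=> s0; rewrite /Zm /Wz Fr_1 s0 subn0 !expr0 !mul1r mulrA [RHS]mulrA; congr (_ * _).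
elim/poly_ind: (Zg b) => [|g c IHg]; first by rewrite /yx_act rmorph0 mul0r mulr0.
rewrite actD actM actX actC mulrDl mulrDr; congr (_ + _); last first.
  by rewrite -scalerAl mul1r -scalerAr mulr1.
by rewrite -mulrA (YX_Fr hp HA Fr_lin FrE) ?prime_gt1 // !mulrA IHg.
Qed.

(** When [X^(cp)] is moved past [Y^m], the correction of index [i <= m - s] dies by a carry with
    [X^(m-s)]. For larger [i] the last digit of the weight is [hat p a + m - p < i], so the binomial
    vanishes. What remains is [XFr] for the vector [X^s mu_a]. *)
Let XW c m z : (n <= m)%N -> (m < p)%N -> (p - hat p a <= n)%N ->
    (s <= p - hat p a)%N -> (p - hat p a <= s.*2)%N ->
  hX (c * p) * W m z = W m (hX c * z).
Proof.
move=> nm mp pn sp ps; have ha := hat_lt hp a.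
have sm : (s <= m)%N := leq_trans sn nm.
rewrite /Wz (Y_exp HA) (X_exp HA (m - s)) -!scalerAl -!scalerAr; do 2!congr (_ *: _).
set v := Fr z * _.
have wv : wt (a + s.*2%:Z) v.
  exact: (wt_Fr hp HA Fr_lin FrE z (wt_Xn hp HA s (wt_mu hp HA a))).
have -> : hX (c * p) * (hY m * (hX (m - s) * v)) = hY m * (hX (c * p) * (hX (m - s) * v)).
  apply: (XY_comm HA) => i i0 im ic.
  have [ims|msi] := leqP i (m - s).
    rewrite [X in _ * X]mulrA (XX_carry hp HA) ?mul0r ?mulr0 //.
    have ip : (i %% p = i)%N by rewrite modn_small //; lia.
    by rewrite (modn_subMl hp) ?ip // modn_small; lia.
  apply: (wt_E0 hp HA _ (wt_X hp HA _ (wt_X hp HA _ wv))) => [|x].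
    apply: Phi_ext (Phi_bin k (i.*2%:Z - (c * p)%N%:Z - m%:Z) i) => x.
    by rewrite !addrA.
  case/dvdzP => q xq; rewrite (binz_lucas hp).
  have ip : (i < p)%N by apply: leq_ltn_trans mp.
  rewrite [X in _ * X%:R]bin_small ?mulr0 // modn_small //.
  have [q' aE] : exists q', a = q' * p%:Z + (hat p a)%:Z.
    by eexists; exact: (divz_hat hp a).
  have -> : x + i.*2%:Z - (c * p)%N%:Z - m%:Z =
      (q + q' + 1 + c%:Z) * p%:Z + (hat p a + m - p)%N%:Z.
    have -> : x = q * p%:Z + (a + s.*2%:Z + (m - s).*2%:Z + (c * p - i).*2%:Z) by lia.
    have -> : (hat p a + m - p)%N%:Z = (hat p a)%:Z + m%:Z - p%:Z by lia.
    have -> : (m - s).*2%:Z = m%:Z *+ 2 - s%:Z *+ 2 by lia.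
    have -> : (c * p - i).*2%:Z = (c%:Z * p%:Z) *+ 2 - i%:Z *+ 2.
      by rewrite -PoszM; lia.
    by rewrite {1}aE -!addnn !PoszD PoszM; ring.
  by rewrite hat_digit; lia.
congr (_ * _); rewrite mulrA (XXC HA) -mulrA; congr (_ * _).
apply: (XFr hp HA Fr_lin FrE (a0 := (hat p a + s.*2 - p)%N)) => [||K Kp].
- by lia.
- apply: wt_per (wt_Xn hp HA s (wt_mu hp HA a)).
  apply/dvdzP; exists ((a %/ p%:Z)%Z + 1).
  rewrite {1}(divz_hat hp a).
  have -> : (hat p a + s.*2 - p)%N%:Z = (hat p a)%:Z + s.*2%:Z - p%:Z by lia.
  by ring.
rewrite (X_exp HA) -scalerAl -scalerAr mulrA (XX_carry hp HA) ?mul0r ?scaler0 //.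
by rewrite [(s %% p)%N]modn_small; lia.
Qed.

(** With a shift, apply [XW] to each summand. Without one, Z(z) is [Fr z] times Z(1), and Z(1) is
    killed by [X^(K)] when the last digit of [K] is at least [p - hat p a], because [hat p a <= nt];
    so [XFr] applies. *)
Lemma XFr_Zm b c z : hX (c * p) * Zm b z = Zm b (hX c * z).
Proof.
case/orP: hs => [/andP [/eqP s0 an]|/and3P [pn sp ps]]; last first.
  have [d dE] := Zm_sum b; rewrite !dE mulr_sumr big_nat_cond [RHS]big_nat_cond.
  apply: eq_bigr => m /andP [/andP [nm mp] _]; rewrite -scalerAr; congr (_ *: _).
  exact: XW.
rewrite Zm_s0 // [RHS]Zm_s0 //.
apply: (XFr hp HA Fr_lin FrE (a0 := hat p a)) => [||K Kp].
- exact: (hat_lt hp a).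
- exact: (wt_hat (wt_Zm b 1)).
rewrite (divn_eq K p) (X_digit hp HA) ?ltn_mod // (X_fact hp HA (ltn_pmod K p0)).
rewrite -scalerAr -scalerAl -mulrA.
have -> : X ^+ (K %% p) * Zm b 1 = 0; last by rewrite mulr0 scaler0.
by case: b; [apply: X_Zm1 | apply: X_Zm0]; move: ntp; lia.
Qed.

(** Up to a nonzero product of factorials, the PBW monomial of [z] with exponents [(m, j)] becomes
    one with exponents [(mp + p-1, jp + N)]. These are distinct, so independence recovers every
    function of [z]. *)
Let W_inj z : Y ^+ p.-1 * (X ^+ (N - s) * (Fr z * (X ^+ s * mu a))) = 0 -> z = 0.
Proof.
have [M [f [Pf zE]]] := hax_span HA z.
have p1 : (p.-1 < p)%N by rewrite prednK.
pose F (i : nat * nat) x := f (i.1 %/ p)%N (i.2 %/ p)%N ((x - (N - s).*2%:Z) %/ p%:Z)%Z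
   * ind_mod k p (a + N.*2%:Z) x.
have PF i : Phi (F i).
  apply: PhiM; last exact: (Phi_ch hp).
  exact: (Phi_shift (- (N - s).*2%:Z) (Phi_floor hp (Pf (i.1 %/ p)%N (i.2 %/ p)%N))).
pose S := [seq (m * p + p.-1, j * p + N)%N | m <- index_iota 0 M, j <- index_iota 0 M].
pose C : k := (p.-1)`!%:R * N`!%:R.
have Cz : C != 0 by rewrite mulf_neq0 ?(fact_unit hp).
have -> : Y ^+ p.-1 * (X ^+ (N - s) * (Fr z * (X ^+ s * mu a))) =
    C *: \sum_(i <- S) hY i.1 * E (F i) * hX i.2.
  rewrite big_allpairs_dep zE (Fr_sum Fr_lin) mulr_suml !mulr_sumr scaler_sumr big_mkord.
  apply: eq_bigr => m _; rewrite (Fr_sum Fr_lin) mulr_suml !mulr_sumr scaler_sumr big_mkord.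
  apply: eq_bigr => j _ /=; rewrite FrE //.
  set g := flr p (f m j); have Pg : Phi g by apply: (Phi_floor hp).
  have qp : (N - s <= p.-1)%N by lia.
  have e1 w : Y ^+ p.-1 * (X ^+ (N - s) * (hY (m * p) * w)) =
      (p.-1)`!%:R *: (hY (m * p + p.-1) * (X ^+ (N - s) * w)).
    have e : hY p.-1 * (hX (N - s) * (hY (m * p) * w)) =
        hY (m * p + p.-1) * (hX (N - s) * w).
      by rewrite !mulrA (YX_comm hp HA) // (Y_digit hp HA) // (YYC HA (m * p)).
    by rewrite (Y_exp HA) (X_exp HA (N - s)) -!scalerAl -!scalerAr e.
  have e2 w : X ^+ (N - s) * (E g * w) =
      E (fun x => g (x - (N - s).*2%:Z)) * (X ^+ (N - s) * w).
    by rewrite (X_exp HA (N - s)) -!scalerAl -scalerAr !mulrA (XE HA _ Pg).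
  have e3 : X ^+ (N - s) * (hX (j * p) * (X ^+ s * mu a)) =
      N`!%:R *: (hX (j * p + N) * mu a).
    have e : X ^+ (N - s) * hX (j * p) = hX (j * p) * X ^+ (N - s).
      by rewrite (X_exp HA) -scalerAl -scalerAr (XXC HA).
    rewrite mulrA e -!mulrA [X in _ * X]mulrA -exprD subnK ?(leq_trans sn) //.
    by rewrite (X_exp HA) -scalerAl -scalerAr mulrA (X_digit hp HA).
  have e4 : hX (j * p + N) * mu a = mu (a + N.*2%:Z) * hX (j * p + N).
    rewrite (mu_X hp HA); congr (_ * _); apply: mu_per; apply/dvdzP.
    by exists (2 * j%:Z); rewrite -!addnn !PoszD PoszM; ring.
  rewrite -!mulrA e1 e2 e3 e4 -!scalerAr scalerA; congr (_ *: _).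
  congr (_ * _); rewrite mulrA; congr (_ * _).
  rewrite -(hax_EM HA); [|exact: Phi_shift|exact: (Phi_ch hp)].
  by apply: E_ext => x; rewrite /F /g /flr /= !divnMDl // !divn_small // !addn0 mulrC.
move/eqP; rewrite scaler_eq0 (negbTE Cz) /= => /eqP S0.
rewrite zE big1 // => m _; rewrite big1 // => j _.
suff -> : f m j = fun=> 0 by rewrite (E0 HA) mulr0 mul0r.
apply/funext => t.
have uS : uniq S.
  apply: allpairs_uniq; rewrite ?iota_uniq // => -[m1 j1] [m2 j2] _ _ /= [].
  move=> /addIn/eqP e1 /addIn/eqP e2; move: e1 e2.
  by rewrite !eqn_pmul2r // => /eqP -> /eqP ->.
(* The point is chosen so that the floor appearing in [F] equals [t] and the indicator of the weight
   class equals 1. *)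
pose x := t * p%:Z + (hat p (a + N.*2%:Z - (N - s).*2%:Z))%:Z + (N - s).*2%:Z.
have := hax_free HA uS PF S0 (i := (m * p + p.-1, j * p + N)%N) x.
have -> : (m * p + p.-1, j * p + N)%N \in S.
  by apply/allpairsP; exists (m : nat, j : nat); split; rewrite ?mem_index_iota /= ?ltn_ord.
move=> /(_ isT); rewrite /F /= !divnMDl // !divn_small // !addn0 {1}/x addrK.
rewrite (divz_digit hp) ?(hat_lt hp) // /ind_mod.
suff -> : (p%:Z %| x - (a + N.*2%:Z))%Z by rewrite mulr1.
apply/dvdzP; exists (t - ((a + N.*2%:Z - (N - s).*2%:Z) %/ p%:Z)%Z).
have := divz_hat hp (a + N.*2%:Z - (N - s).*2%:Z); rewrite /x.
move: (_ %/ _)%Z => q; move: (hat _ _)%:Z => h aE.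
by rewrite mulrBl; move: aE; lia.
Qed.

(** Write Z^(1)(z) as a combination of the [Wz m z] with [m >= N]. Multiplication by [Y^nt] keeps
    only [m = N], to which [W_inj] applies; its coefficient is nonzero because [gam] does not take
    the value [gam a n] strictly between [N] and [p]. *)
Lemma Zm1_inj z : Zm true z = 0 -> z = 0.
Proof.
move=> Z0; apply: W_inj.
have [c [cE cN]] := act_Wz_sum hp HA Fr_lin FrE a (e N.+1 p) (leq_trans sn nN) (ltnW Np).
have Z1 z' : Zm true z' = \sum_(N <= m < p) c m *: W m z'.
  by rewrite -cE /Zm Zg1E mulrC actM -mulrA actWz // (leq_trans sn).
have : Y ^+ nt * Zm true z = 0 by rewrite Z0 mulr0.
rewrite Z1 big_ltn // mulrDr mulr_sumr big_nat_cond big1 => [|m /andP [/andP [Nm mp] _]].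
  rewrite addr0 -scalerAr /Wz (mulrA (Y ^+ nt)) -exprD (_ : (nt + N)%N = p.-1); last by move: ntp; lia.
  have nz : c N != 0.
    rewrite (cN Np) horner_prod prodf_seq_neq0; apply/allP => i.
    rewrite mem_index_iota => /andP [Ni ip] /=; rewrite !hornerE subr_eq0 gam_N.
    apply/eqP => /esym/gam_eqP /orP [] /dvdzP [q qE].
      have : (0 < q * p%:Z < p%:Z) by lia.
      by case: q {qE} => [[|q]|q]; move: p0; nia.
    have : (p%:Z < q * p%:Z < 2 * p%:Z) by lia.
    by case: q {qE} => [[|[|q]]|q]; move: p0; nia.
  by move/eqP; rewrite scaler_eq0 (negbTE nz) => /eqP.
rewrite -scalerAr /Wz (mulrA (Y ^+ nt)) -exprD (Y_p hp HA) ?mul0r ?scaler0 //.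
by move: ntp; lia.
Qed.

End ZData.

(** * The admissible pairs (theta, t) as two strings *)

Section Index.
Variables p n nt : nat.
Local Notation N := (p.-1 - nt)%N.
Local Notation Nt := (p.-1 - n)%N.
Hypothesis ntp : (n + nt < p)%N.

(** The 2p admissible pairs split into two strings with p consecutive values of t. [idxA] runs from
    [-Nt] to [n] and switches from Z^(0) to Z^(1) at [t = -nt]; [idxB] runs from [-nt] to [N] and
    stays with Z^(0). *)
Definition idxA (i : nat) : bool * int := ((p.-1 - (n + nt) <= i)%N, i%:Z - Nt%:Z).
Definition idxB (i : nat) : bool * int := (false, i%:Z - nt%:Z).

Variable only : bool.
Hypothesis nN_only : ~~ only -> (n < N)%N.

(** [only] records that theta is forced to be 1, either by epsilon or by condition (E); then only
    the Z^(1) part of the first string is left. *)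
Definition idx : seq (bool * int) :=
  if only then [seq i <- map idxA (iota 0 p) | i.1]
  else map idxA (iota 0 p) ++ map idxB (iota 0 p).

Lemma mem_idxA b t : ((b, t) \in map idxA (iota 0 p)) =
  [&& - Nt%:Z <= t, t <= n%:Z & b == (- nt%:Z <= t)].
Proof.
apply/mapP/and3P => [[i +]|[tl tu /eqP ->]].
  rewrite mem_iota add0n => /andP [_ ip] [-> ->]; split; [lia|move: ntp; lia|].
  by apply/eqP; move: ntp; lia.
exists (absz (t + Nt%:Z)); first by rewrite mem_iota; move: ntp; lia.
by rewrite /idxA; congr (_, _); move: ntp; lia.
Qed.

Lemma mem_idxB b t : ((b, t) \in map idxB (iota 0 p)) =
  [&& ~~ b, - nt%:Z <= t & t <= N%:Z].
Proof.
apply/mapP/and3P => [[i +]|[/negbTE -> tl tu]].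
  by rewrite mem_iota add0n => /andP [_ ip] [-> ->]; split=> //; move: ntp; lia.
exists (absz (t + nt%:Z)); first by rewrite mem_iota; move: ntp; lia.
by rewrite /idxB; congr (_, _); move: ntp; lia.
Qed.

Lemma mem_idx b t : ((b, t) \in idx) =
  (only ==> b) && (if b then (- nt%:Z <= t) && (t <= n%:Z)
                   else (- Nt%:Z <= t) && (t <= N%:Z)).
Proof.
rewrite /idx; case: (boolP only) => [_|/nN_only nN] /=.
  rewrite mem_filter mem_idxA /=; case: b => //=.
  by move: ntp; case: (- nt%:Z <= t) / idP; case: (t <= n%:Z) / idP; lia.
rewrite mem_cat mem_idxA mem_idxB; case: b => /=.
  by rewrite orbF; apply/and3P/andP; [move=> [? ? /eqP]|move=> [? ?]]; split; move: ntp; try lia.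
apply/orP/andP; first by case; [move=> /and3P [? ? /eqP]|move=> /andP [? ?]]; split; move: ntp nN; lia.
move=> [tl tu]; case: (lerP (- nt%:Z) t) => h; [right|left]; apply/andP; split=> //.
by apply/andP; split; move: ntp nN; lia.
Qed.

Lemma idx_uniq : uniq idx.
Proof.
have uA : uniq (map idxA (iota 0 p)).
  by rewrite map_inj_uniq ?iota_uniq // => i j [_]; lia.
have uB : uniq (map idxB (iota 0 p)).
  by rewrite map_inj_uniq ?iota_uniq // => i j []; lia.
rewrite /idx; case: (boolP only) => [_|/nN_only nN]; first exact: filter_uniq.
rewrite cat_uniq uA uB andbT; apply/hasPn => -[b t]; rewrite mem_idxB mem_idxA.
by case: b => //= /andP [-> ] _; rewrite !andbF.
Qed.

End Index.

(** * Independence and stability of the two strings *)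

Section Chain.
Variables (k : fieldType) (p : nat).
Hypothesis hp : p \in [pchar k].
Variables (U : algType k) (hX hY : nat -> U) (E : (int -> k) -> U).
Hypothesis HA : hyper_axioms hX hY E.

Local Notation wt := (@has_wt k p U E).
Local Notation act := (yx_act hX hY).
Local Notation X := (hX 1).
Local Notation Y := (hY 1).
Let pP : prime p := pcharf_prime hp.
Let p0 : (0 < p)%N := prime_gt0 pP.

Variables (a : int) (n nt : nat) (Z : bool -> U -> U) (beta : k).
Local Notation N := (p.-1 - nt)%N.
Local Notation Nt := (p.-1 - n)%N.
Local Notation g := (gam k a n).
Hypothesis ntp : (n + nt < p)%N.
Hypothesis ant : (p%:Z %| a + n%:Z - nt%:Z)%Z.
Hypothesis Zlin : forall b, linear (Z b).
Hypothesis Zwt : forall b z, wt a (Z b z).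
Hypothesis YX1 : forall z, Y * (X * Z true z) = g *: Z true z.
Hypothesis YX0 : (n < N)%N -> forall z,
  Y * (X * Z false z) = g *: Z false z + beta *: Z true z.
Hypothesis beta_neq0 : beta != 0.
Hypothesis XZ1 : forall q z, (p <= q + Nt)%N -> X ^+ q * Z true z = 0.
Hypothesis XZ0 : forall q z, (p <= q + nt)%N -> X ^+ q * Z false z = 0.
Hypothesis YZ1 : forall q z, (p <= q + N)%N -> Y ^+ q * Z true z = 0.
Hypothesis YZ0 : forall q z, (p <= q + n)%N -> Y ^+ q * Z false z = 0.
Hypothesis Zinj : forall z, Z true z = 0 -> z = 0.

Lemma act_eigen c f v : Y * (X * v) = c *: v -> act f * v = f.[c] *: v.
Proof.
move=> H; elim/poly_ind: f => [|f d IHf].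
  by rewrite /yx_act rmorph0 mul0r horner0 scale0r.
rewrite actD actM actX actC mulrDl -!mulrA H -scalerAr IHf -scalerAl mul1r.
by rewrite !hornerE scalerDl scalerA mulrC.
Qed.

Lemma act_root h z : (n < N)%N ->
  act (h * ('X - g%:P)) * Z false z = (beta * h.[g]) *: Z true z.
Proof.
move=> nN; rewrite actM -mulrA actD actX -polyCN actC mulrDl -mulrA YX0 // -scalerAl mul1r.
rewrite scaleNr addrC addKr -scalerAr (act_eigen _ (YX1 z)) scalerA.
by [].
Qed.

Lemma act_Z0 f z : (n < N)%N ->
  exists c, act f * Z false z = f.[g] *: Z false z + c *: Z true z.
Proof.
move=> nN; have /factor_theorem [q qE] : root (f - (f.[g])%:P) g.
  by rewrite /root !hornerE subrr.
exists (beta * q.[g]); rewrite -{1}[f](subrK (f.[g])%:P) qE actD mulrDl act_root //.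
by rewrite addrC actC -scalerAl mul1r.
Qed.

Lemma YmXm m w : wt a w ->
  Y ^+ m * (X ^+ m * w) = act (\prod_(i < m) ('X - (gam k a i)%:P)) * w.
Proof.
elim: m w => [|m IHm] w ww; first by rewrite big_ord0 act1 !mul1r.
rewrite exprSr -mulrA (YX_Xq hp HA m ww) IHm; last exact: (wt_act hp HA _ ww).
by rewrite mulrA -actM big_ord_recr.
Qed.

Local Notation el q := (\prod_(i < q) ('X - (gam k a (- i.+1%:Z))%:P)).
Local Notation eu q := (\prod_(i < q) ('X - (gam k a i)%:P)).

Lemma gam_low i : (0 < i)%N -> (i <= Nt)%N -> i != nt.+1 ->
  gam k a (- i%:Z) != g.
Proof.
move=> i0 iNt /eqP int_; apply/eqP => /(gam_eqP hp ant) /orP [] /dvdzP [q qE].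
  have : (- p%:Z < q * p%:Z < 0) by lia.
  by case: q {qE} => [q|[|q]]; move: p0; nia.
have : (- p%:Z < q * p%:Z < p%:Z) by lia.
by case: q qE => [[|q]|[|q]] qE; move: p0; nia.
Qed.

Lemma gam_up i : (i < N)%N -> i != n -> gam k a i != g.
Proof.
move=> iN /eqP ni; apply/eqP => /(gam_eqP hp ant) /orP [] /dvdzP [q qE].
  have : (- p%:Z < q * p%:Z < p%:Z) by lia.
  by case: q qE => [[|q]|[|q]] qE; move: p0; nia.
have : (0 < q * p%:Z < p%:Z) by lia.
by case: q {qE} => [[|q]|q]; move: p0; nia.
Qed.

Lemma el_neq0 q : (q <= nt)%N -> (el q).[g] != 0.
Proof.
move=> qnt; rewrite horner_prod; apply/prodf_neq0 => i _; have iq := ltn_ord i.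
rewrite !hornerE subr_eq0 eq_sym gam_low //; move: ntp; lia.
Qed.

Lemma eu_neq0 m : (m <= n)%N -> (eu m).[g] != 0.
Proof.
move=> mn; rewrite horner_prod; apply/prodf_neq0 => i _; have im := ltn_ord i.
rewrite !hornerE subr_eq0 eq_sym gam_up //; move: ntp; lia.
Qed.

(** The reflection of [gam] identifies its value at [-(nt+1)] with that at [n], and no other index
    in the range gives this value: the root is simple. *)
Lemma el_root q : (nt < q)%N -> (q <= Nt)%N -> exists h,
  el q = h * ('X - g%:P) /\ h.[g] != 0.
Proof.
move=> ntq qNt; rewrite (bigD1 (Ordinal ntq)) //= mulrC.
have -> : gam k a (- nt.+1%:Z) = g.
  rewrite (gam_refl _ _ n); apply: (gam_per hp); case/dvdzP: ant => c aE; apply/dvdzP.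
  by exists c; rewrite -aE; lia.
eexists; split; first by []; rewrite horner_prod; apply/prodf_neq0 => i ni.
rewrite !hornerE subr_eq0 eq_sym gam_low //.
  by have := ltn_ord i; lia.
Qed.

Lemma eu_root : (n < N)%N -> exists h,
  eu N = h * ('X - g%:P) /\ h.[g] != 0.
Proof.
move=> nN; rewrite (bigD1 (Ordinal nN)) //= mulrC.
eexists; split; first by []; rewrite horner_prod; apply/prodf_neq0 => i ni.
by rewrite !hornerE subr_eq0 eq_sym gam_up.
Qed.

Definition u_pow (t : int) : U := if 0 <= t then X ^+ `|t|%N else Y ^+ `|t|%N.
Local Notation ut := u_pow.
Definition Vz (i : bool * int) (z : U) : U := ut i.2 * Z i.1 z.

Local Notation idxA := (idxA p n nt).
Local Notation idxB := (idxB nt).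

Lemma ut_nneg (q : nat) : ut q%:Z = X ^+ q. Proof. by []. Qed.
Lemma ut_neg (q : nat) : ut (- q%:Z) = Y ^+ q.
Proof. by rewrite /ut; case: q => [|q] //=; rewrite !expr0. Qed.

(** For negative t the product [X^q Y^q] is a polynomial in [YX]. On Z^(1) it is a nonzero scalar;
    on Z^(0) with [q > nt] the eigenvalue is a simple root, so it yields a nonzero multiple of
    Z^(1). Thus, up to scalars, powers of X climb the whole string towards [X^n] Z^(1). *)
Lemma XVA i j z : (i <= j)%N -> (j < p)%N -> exists c,
  X ^+ (p.-1 - i) * Vz (idxA j) z = c *: (X ^+ (n + (j - i)) * Z true z) /\ c != 0.
Proof.
move=> ij jp; rewrite /Vz /idxA /=; case: (leqP Nt j) => [Ntj|jNt].
  have -> : j%:Z - Nt%:Z = (j - Nt)%N%:Z by lia.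
  rewrite ut_nneg mulrA -exprD; have -> : (p.-1 - (n + nt) <= j)%N by lia.
  exists 1; rewrite scale1r oner_neq0; split=> //; congr (_ ^+ _ * _); move: ntp; lia.
have -> : j%:Z - Nt%:Z = - (Nt - j)%N%:Z by lia.
have eL : (p.-1 - i = (n + (j - i)) + (Nt - j))%N by move: ntp; lia.
rewrite ut_neg eL exprD -mulrA (XjYj hp HA _ (Zwt _ _)).
case: leqP => [le|lt].
  exists ((el (Nt - j)).[g]); rewrite (act_eigen _ (YX1 z)) -scalerAr; split=> //.
  by apply: el_neq0; move: ntp; lia.
have nN : (n < N)%N by lia.
have [||h [-> hg]] := @el_root (Nt - j)%N; [by lia|by lia|].
exists (beta * h.[g]); rewrite act_root // -scalerAr; split=> //.
by rewrite mulf_neq0.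
Qed.

Lemma XVB i j z : (n < N)%N -> (i <= j)%N -> (j < p)%N -> exists c,
  X ^+ (p.-1 - i) * Vz (idxB j) z = c *: (X ^+ (N + (j - i)) * Z false z) /\ c != 0.
Proof.
move=> nN ij jp; rewrite /Vz /idxB /=; case: (leqP nt j) => [ntj|jnt].
  have -> : j%:Z - nt%:Z = (j - nt)%N%:Z by lia.
  rewrite ut_nneg mulrA -exprD.
  exists 1; rewrite scale1r oner_neq0; split=> //; congr (_ ^+ _ * _); move: ntp; lia.
have -> : j%:Z - nt%:Z = - (nt - j)%N%:Z by lia.
have eL : (p.-1 - i = (N + (j - i)) + (nt - j))%N by move: ntp; lia.
rewrite ut_neg eL exprD -mulrA (XjYj hp HA _ (Zwt _ _)).
have [c ->] := act_Z0 (el (nt - j)) z nN.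
exists ((el (nt - j)).[g]); split; last by apply: el_neq0; lia.
by rewrite mulrDr -!scalerAr XZ1 ?scaler0 ?addr0 //; lia.
Qed.

(** Induction from the bottom of the strings. [X^(p-1-i)] kills all members above position [i] and
    sends the two members at position [i] to nonzero multiples of [X^n] Z^(1) and [X^N] Z^(0). The
    latter two are then separated, and injectivity of Z^(1) concludes. *)
Lemma chain_free (zA zB : nat -> U) :
    ((n < N)%N \/ (forall i, zB i = 0)) ->
    \sum_(i < p) Vz (idxA i) (zA i) + \sum_(i < p) Vz (idxB i) (zB i) = 0 ->
  forall i, (i < p)%N -> zA i = 0 /\ zB i = 0.
Proof.
move=> nNE S0 i; have [m] := ubnP i; elim: m i => // m IHm i; rewrite ltnS => im ip.
have V0 j : Vz j 0 = 0.
  by have := Zlin j.1 (-1) 0 0; rewrite /Vz scaler0 addr0 scaleN1r addNr => ->; rewrite mulr0.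
have XS : X ^+ (p.-1 - i) * Vz (idxA i) (zA i) + X ^+ (p.-1 - i) * Vz (idxB i) (zB i) = 0.
  have := congr1 (fun v => X ^+ (p.-1 - i) * v) S0; rewrite mulr0 mulrDr !mulr_sumr.
  rewrite (bigD1 (Ordinal ip)) //= big1 ?addr0 => [|j nj].
    rewrite (bigD1 (Ordinal ip)) //= big1 ?addr0 // => j nj.
    have [ji|] := ltnP j i; first by have [_ ->] := IHm j (leq_trans ji im) (ltn_ord j); rewrite V0 mulr0.
    rewrite leq_eqVlt => /predU1P [eij|ij]; first by case/eqP: nj; apply/val_inj.
    case: nNE => [nN|->]; last by rewrite V0 mulr0.
    have [c [-> _]] := XVB (zB j) nN (ltnW ij) (ltn_ord j).
    by rewrite XZ0 ?scaler0 //; move: ntp; lia.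
  have [ji|] := ltnP j i; first by have [-> _] := IHm j (leq_trans ji im) (ltn_ord j); rewrite V0 mulr0.
  rewrite leq_eqVlt => /predU1P [eij|ij]; first by case/eqP: nj; apply/val_inj.
  have [c [-> _]] := XVA (zA j) (ltnW ij) (ltn_ord j).
  by rewrite XZ1 ?scaler0 //; move: ntp; lia.
have [c [cE cz]] := XVA (zA i) (leqnn i) ip; move: XS; rewrite cE subnn addn0.
have zA0 : c *: (X ^+ n * Z true (zA i)) = 0 -> zA i = 0.
  move/eqP; rewrite scaler_eq0 (negbTE cz) /= => /eqP XZ.
  have := congr1 (fun v => Y ^+ n * v) XZ; rewrite mulr0 YmXm // (act_eigen _ (YX1 _)).
  by move/eqP; rewrite scaler_eq0 (negbTE (eu_neq0 (leqnn n))) => /eqP /Zinj.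
case: nNE => [nN|zB0]; last by rewrite zB0 V0 mulr0 addr0 => /zA0.
have [d [dE dz]] := XVB (zB i) nN (leqnn i) ip; rewrite dE subnn addn0 => XS.
suff zB0 : zB i = 0.
  split=> //; apply: zA0; move: XS; rewrite zB0.
  have := V0 (false, 0); rewrite /Vz /= /ut /= mul1r => ->.
  by rewrite mulr0 scaler0 addr0.
have [h [hE hg]] := eu_root nN.
(* [Y^N] turns [X^N] Z^(0) into a nonzero multiple of Z^(1), on which [X^nt Y^nt] is a nonzero
   scalar. The other term dies since [Y^(nt+N) = Y^(Nt+n)] and [Y^Nt] kills Z^(1) when [n < N]. *)
have := congr1 (fun v => X ^+ nt * (Y ^+ nt * (Y ^+ N * v))) XS.
rewrite !mulr0 !mulrDr -!scalerAr (YmXm N) // hE act_root // -!scalerAr.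
have -> : Y ^+ nt * (Y ^+ N * (X ^+ n * Z true (zA i))) = 0.
  rewrite mulrA -exprD (_ : (nt + N)%N = (Nt + n)%N); last by move: ntp; lia.
  rewrite exprD -mulrA YmXm // (act_eigen _ (YX1 _)) -scalerAr YZ1 ?scaler0 //.
  by move: nN ntp; lia.
rewrite mulr0 scaler0 add0r scalerA (XjYj hp HA _ (Zwt _ _)) (act_eigen _ (YX1 _)) scalerA.
move/eqP; rewrite scaler_eq0 => /orP [|/eqP/Zinj//].
by rewrite !mulf_eq0 (negbTE dz) (negbTE beta_neq0) (negbTE hg) (negbTE (el_neq0 (leqnn nt))).
Qed.

Hypothesis XZFr : forall b c z, hX (c * p) * Z b z = Z b (hX c * z).
Hypothesis YZFr : forall b c z, hY (c * p) * Z b z = Z b (hY c * z).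
Variable only : bool.
Hypothesis nN_only : ~~ only -> (n < N)%N.
Local Notation idx := (idx p n nt only).
Local Notation mem_idx := (mem_idx ntp nN_only).
Local Notation idx_uniq := (idx_uniq ntp nN_only).

Lemma Vz_lin i : linear (Vz i).
Proof. by move=> c z z'; rewrite /Vz Zlin mulrDr -scalerAr. Qed.

Lemma Vz0 i : Vz i 0 = 0.
Proof. by have := Vz_lin i (-1) 0 0; rewrite scaler0 addr0 scaleN1r addNr. Qed.

Lemma idx_free (c : bool * int -> U) :
  \sum_(i <- idx) Vz i (c i) = 0 -> forall i, i \in idx -> c i = 0.
Proof.
move=> S0; pose d i := if i \in idx then c i else 0.
have E0 : \sum_(i < p) Vz (idxA i) (d (idxA i)) + \sum_(i < p) Vz (idxB i)
     (if only then 0 else d (idxB i)) = 0.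
  rewrite -[RHS]S0 /idx; rewrite -(big_mkord xpredT (fun i => Vz (idxA i) (d (idxA i)))).
  rewrite -(big_mkord xpredT (fun i => Vz (idxB i) (if only then 0 else d (idxB i)))).
  rewrite /index_iota subn0 -(big_map idxA xpredT (fun i => Vz i (d i))).
  rewrite -(big_map idxB xpredT (fun i => Vz i (if only then 0 else d i))).
  case: (boolP only) => [o|no].
    rewrite [X in _ + X]big1 ?addr0; last by move=> i _; rewrite Vz0.
    rewrite big_filter big_seq_cond [RHS]big_seq_cond [RHS]big_mkcondr /=.
    rewrite big_mkcondr; apply: eq_bigr => i iA; rewrite /d /idx o mem_filter iA andbT.
    by case: ifP => _ //; rewrite Vz0.
  rewrite big_cat /=; congr (_ + _); rewrite big_seq [RHS]big_seq; apply: eq_bigr => i iA.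
    by rewrite /d /idx (negbTE no) mem_cat iA.
  by rewrite /d /idx (negbTE no) mem_cat iA orbT.
have H : (n < N)%N \/ (forall i, (if only then 0 else d (idxB i)) = 0 :> U).
  by case: (boolP only) => [_|/nN_only]; [right|left].
have K := @chain_free (fun i => d (idxA i)) (fun i => if only then 0 else d (idxB i)) H E0.
move=> [b t] ii; have -> : c (b, t) = d (b, t) by rewrite /d ii.
move: (ii); rewrite /idx; case: (boolP only) => [o|no].
  rewrite mem_filter => /andP [_ /mapP [i +]]; rewrite mem_iota add0n => /andP [_ ip] ->.
  by have [] := K i ip.
rewrite mem_cat => /orP [] /mapP [i +]; rewrite mem_iota add0n => /andP [_ ip] ->.
  by have [] := K i ip.
by have [_] := K i ip; rewrite (negbTE no).
Qed.

Definition submod (W : U -> Prop) :=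
  W 0 /\ forall c u v, W u -> W v -> W (c *: u + v).

Lemma submodZ W c u : submod W -> W u -> W (c *: u).
Proof. by move=> [W0 Wl] Wu; rewrite -[_ *: _]addr0; apply: Wl. Qed.

Lemma submodD W u v : submod W -> W u -> W v -> W (u + v).
Proof. by move=> [W0 Wl] Wu Wv; rewrite -[u]scale1r; apply: Wl. Qed.

Lemma submod_sum W (I : Type) (r : seq I) (P : pred I) (F : I -> U) : submod W ->
  (forall i, P i -> W (F i)) -> W (\sum_(i <- r | P i) F i).
Proof.
by move=> sW WF; apply: big_ind WF; [case: sW|move=> u v; apply: submodD].
Qed.

Section Span.
Variable W : U -> Prop.
Hypothesis sW : submod W.

Definition spanM (v : U) : Prop :=
  exists c : bool * int -> U, (forall i, W (c i)) /\ v = \sum_(i <- idx) Vz i (c i).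

Lemma spanM_submod : submod spanM.
Proof.
split; first by exists (fun=> 0); split; [case: sW | rewrite big1 // => i _; rewrite Vz0].
move=> c _ _ [d [Wd ->]] [d' [Wd' ->]]; exists (fun i => c *: d i + d' i); split.
  by move=> i; case: sW => _; apply.
by rewrite scaler_sumr -big_split; apply: eq_bigr => i _; rewrite Vz_lin.
Qed.

Lemma spanM_Vz i w : i \in idx -> W w -> spanM (Vz i w).
Proof.
move=> ii Ww; exists (fun j => if j == i then w else 0); split.
  by move=> j; case: ifP => // _; case: sW.
rewrite (bigD1_seq i) ?idx_uniq //= eqxx big1 ?addr0 // => j /negbTE ->.
by rewrite Vz0.
Qed.

Lemma spanM_lmul u : (forall i w, i \in idx -> W w -> spanM (u * Vz i w)) ->
  forall v, spanM v -> spanM (u * v).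
Proof.
move=> H v [c [Wc ->]]; rewrite mulr_sumr big_seq.
by apply: submod_sum spanM_submod _ => i ii; apply: H.
Qed.

(** For [t >= 0], X moves to the next index or yields zero at the end. For [t < 0] it lowers the
    power of Y by one at the price of a linear polynomial in [YX]; on Z^(0) this adds a multiple of
    the corresponding Z^(1) vector, which is either indexed or zero. *)
Lemma spanM_X v : spanM v -> spanM (X * v).
Proof.
apply: spanM_lmul => -[b t] w ii Ww; rewrite /Vz /=.
have [t0|t0] := leP 0 t.
  have [q tq] : exists q : nat, t = q%:Z by exists `|t|%N; lia.
  rewrite tq ut_nneg mulrA -exprS -ut_nneg -[ut _ * _]/(Vz (b, q.+1%:Z) w).
  have [ii'|] := boolP ((b, q.+1%:Z) \in idx); first exact: spanM_Vz.
  rewrite mem_idx; move: ii; rewrite mem_idx tq => /andP [-> ii] /= ni.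
  suff -> : Vz (b, q.+1%:Z) w = 0 by case: spanM_submod.
  rewrite /Vz /= ut_nneg; case: b {ii} ni ii => ni ii.
    by apply: XZ1; move: ni ii ntp; lia.
  by apply: XZ0; move: ni ii ntp; lia.
have [q tq] : exists q : nat, t = - (q.+1)%:Z by exists (`|t|.-1)%N; lia.
rewrite tq ut_neg (XY_Yj hp HA _ (Zwt _ _)).
have inner b' : ((b', - q%:Z) \in idx) \/ Y ^+ q * Z b' w = 0 ->
    spanM (Y ^+ q * Z b' w).
  move=> [iq|->]; last by case: spanM_submod.
  by rewrite -ut_neg -[_ * _]/(Vz (b', - q%:Z) w); apply: spanM_Vz.
have iq : (b, - q%:Z) \in idx.
  by move: ii; rewrite !mem_idx tq; case: (b); move: ntp; lia.
case: b ii iq => ii iq.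
  rewrite (act_eigen _ (YX1 _)) -scalerAr; apply: submodZ spanM_submod _.
  by apply: inner; left.
have no : ~~ only by move: ii; rewrite mem_idx; case: (only).
have [c ->] := act_Z0 ('X - (gam k a (- q.+1%:Z))%:P) w (nN_only no).
rewrite mulrDr -!scalerAr; apply: submodD spanM_submod _ _; apply: submodZ spanM_submod _.
  by apply: inner; left.
apply: inner; have [qnt|ntq] := leqP q nt; last by right; apply: YZ1; move: ntp; lia.
by left; rewrite mem_idx (negbTE no) /=; move: ntp; lia.
Qed.

Lemma spanM_Y v : spanM v -> spanM (Y * v).
Proof.
apply: spanM_lmul => -[b t] w ii Ww; rewrite /Vz /=.
have [t0|t0] := leP t 0.
  have [q tq] : exists q : nat, t = - q%:Z by exists `|t|%N; lia.
  rewrite tq ut_neg mulrA -exprS -ut_neg -[ut _ * _]/(Vz (b, - q.+1%:Z) w).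
  have [ii'|] := boolP ((b, - q.+1%:Z) \in idx); first exact: spanM_Vz.
  rewrite mem_idx; move: ii; rewrite mem_idx tq => /andP [-> ii] /= ni.
  suff -> : Vz (b, - q.+1%:Z) w = 0 by case: spanM_submod.
  rewrite /Vz /= ut_neg; case: b {ii} ni ii => ni ii.
    by apply: YZ1; move: ni ii ntp; lia.
  by apply: YZ0; move: ni ii ntp; lia.
have [q tq] : exists q : nat, t = (q.+1)%:Z by exists (`|t|.-1)%N; lia.
rewrite tq ut_nneg (YX_Xq hp HA _ (Zwt _ _)).
have inner b' : ((b', q%:Z) \in idx) \/ X ^+ q * Z b' w = 0 ->
    spanM (X ^+ q * Z b' w).
  move=> [iq|->]; last by case: spanM_submod.
  by rewrite -ut_nneg -[_ * _]/(Vz (b', q%:Z) w); apply: spanM_Vz.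
have iq : (b, q%:Z) \in idx.
  by move: ii; rewrite !mem_idx tq; case: (b); move: ntp; lia.
case: b ii iq => ii iq.
  rewrite (act_eigen _ (YX1 _)) -scalerAr; apply: submodZ spanM_submod _.
  by apply: inner; left.
have no : ~~ only by move: ii; rewrite mem_idx; case: (only).
have [c ->] := act_Z0 ('X - (gam k a q)%:P) w (nN_only no).
rewrite mulrDr -!scalerAr; apply: submodD spanM_submod _ _; apply: submodZ spanM_submod _.
  by apply: inner; left.
apply: inner; have [qnt|ntq] := leqP q n; last by right; apply: XZ1; move: ntp; lia.
by left; rewrite mem_idx (negbTE no) /=; move: ntp; lia.
Qed.

Lemma spanM_Xl l v : (l < p)%N -> spanM v -> spanM (hX l * v).
Proof.
move=> lp sv; rewrite (X_fact hp HA lp) -scalerAl; apply: submodZ spanM_submod _.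
by elim: l {lp} => [|l IHl]; rewrite ?mul1r // exprS -mulrA; apply: spanM_X.
Qed.

Lemma spanM_Yl l v : (l < p)%N -> spanM v -> spanM (hY l * v).
Proof.
move=> lp sv; rewrite (Y_fact hp HA lp) -scalerAl; apply: submodZ spanM_submod _.
by elim: l {lp} => [|l IHl]; rewrite ?mul1r // exprS -mulrA; apply: spanM_Y.
Qed.

Variable M : nat.
Hypothesis WX : forall m w, (m < M)%N -> W w -> W (hX m * w).
Hypothesis WY : forall m w, (m < M)%N -> W w -> W (hY m * w).

Lemma zero_idx b q : (b, q) \in idx -> (b, 0) \in idx.
Proof. by rewrite !mem_idx; case: b; move: ntp; lia. Qed.

Lemma spanM_ut b w i : (b, i) \in idx -> W w -> forall q : nat,
  spanM (X ^+ q * Z b w) /\ spanM (Y ^+ q * Z b w).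
Proof.
move=> ii Ww; have s0 : spanM (Z b w).
  have := spanM_Vz (zero_idx ii) Ww; by rewrite /Vz /= /ut /= mul1r.
elim=> [|q [IH1 IH2]]; first by rewrite !expr0 !mul1r.
by split; rewrite exprS -mulrA; [apply: spanM_X | apply: spanM_Y].
Qed.

(** Move the divided power past one Y at a time. The correction has degree one less than a multiple
    of p, so it splits as [X^(p-1)] times the preceding multiple of p, covered by induction on [q]
    for all [c]. *)
Lemma spanM_Xp b i : (b, i) \in idx -> forall q c w, (c < M)%N -> W w ->
  spanM (hX (c * p) * (Y ^+ q * Z b w)).
Proof.
move=> ii; elim=> [|q IHq] c w cM Ww.
  rewrite expr0 mul1r XZFr; have Wc := WX cM Ww.
  by have [+ _] := spanM_ut ii Wc 0; rewrite expr0 mul1r.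
case: c cM => [|c] cM.
  by rewrite mul0n (hax_X0 HA) mul1r; have [_] := spanM_ut ii Ww q.+1.
have cp : (c.+1 * p = (c * p + p.-1).+1)%N by rewrite mulSn; move: p0; lia.
rewrite cp exprS -mulrA (hXn_Y hp HA _ (wt_Yn hp HA q (Zwt b w))) -cp.
apply: submodD spanM_submod _ _; first exact/spanM_Y/IHq.
apply: submodZ spanM_submod _; rewrite (X_digit hp HA) ?prednK // (XXC HA) -mulrA.
by apply: spanM_Xl; [rewrite prednK | apply: IHq => //; apply: ltnW].
Qed.

Lemma spanM_Yp b i : (b, i) \in idx -> forall q c w, (c < M)%N -> W w ->
  spanM (hY (c * p) * (X ^+ q * Z b w)).
Proof.
move=> ii; elim=> [|q IHq] c w cM Ww.
  rewrite expr0 mul1r YZFr; have Wc := WY cM Ww.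
  by have [+ _] := spanM_ut ii Wc 0; rewrite expr0 mul1r.
case: c cM => [|c] cM.
  by rewrite mul0n (hax_Y0 HA) mul1r; have [] := spanM_ut ii Ww q.+1.
have cp : (c.+1 * p = (c * p + p.-1).+1)%N by rewrite mulSn; move: p0; lia.
rewrite cp exprS -mulrA (hYn_X hp HA _ (wt_Xn hp HA q (Zwt b w))) -cp -scaleNr.
apply: submodD spanM_submod _ _; first exact/spanM_X/IHq.
apply: submodZ spanM_submod _; rewrite (Y_digit hp HA) ?prednK // (YYC HA) -mulrA.
by apply: spanM_Yl; [rewrite prednK | apply: IHq => //; apply: ltnW].
Qed.

Lemma spanM_hX m v : (m < M * p)%N -> spanM v -> spanM (hX m * v).
Proof.
move=> mM; rewrite (divn_eq m p) (X_digit hp HA) ?ltn_mod // (XXC HA) -mulrA => sv.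
apply: spanM_Xl; first by rewrite ltn_mod.
have cM : (m %/ p < M)%N by rewrite ltn_divLR.
move: sv; apply: spanM_lmul => -[b t] w ii Ww; rewrite /Vz /=.
have [t0|t0] := leP 0 t.
  have [q ->] : exists q : nat, t = q%:Z by exists `|t|%N; lia.
  rewrite ut_nneg mulrA (_ : hX _ * X ^+ q = X ^+ q * hX (m %/ p * p)); last first.
    by rewrite (X_exp HA) -scalerAl -scalerAr (XXC HA).
  by rewrite -mulrA XZFr; have [] := spanM_ut ii (WX cM Ww) q.
have [q ->] : exists q : nat, t = - q%:Z by exists `|t|%N; lia.
by rewrite ut_neg; apply: spanM_Xp ii _ _ _ _ _.
Qed.

Lemma spanM_hY m v : (m < M * p)%N -> spanM v -> spanM (hY m * v).
Proof.
move=> mM; rewrite (divn_eq m p) (Y_digit hp HA) ?ltn_mod // (YYC HA) -mulrA => sv.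
apply: spanM_Yl; first by rewrite ltn_mod.
have cM : (m %/ p < M)%N by rewrite ltn_divLR.
move: sv; apply: spanM_lmul => -[b t] w ii Ww; rewrite /Vz /=.
have [t0|t0] := leP 0 t; last first.
  have [q ->] : exists q : nat, t = - q%:Z by exists `|t|%N; lia.
  rewrite ut_neg mulrA (_ : hY _ * Y ^+ q = Y ^+ q * hY (m %/ p * p)); last first.
    by rewrite (Y_exp HA) -scalerAl -scalerAr (YYC HA).
  by rewrite -mulrA YZFr; have [] := spanM_ut ii (WY cM Ww) q.
have [q ->] : exists q : nat, t = q%:Z by exists `|t|%N; lia.
by rewrite ut_nneg; apply: spanM_Yp ii _ _ _ _ _.
Qed.

End Span.

End Chain.

(** * The embedding of the prime field into [k] *)

Section PrimeField.
Variables (k : fieldType) (p : nat).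
Hypothesis hp : p \in [pchar k].
Let pP : prime p := pcharf_prime hp.

(** The characteristic hypothesis is an argument so that ring morphism instances can be attached to
    [femb hp]. *)
Definition femb of p \in [pchar k] : 'F_p -> k := @Fp_emb k p.

Lemma natr_modp m : (m %% p)%:R = m%:R :> k.
Proof. by rewrite {2}(divn_eq m p) natrD natrM (pcharf0 hp) mulr0 add0r. Qed.

Lemma femb_nat m : femb hp m%:R = m%:R.
Proof. by rewrite /femb /Fp_emb val_Fp_nat // natr_modp. Qed.

Let femb_zmod : zmod_morphism (femb hp).
Proof.
have D u v : femb hp (u + v) = femb hp u + femb hp v.
  have -> : u + v = ((u : nat) + (v : nat))%:R by rewrite natrD !natr_Zp.
  by rewrite femb_nat natrD.
by move=> x y; apply/eqP; rewrite eq_sym subr_eq -D subrK.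
Qed.

Let femb_monoid : monoid_morphism (femb hp).
Proof.
split=> [|u v]; first by rewrite -[1]/(1%:R : 'F_p) femb_nat.
have -> : u * v = ((u : nat) * (v : nat))%:R by rewrite natrM !natr_Zp.
by rewrite femb_nat natrM.
Qed.

HB.instance Definition _ := GRing.isZmodMorphism.Build 'F_p k (femb hp) femb_zmod.
HB.instance Definition _ := GRing.isMonoidMorphism.Build 'F_p k (femb hp) femb_monoid.

Lemma femb_int (z : int) : femb hp z%:~R = z%:~R.
Proof. exact: rmorph_int. Qed.

Lemma femb_inj : injective (femb hp).
Proof. exact: fmorph_inj. Qed.

Lemma map_rprod (g : nat -> 'F_p) i j :
  map_poly (femb hp) (rprod g i j) = rprod (fun l => femb hp (g l)) i j.
Proof.
rewrite /rprod rmorph_prod; apply: eq_bigr => l _.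
by rewrite rmorphB /= map_polyX map_polyC.
Qed.

End PrimeField.

Section MuWz.
Variables (k : fieldType) (p : nat).
Hypothesis hp : p \in [pchar k].
Variables (U : algType k) (hX hY : nat -> U) (E : (int -> k) -> U).
Hypothesis HA : hyper_axioms hX hY E.
Variable Fr : U -> U.
Hypothesis Fr_lin : linear Fr.
Hypothesis FrE : forall m f l, Phi f ->
  Fr (hY m * E f * hX l) = hY (m * p) * E (flr p f) * hX (l * p).
Local Notation mu := (@proj_mu k p U E).
Local Notation X := (hX 1).
Local Notation Y := (hY 1).

(** The factor in parentheses preserves weights modulo p, so the idempotent moves across it. *)
Lemma mu_Wz a s m z : (s <= m)%N ->
  mu a * (Y ^+ m * X ^+ (m - s) * Fr z * X ^+ s) = Wz p hX hY E Fr a s m z.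
Proof.
move=> sm; rewrite /Wz (Y_exp HA) (X_exp HA) (X_exp HA s).
rewrite -!(scalerAl, scalerAr) !scalerA.
rewrite !mulrA (mu_Y hp HA) -[_ * mu _ * _]mulrA (mu_X hp HA) mulrA -[_ * mu _ * _]mulrA.
have -> : mu (a + m.*2%:Z - (m - s).*2%:Z) = mu (a + s.*2%:Z) by congr (proj_mu _ _); lia.
rewrite (mu_Fr hp HA Fr_lin FrE) !mulrA -[_ * mu _ * _]mulrA (mu_X hp HA).
by rewrite addrK !mulrA; congr (_ *: _); rewrite -mulrA mulrC.
Qed.
End MuWz.

(** * The coefficients c_m as Newton coefficients *)

Section HyperLink.
Variables (k : fieldType) (p : nat).
Hypothesis hp : p \in [pchar k].
Let pP : prime p := pcharf_prime hp.
Let p0 : (0 < p)%N := prime_gt0 pP.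
Local Notation U := (hyper k).
Let HA : hyper_axioms (hX k) (hY k) (@hE k) := hyper_is_hyper k.
Local Notation X := (hX k 1).
Local Notation Y := (hY k 1).
Local Notation act := (yx_act (hX k) (hY k)).
Local Notation wmu := (@proj_mu k p U (@hE k)).

Lemma mu_wmu a : Defs.mu k p a = wmu a.
Proof.
rewrite /Defs.mu; case: (hE_bin k (- a - 1) p.-1) => _ ->; rewrite /proj_mu.
by apply: E_ext => x; rewrite (chE hp) addrA.
Qed.

(** [Fr_exists] shows that the specification can be met, so the chosen map meets it; linearity
    extends it from binomials to all functions in [Phi]. *)
Lemma Fr'_spec : linear (Fr' p (k := k)) /\ forall m f l, Phi f ->
  Fr' p (hY k m * hE f * hX k l) = hY k (m * p) * hE (flr p f) * hX k (l * p).
Proof.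
have flr_bin n : flr p (fun x => (binz x n)%:~R : k) = fun x => (binz x (n * p))%:~R.
  by apply/funext => x; rewrite /flr [RHS](binz_lucas hp) mulnK // modnMl bin0 mulr1.
have [F [Fl FE]] := Fr_exists hp HA.
set S : set (U -> U) := [set f : U -> U | linear f /\ forall m n m' : nat,
    f (hY k m * hbin k 0 n * hX k m')
    = hY k (m * p) * hbin k 0 (n * p) * hX k (m' * p)]%classic.
have SF : S F.
  split=> // m n l; rewrite -!hE_bin0 FE ?flr_bin //.
  by case: (Phi_bin0 (fun n => hbin k 0 n) n).
have [Frl FrE] : S (Fr' p (k := k)) by rewrite /Fr' -/S; apply: xgetPex; exists F.
split=> // m f l.
elim/(@Phi_ind k k^o (fun=> 0)): f / => [n||c f g Pf Pg Hf Hg].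
- by rewrite flr_bin !hE_bin0 FrE.
- rewrite -[flr p _]/(fun=> 0) hE0 !mulr0 !mul0r.
  by have := Frl (-1) 0 0; rewrite scaler0 addr0 scaleN1r addNr.
- rewrite hE_lin // mulrDr mulrDl -scalerAr -scalerAl Frl Hf Hg.
  have -> : flr p (fun x => c * f x + g x) = fun x => c * flr p f x + flr p g x by [].
  rewrite hE_lin; try exact: (Phi_flr hp).
  by rewrite mulrDr mulrDl -scalerAr -scalerAl.
Qed.

Let Frl := Fr'_spec.1.
Let FrE := Fr'_spec.2.

(** Moving the idempotent inside gives the square of a nonzero factorial times distinct PBW
    monomials. This is the uniqueness of the c_m. *)
Lemma muYX_free a (d : nat -> k) :
  wmu a * (\sum_(m < p) d m *: (Y ^+ m * X ^+ m)) = 0 -> forall m, (m < p)%N -> d m = 0.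
Proof.
move=> S0 m mp.
pose F (i : nat * nat) x := d i.1 * (i.1`!%:R * i.1`!%:R) * ind_mod k p (a + i.1.*2%:Z) x.
have PF i : Phi (F i) by apply: PhiZ; apply: (Phi_ch hp).
pose s := [seq (i, i) | i <- iota 0 p].
have us : uniq s by rewrite map_inj_uniq ?iota_uniq // => i j [].
have S1 : \sum_(i <- s) hY k i.1 * hE (F i) * hX k i.2 = 0.
  rewrite -[RHS]S0 big_map mulr_sumr -(big_mkord xpredT (fun m => wmu a * (d m *: (Y ^+ m * X ^+ m)))).
  rewrite /index_iota subn0; apply: eq_bigr => i _ /=.
  rewrite (EZ HA); last exact: (Phi_ch hp).
  rewrite -[hE _]/(wmu _) (Y_exp HA) (X_exp HA) -!scalerAr -!scalerAl -!scalerAr !scalerA.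
  by rewrite /= (mulrA (d i)); congr (_ *: _); rewrite [RHS]mulrA (mu_Y hp HA).
have := hax_free HA us PF S1 (i := (m, m)) (a + m.*2%:Z).
rewrite mem_map ?mem_iota ?mp => [/(_ isT)|i j [] //].
rewrite /F /= /ind_mod subrr dvdz0 mulr1 => /eqP; rewrite !mulf_eq0.
by rewrite (negbTE (fact_unit hp mp)) !orbF => /eqP.
Qed.

Lemma mu_YX_act a m : wmu a * (Y ^+ m * X ^+ m) =
  act (rprod (fun i : nat => gam k a i) 0 m) * wmu a.
Proof.
rewrite /rprod big_mkord -(YmXm hp HA m (wt_mu hp HA a)).
rewrite (Y_exp HA) (X_exp HA) -!scalerAr -!scalerAl -!scalerAr; do 2!congr (_ *: _).
rewrite mulrA (mu_Y hp HA) -mulrA (mu_X hp HA) addrK.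
by [].
Qed.

Section Link.
Variables (e : bool) (a : int) (j : rat) (s n' : nat) (f : {poly 'F_p}) (h : {poly k}).
Local Notation gm := (fun i : nat => gam k a i).
Local Notation gF := (fun i : nat => (i%:Z * (a + i%:Z + 1))%:~R : 'F_p).
Hypothesis nnE : nn p e (a, j) = n'%:R.
Hypothesis n'p : (n' <= p)%N.
Hypothesis sn' : (s <= n')%N.
Hypothesis BE : B1 k p e (a, j) = act (map_poly (femb hp) f) * wmu a.
Variable hF : {poly 'F_p}.
Hypothesis fE : f = rprod gF 0 n' * hF.
Hypothesis fh : map_poly (femb hp) f = rprod gm 0 s * h.

(** By [mu_YX_act] the c_m are the Newton coefficients of [f] at the nodes [gam]. The same
    coefficients, applied to the [Wz m z], sum to the quotient of [f] by its factors of index below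
    [s], evaluated at [YX] and applied to [Wz s z]. *)
Lemma Zmap_link z :
  wmu a * (\sum_(m < p | nn p e (a, j) <= m%:R)
      Fp_emb k (Bcoef k p e (a, j) m) *: (Y ^+ m * X ^+ (m - s) * Fr' p z * X ^+ s))
  = act h * Wz p (hX k) (hY k) (@hE k) (Fr' p (k := k)) a s s z.
Proof.
have [c [h' cE]] := newton gF hF n'p.
pose ck m := femb hp (c m).
have fgm : (fun l => femb hp (gF l)) = gm by apply/funext => i; rewrite femb_int.
have fK : map_poly (femb hp) f =
   \sum_(n' <= m < p) ck m *: rprod gm 0 m + map_poly (femb hp) h' * rprod gm 0 p.
  rewrite fE cE mulrDr rmorphD mulrCA rprod_cat //; congr (_ + _); last by rewrite rmorphM /= map_rprod fgm.
  rewrite mulr_sumr rmorph_sum /= big_nat_cond [RHS]big_nat_cond.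
  apply: eq_bigr => m /andP [/andP [nm _] _].
  by rewrite -scalerAr rprod_cat // -mul_polyC rmorphM /= map_polyC map_rprod fgm mul_polyC.
have sumE (F : nat -> U) : \sum_(m < p | nn p e (a, j) <= m%:R) F m = \sum_(n' <= m < p) F m.
  by rewrite big_geq_mkord; apply: eq_bigl => m; rewrite nnE ler_nat.
have act_p : act (rprod gm 0 p) * wmu a = 0.
  by rewrite -mu_YX_act (Y_p hp HA) // mul0r mulr0.
have cS : B1 k p e (a, j) = Defs.mu k p a *
     \sum_(m < p | nn p e (a, j) <= m%:R) Fp_emb k (c m) *: (Y ^+ m * X ^+ m).
  rewrite BE fK actD actM mulrDl -mulrA act_p mulr0 addr0 mu_wmu mulr_sumr.
  rewrite (sumE (fun m => wmu a * (Fp_emb k (c m) *: (Y ^+ m * X ^+ m)))) act_sum mulr_suml; apply: eq_bigr => m _.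
  by rewrite (actZ _ _ (ck m)) -scalerAl -mu_YX_act scalerAr.
set S : set (nat -> 'F_p) := [set c : nat -> 'F_p | B1 k p e (a, j) = Defs.mu k p (a, j).1 *
     \sum_(m < p | nn p e (a, j) <= m%:R) Fp_emb k (c m) *: (Y ^+ m * X ^+ m)]%classic.
have SB : S (Bcoef k p e (a, j)) by rewrite /Bcoef -/S; apply: xgetPex; exists c.
(* The chosen coefficients and the Newton coefficients both express the same element, so [muYX_free]
   identifies them. *)
have BcE m : (n' <= m < p)%N -> femb hp (Bcoef k p e (a, j) m) = ck m.
  case/andP => nm mp; pose d i := if (n' <= i)%N then femb hp (Bcoef k p e (a, j) i) - ck i else 0.
  suff /(_ m mp) : forall m, (m < p)%N -> d m = 0.
    by rewrite /d nm => /eqP; rewrite subr_eq0 => /eqP.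
  apply: (@muYX_free a).
  have e1 : B1 k p e (a, j) = wmu a * \sum_(n' <= m < p)
      femb hp (Bcoef k p e (a, j) m) *: (Y ^+ m * X ^+ m) by rewrite SB mu_wmu -sumE.
  move: cS; rewrite mu_wmu e1 (sumE (fun m => Fp_emb k (c m) *: (Y ^+ m * X ^+ m))) => /eqP; rewrite -subr_eq0 -mulrBr -sumrB => /eqP S0; rewrite -[RHS]S0.
  congr (_ * _); rewrite big_geq_mkord [RHS]big_mkcond /=.
  by apply: eq_bigr => i _; rewrite /d; case: ifP => _; rewrite ?scale0r // scalerBl.
rewrite mulr_sumr (sumE (fun m => wmu a * (Fp_emb k (Bcoef k p e (a, j) m) *:
  (Y ^+ m * X ^+ (m - s) * Fr' p z * X ^+ s)))).
transitivity (\sum_(n' <= m < p) ck m *: Wz p (hX k) (hY k) (@hE k) (Fr' p (k := k)) a s m z).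
  rewrite big_nat_cond [RHS]big_nat_cond; apply: eq_bigr => m /andP [mm _].
  rewrite -scalerAr -/(femb hp (Bcoef k p e (a, j) m)) (BcE m mm); congr (_ *: _).
  by apply: (mu_Wz hp HA Frl FrE); case/andP: mm => nm _; apply: leq_trans sn' nm.
have hK : h = \sum_(n' <= m < p) ck m *: rprod gm s m + map_poly (femb hp) h' * rprod gm s p.
  have nz : rprod gm 0 s != 0 by apply/monic_neq0/monic_prod_XsubC.
  apply: (mulfI nz); rewrite -fh fK mulrDr; congr (_ + _).
    rewrite mulr_sumr big_nat_cond [RHS]big_nat_cond; apply: eq_bigr => m /andP [/andP [nm _] _].
    by rewrite -scalerAr rprod_cat // (leq_trans sn').
  by rewrite [RHS]mulrCA rprod_cat // (leq_trans sn').
rewrite {1}hK actD actM mulrDl -mulrA (act_Wz hp HA Frl FrE) //; last exact: leq_trans n'p.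
rewrite (Wz_p hp HA _ _ _ _ (leqnn p)) mulr0 addr0 act_sum mulr_suml.
rewrite big_nat_cond [RHS]big_nat_cond; apply: eq_bigr => m /andP [/andP [nm _] _].
by rewrite (actZ _ _ (ck m)) -scalerAl (act_Wz hp HA Frl FrE) // (leq_trans sn').
Qed.
End Link.

End HyperLink.

(** * The polynomials psi as products over squares *)

Section SquareProd.
Variable p : nat.
Hypothesis pP : prime p.
Let p0 : (0 < p)%N := prime_gt0 pP.
Let charF : p \in [pchar 'F_p] := pchar_Fp pP.

Lemma prod_Fp (T : comNzRingType) (F : 'F_p -> T) :
  \prod_(0 <= i < p) F i%:R = \prod_x F x.
Proof.
have inj : injective (fun i : 'I_p => (i : nat)%:R : 'F_p).
  move=> i i' /(congr1 val) /=; rewrite !val_Fp_nat // !modn_small ?ltn_ord // => e.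
  exact: val_inj.
rewrite big_mkord [RHS](reindex (fun i : 'I_p => (i : nat)%:R)) //.
by apply/onW_bij/inj_card_bij; rewrite // card_Fp // card_ord.
Qed.

Variables (a : int).
Hypothesis podd : odd p.
Local Notation w := p./2.
Local Notation gF := (fun i : nat => (i%:Z * (a + i%:Z + 1))%:~R : 'F_p).
Local Notation q i := ('X - ((i ^ 2)%:R)%:P : {poly 'F_p}).
Definition half_sq : 'F_p := ((a + 1)%:~R / 2) ^+ 2.

Lemma two_neq0 : 2 != 0 :> 'F_p.
Proof.
rewrite -(dvdn_pcharf charF) dvdn_prime2 //.
by apply/eqP => e; move: podd; rewrite e.
Qed.

(** Completing the square explains the shift by ((a+1)/2)^2 in the argument of psi: it turns the
    nodes into squares. *)
Lemma gF_half (i : nat) : gF i + half_sq = (i%:R + (a + 1)%:~R / 2) ^+ 2.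
Proof.
rewrite /half_sq; have := two_neq0; rewrite !rmorphM !rmorphD /= => t.
by field.
Qed.

Lemma prod_fold (T : comNzRingType) (F : nat -> T) :
    (forall i, (i < w.+1)%N -> F (p - i)%N = F i) ->
  \prod_(1 <= i < p) F i = \prod_(1 <= i < w.+1) F i ^+ 2.
Proof.
move=> FE; rewrite (@big_cat_nat _ _ _ w.+1) //=; last first.
  by rewrite -[p in (_ < p)%N]odd_double_half podd; lia.
rewrite prodrXl expr2; congr (_ * _).
rewrite big_nat_rev /= -(add1n w) big_addn.
have -> : (p - w = w.+1)%N by rewrite -[p in LHS]odd_double_half podd; lia.
rewrite big_nat_cond [RHS]big_nat_cond; apply: eq_bigr => i /andP [/andP [i0 iw] _].
by have -> : (1 + w + p - (i + w).+1 = p - i)%N; [lia | apply: FE].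
Qed.

Lemma prod_sq : \prod_(x : 'F_p) ('X - (x ^+ 2)%:P) =
  'X * \prod_(1 <= i < w.+1) (q i) ^+ 2 :> {poly 'F_p}.
Proof.
rewrite -(prod_Fp (fun x => 'X - (x ^+ 2)%:P)) big_ltn // expr0n /= subr0; congr (_ * _).
rewrite prod_fold => [|i iw]; first by apply: eq_bigr => i _; rewrite natrX.
congr (_ - _%:P); rewrite natrB; last by rewrite -[p]odd_double_half podd; lia.
by rewrite (pcharf0 charF) sub0r sqrrN.
Qed.

Lemma rprod_sq : rprod gF 0 p =
  ('X * \prod_(1 <= i < w.+1) (q i) ^+ 2) \Po ('X + half_sq%:P).
Proof.
rewrite -prod_sq rmorph_prod /=.
rewrite (reindex_inj (addIr ((a + 1)%:~R / 2))) /=.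
rewrite -(prod_Fp (fun x => ('X - ((x + (a + 1)%:~R / 2) ^+ 2)%:P) \Po ('X + half_sq%:P))).
rewrite /rprod; apply: eq_bigr => i _.
rewrite -gF_half rmorphB /= comp_polyX comp_polyC polyCD.
by rewrite opprD addrACA subrr addr0.
Qed.

Lemma psi_spec (i n : nat) : (i <= w)%N ->
  (p%:Z %| (2 * n%:Z + a + 1 - 2 * i%:Z) * (2 * n%:Z + a + 1 + 2 * i%:Z))%Z ->
  let f e := psi p e i \Po ('X + half_sq%:P) in
  f true * ('X - (gF n)%:P) = rprod gF 0 p /\
  (i != 0%N -> exists l q : {poly 'F_p}, [/\ f false = l * q,
     q * ('X - (gF n)%:P) ^+ 2 = rprod gF 0 p & l.[gF n] != 0]).
Proof.
move=> iw dv f.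
have gE : gF n + half_sq = (i ^ 2)%:R.
  rewrite gF_half natrX.
  move: dv; rewrite (dvdz_pcharf charF) rmorphM /= !rmorphD !rmorphN !rmorphM /= => /eqP dv.
  have t := two_neq0; apply/eqP; rewrite -subr_eq0.
  have := congr1 (fun x => x / 2 ^+ 2) dv; rewrite mul0r => <-.
  rewrite rmorphD /=; apply/eqP; field.
  by rewrite (_ : 4 = 2 * 2 :> 'F_p) ?mulf_neq0 ?t -?natrM.
have XgE : 'X - (gF n)%:P = q i \Po ('X + half_sq%:P).
  rewrite rmorphB /= comp_polyX comp_polyC -gE polyCD.
  by rewrite opprD addrACA subrr addr0.
split.
  rewrite XgE rprod_sq -rmorphM /=; congr (_ \Po _); rewrite /psi.
  case: eqP => [->|/eqP i0]; first by rewrite exp0n // subr0 mulrC.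
  rewrite (bigD1_seq i) ?iota_uniq ?mem_index_iota ?lt0n ?i0 //=.
  by rewrite expr2; ring.
move=> i0; pose rest := \prod_(1 <= j < w.+1 | j != i) (q j) ^+ 2.
exists ((2%:P * ('X + ((i ^ 2)%:R)%:P)) \Po ('X + half_sq%:P)).
exists (('X * rest) \Po ('X + half_sq%:P)); split.
- rewrite -rmorphM /=; congr (_ \Po _); rewrite /psi (negbTE i0) -/rest -mul_polyC.
  by ring.
- rewrite XgE rprod_sq -rmorphXn -rmorphM /=; congr (_ \Po _).
  rewrite (bigD1_seq i) ?iota_uniq ?mem_index_iota ?lt0n ?i0 //=.
  by rewrite -/rest; ring.
- rewrite horner_comp !hornerE gE -!mulr2n -[(i ^ 2)%:R *+ 2]mulr_natl !mulf_neq0 ?two_neq0 //.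
  rewrite natrX expf_neq0 // -(dvdn_pcharf charF) gtnNdvd ?lt0n //.
  by rewrite -[p]odd_double_half podd; lia.
Qed.
End SquareProd.

Section HornerMu.
Variables (k : fieldType) (p : nat).
Hypothesis hp : p \in [pchar k].
Variables (U : algType k) (hX hY : nat -> U) (E : (int -> k) -> U).
Hypothesis HA : hyper_axioms hX hY E.
Local Notation X := (hX 1).
Local Notation Y := (hY 1).
Local Notation act := (yx_act hX hY).
Local Notation wmu := (@proj_mu k p U E).

Lemma YX_wmu a : wmu a * (Y * X) = Y * X * wmu a.
Proof. by rewrite mulrA (mu_Y hp HA) -mulrA (mu_X hp HA) addrK mulrA. Qed.

(** The idempotent commutes with [YX], so inside the polynomial it is absorbed by the one on the
    right. *)
Lemma horner_mu a c (g : {poly k}) :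
  horner_alg (wmu a * Y * X + c%:A) g * wmu a = act (g \Po ('X + c%:P)) * wmu a.
Proof.
elim/poly_ind: g => [|g d IHg]; first by rewrite comp_poly0 /yx_act !rmorph0.
rewrite comp_polyD comp_polyM comp_polyX comp_polyC actD actM actD actX !actC.
rewrite rmorphD rmorphM /= horner_algX horner_algC !mulrDl; congr (_ + _).
have -> : horner_alg (wmu a * Y * X + c%:A) g * (wmu a * Y * X + c%:A) * wmu a =
    horner_alg (wmu a * Y * X + c%:A) g * wmu a * (Y * X + c%:A).
  rewrite -[LHS]mulrA -[RHS]mulrA; congr (_ * _); rewrite mulrDl mulrDr; congr (_ + _).
    by rewrite -[wmu a * Y * X]mulrA -[LHS]mulrA -YX_wmu !mulrA (mu_idem hp HA).
  by rewrite -scalerAl mul1r -scalerAr mulr1.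
rewrite IHg -[LHS]mulrA -[RHS]mulrA; congr (_ * _).
rewrite mulrDl mulrDr YX_wmu; congr (_ + _).
by rewrite -scalerAl mul1r -scalerAr mulr1.
Qed.

End HornerMu.

(** * Numerical and polynomial data of a pair (a,j) *)

Section Datum.
Variables (k : fieldType) (p : nat).
Hypothesis hp : p \in [pchar k].
Let pP : prime p := pcharf_prime hp.
Let p0 : (0 < p)%N := prime_gt0 pP.
Local Notation U := (hyper k).
Let HA : hyper_axioms (hX k) (hY k) (@hE k) := hyper_is_hyper k.
Local Notation X := (hX k 1).
Local Notation Y := (hY k 1).
Local Notation act := (yx_act (hX k) (hY k)).
Local Notation wmu := (@proj_mu k p U (@hE k)).
Local Notation gF a := (fun i : nat => (i%:Z * (a + i%:Z + 1))%:~R : 'F_p).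

(** What remains of the case distinctions (A)-(D) and of the parity of p: the four integers come
    from [n] and [nt] by complement to p-1, and the polynomials [f] are the full product with one or
    two equal factors removed. *)
Record datum (aj : int * rat) (n nt s : nat) (f : bool -> {poly 'F_p})
    (l q : {poly 'F_p}) : Prop := Datum {
  dt_lt : (n + nt < p)%N;
  dt_dvd : (p%:Z %| aj.1 + n%:Z - nt%:Z)%Z;
  dt_E : condE p aj = (n + nt == p.-1);
  dt_nn : forall e, nn p e aj = (if e then p.-1 - nt else n)%N%:R;
  dt_nt : forall e, ntilde p e aj = (if e then p.-1 - n else nt)%N%:R;
  dt_shift : if condA p aj || condC p aj then s = shift p aj /\
      [&& p - hat p aj.1 <= n, s <= p - hat p aj.1 & p - hat p aj.1 <= s.*2]%N
    else s = 0%N /\ (hat p aj.1 <= nt)%N;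
  dt_f1 : f true * ('X - (gF aj.1 n)%:P) = rprod (gF aj.1) 0 p;
  dt_f0 : ~~ condE p aj -> [/\ f false = l * q,
    q * ('X - (gF aj.1 n)%:P) ^+ 2 = rprod (gF aj.1) 0 p & l.[gF aj.1 n] != 0];
  dt_B1 : forall e, B1 k p e aj = act (map_poly (femb hp) (f e)) * wmu aj.1
}.

Section Odd.
Hypothesis podd : odd p.
Let p2 : (p == 2)%N = false.
Proof. by apply/eqP => e; move: podd; rewrite e. Qed.

Lemma B1_odd e a (i : nat) :
  B1 k p e (a, i%:R) = act (map_poly (femb hp) (psi p e i \Po ('X + (half_sq p a)%:P))) * wmu a.
Proof.
have E c : act (map_poly (femb hp) (psi p e i \Po ('X + c%:P))) =
    act (map_poly (femb hp) (psi p e i) \Po ('X + (femb hp c)%:P)).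
  by rewrite map_comp_poly rmorphD /= map_polyX map_polyC.
rewrite E -(horner_mu hp HA) /B1 p2 natrK.
rewrite (mu_wmu hp); congr (_ * _); congr (horner_alg (_ + _%:A) _).
rewrite /half_sq rmorphXn fmorph_div rmorph_int /=; congr ((_ / _) ^+ 2).
exact/esym/(rmorph_nat _ 2).
Qed.

Lemma datum_odd a (i : nat) : (i <= p./2)%N ->
  exists n nt s f l q, datum (a, i%:R) n nt s f l q.
Proof.
move=> iw; set w := p./2 in iw *.
have pE : p = (w + w).+1 by rewrite -[LHS]odd_double_half podd addnn.
have hlt := hat_lt hp a.
(* With [p = 2w + 1] and [hat p a] equal to [2u] or [2u + 1], conditions (C), (D) compare [i] with
   [u], and (A), (B) compare [i] with [w - u]. *)
have [u hE] : exists u, hat p a = ((u + u) + odd (hat p a))%N.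
  by exists (hat p a)./2; rewrite addnn addnC odd_double_half.
have aE := divz_hat hp a.
have PQ : p%:R = w%:R + w%:R + 1 :> rat by rewrite {1}pE -addn1 !natrD.
suff [n [nt [s []]]] : exists n nt s,
  [/\ (n + nt < p)%N, (p%:Z %| a + n%:Z - nt%:Z)%Z,
     (i == 0%N) = (n + nt == p.-1),
     (forall e, nn p e (a, i%:R) = (if e then p.-1 - nt else n)%N%:R) /\
     (forall e, ntilde p e (a, i%:R) = (if e then p.-1 - n else nt)%N%:R) &
     ((p%:Z %| 2 * n%:Z + a + 1 - 2 * i%:Z) || (p%:Z %| 2 * n%:Z + a + 1 + 2 * i%:Z))%Z /\
     if condA p (a, i%:R) || condC p (a, i%:R) then s = shift p (a, i%:R) /\
      [&& p - hat p a <= n, s <= p - hat p a & p - hat p a <= s.*2]%N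
    else s = 0%N /\ (hat p a <= nt)%N].
  move=> H1 H2 H3 [H4 H5] [H6 H7].
  have dv : (p%:Z %| (2 * n%:Z + a + 1 - 2 * i%:Z) * (2 * n%:Z + a + 1 + 2 * i%:Z))%Z.
    by case/orP: H6 => H; [apply: dvdz_mulr | apply: dvdz_mull].
  have [f1 f0] := psi_spec pP podd iw dv.
  have [i0|i0] := eqVneq i 0%N.
    (* For [j = 0] condition (E) holds and there is nothing to factor in [f false], so [l] and [q]
       are placeholders. *)
    exists n, nt, s, (fun e => psi p e i \Po ('X + (half_sq p a)%:P)), 0, 0.
    split=> // [||e]; rewrite ?B1_odd // /condE p2 i0 ?eqxx //.
    by rewrite -H3 i0.
  have [l [q [f0E qE lE]]] := f0 i0.
  exists n, nt, s, (fun e => psi p e i \Po ('X + (half_sq p a)%:P)), l, q.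
  split=> // [|e]; rewrite ?B1_odd // /condE p2 -H3.
  by rewrite pnatr_eq0.
have PmE : p.-1 = (w + w)%N by rewrite pE.
move: aE; set q := (a %/ p%:Z)%Z; move: (q) (w) iw pE PQ PmE => {}q {}w iw pE PQ PmE aE.
have [o|o] := boolP (odd (hat p a)).
  have hE1 : hat p a = (u + u).+1 by rewrite hE o addn1.
  have HQ : (hat p a)%:R = u%:R + u%:R + 1 :> rat by rewrite {1}hE1 -addn1 !natrD.
  have cA : condA p (a, i%:R) = false by rewrite /condA o /= andbF.
  have cB : condB p (a, i%:R) = false by rewrite /condB o.
  have cC : condC p (a, i%:R) = (i <= u)%N.
    rewrite /condC o p2 ler0n /= HQ (_ : (_ + 1 - 1) / 2 = u%:R) ?ler_nat //; by field.
  have sE : shift p (a, i%:R) = (w - u)%N.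
    by rewrite /shift p2 /= o hE1; lia.
  rewrite /nn /ntilde cA cB cC PQ HQ sE hE1 PmE /=; case: leqP => iu.
    exists (w + w - u - i)%N, (u - i)%N, (w - u)%N; split.
    - by lia.
    - by apply/dvdzP; exists (q + 1); lia.
    - by lia.
    - have c1 : (w + w - u - i)%:R = w%:R + w%:R - u%:R - i%:R :> rat by rewrite !natrB ?natrD //; lia.
      have c2 : (u - i)%:R = u%:R - i%:R :> rat by rewrite natrB.
      split=> -[]; rewrite ?c1 ?c2; try lra.
        by rewrite natrB ?natrD ?c2; [lra | lia].
      by rewrite natrB ?natrD ?c1; [lra | lia].
    - split; last by split; lia.
      by apply/orP; right; apply/dvdzP; exists (q + 2); lia.
  exists (i - u.+1)%N, (u + i)%N, 0%N; split.
  - by lia.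
  - by apply/dvdzP; exists q; lia.
  - by lia.
  - have c1 : (i - u.+1)%:R = i%:R - u%:R - 1 :> rat by rewrite natrB // -addn1 natrD; lra.
    split=> -[]; rewrite ?c1 ?natrD; try lra.
      by rewrite natrB ?natrD; [lra | lia].
    by rewrite natrB ?natrD ?c1; [lra | lia].
  - split; last by split; lia.
    by apply/orP; left; apply/dvdzP; exists q; lia.
have hE1 : hat p a = (u + u)%N by rewrite hE (negbTE o) addn0.
have HQ : (hat p a)%:R = u%:R + u%:R :> rat by rewrite {1}hE1 !natrD.
have uw : (u <= w)%N by lia.
have cA : condA p (a, i%:R) = (w - u < i)%N.
  have c : (w - u).+1%:R = w%:R - u%:R + 1 :> rat by rewrite -addn1 natrD natrB.
  rewrite /condA p2 o /= PQ HQ -(ler_nat rat) c.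
  rewrite [X in _ && X](_ : _ = true) ?andbT; last first.
    by rewrite (_ : (_ + 1 - 1) / 2 = w%:R) ?ler_nat //; field.
  by congr (_ <= _); field.
have cB : condB p (a, i%:R) = (i <= w - u)%N.
  rewrite /condB o p2 ler0n /= PQ HQ -(ler_nat rat) natrB //; congr (_ <= _); by field.
have cC : condC p (a, i%:R) = false by rewrite /condC (negbTE o).
have sE : shift p (a, i%:R) = (w - u).+1.
  by rewrite /shift p2 /= (negbTE o) hE1; lia.
rewrite /nn /ntilde cA cB cC PQ HQ sE hE1 PmE orbF; case: ltnP => iu.
  exists (w - u + i)%N, (i + u - w.+1)%N, (w - u).+1; split.
  - by lia.
  - by apply/dvdzP; exists (q + 1); lia.
  - by lia.
  - have c1 : (w - u + i)%:R = w%:R - u%:R + i%:R :> rat by rewrite natrD natrB.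
    have c2 : (i + u - w.+1)%:R = i%:R + u%:R - w%:R - 1 :> rat.
      by rewrite natrB ?natrD -?natr1; [lra | lia].
    split=> -[]; rewrite ?c1 ?c2; try lra.
      by rewrite natrB ?natrD ?c2; [lra | lia].
    by rewrite natrB ?natrD ?natrB; [lra | lia..].
  - split; last by split; lia.
    by apply/orP; left; apply/dvdzP; exists (q + 1); lia.
exists (w - u - i)%N, (w + u - i)%N, 0%N; split.
- by lia.
- by apply/dvdzP; exists q; lia.
- by lia.
- have c1 : (w - u - i)%:R = w%:R - u%:R - i%:R :> rat by rewrite !natrB.
  have c2 : (w + u - i)%:R = w%:R + u%:R - i%:R :> rat.
    by rewrite natrB ?natrD //; lia.
  split=> -[]; rewrite ?c1 ?c2; try lra.
    by rewrite natrB ?natrD ?c2; [lra | lia].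
  by rewrite natrB ?natrD ?c1; [lra | lia].
- split; last by split; lia.
  by apply/orP; right; apply/dvdzP; exists (q + 1); lia.
Qed.
End Odd.

Section Two.
Hypothesis p2 : p = 2%N.

Lemma B1_two e a j : PZ p (a, j) -> B1 k p e (a, j) =
  act (map_poly (femb hp) (if ~~ odd (hat p a) then (if e then 'X else 1)
    else if j == 0 then 'X else 'X + 1)) * wmu a.
Proof.
have muYX b : Defs.mu k p b * Y * X = act 'X * wmu b.
  by rewrite (mu_wmu hp) actX -mulrA (YX_wmu hp HA).
have pE : (p == 2)%N by rewrite p2.
have aE := divz_hat hp a; have hlt := hat_lt hp a.
have muE b : hat p a = b -> wmu b%:Z = wmu a.
  move=> hb; apply: mu_per; apply/dvdzP.
  by exists (- (a %/ p%:Z)%Z); rewrite -hb; lia.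
rewrite /B1 pE /PZ pE => _.
have [o|o] := boolP (odd (hat p a)) => /=.
  have h1 : hat p a = 1%N by move: o hlt; move: (hat p a); rewrite p2 => -[|[]].
  have e1 : wmu 1 = wmu a := muE 1%N h1.
  rewrite muYX !(mu_wmu hp) e1; case: ifP => _; first by rewrite map_polyX.
  by rewrite rmorphD /= map_polyX rmorph1 actD act1 mulrDl mul1r.
have h0 : hat p a = 0%N by move: o hlt; move: (hat p a); rewrite p2 => -[|[]].
have e0 : wmu 0 = wmu a := muE 0%N h0.
by case: ifP => _; rewrite ?muYX ?(mu_wmu hp) e0 ?map_polyX // rmorph1 act1 mul1r.
Qed.

(** For p = 2 the full product is [X (X + 1)] if [a] is odd and [X^2] if [a] is even. The three
    families of elements omit one of the two distinct factors, respectively one or both of the equal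
    ones. *)
Lemma datum_two a j : PZ p (a, j) -> exists n nt s f l q, datum (a, j) n nt s f l q.
Proof.
move=> pz; have pE : (p == 2)%N by rewrite p2.
have aE := divz_hat hp a; have hlt := hat_lt hp a.
have c2 : 2 = 0 :> 'F_p by apply/eqP; rewrite -(dvdn_pcharf (pchar_Fp pP)) p2.
have gE i : (i%:Z * (a + i%:Z + 1))%:~R = i%:R * ((hat p a)%:R + i%:R + 1) :> 'F_p.
  rewrite {1}aE rmorphM !rmorphD rmorphM /= -[(p%:Z)%:~R]/(p%:R) (pcharf0 (pchar_Fp pP)).
  by rewrite mulr0 add0r.
have rE : rprod (gF a) 0 p = 'X * ('X - ((hat p a)%:R + 2)%:P).
  rewrite /rprod (_ : index_iota 0 p = [:: 0; 1]%N); last by rewrite p2.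
  rewrite !big_cons big_nil mulr1 !gE mul0r subr0 mul1r.
  by rewrite -addrA.
have := pz; rewrite /PZ pE.
have B := fun e => B1_two e pz.
have [o|o] := boolP (odd (hat p a)) => /=.
  have h1 : hat p a = 1%N by move: o hlt; move: (hat p a); rewrite p2 => -[|[]].
  move: rE; rewrite h1 c2 addr0 => rE.
  case/orP => /eqP jE; subst j.
    exists 1%N, 0%N, 1%N, (fun=> 'X), 0, 0; split=> [||||||||e] /=; last by rewrite -/(B1 k p e (a, _)) B o.
    - by rewrite p2.
    - by apply/dvdzP; exists ((a %/ p%:Z)%Z + 1); lia.
    - by rewrite /condE pE o p2.
    - by case; rewrite /nn /condA /condB /condC o pE h1 p2 /=.
    - by case; rewrite /ntilde /condA /condB /condC o pE h1 p2 /=.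
    - rewrite /condA /condC pE o /= /shift pE; split=> //; rewrite h1 p2; by [].
    - by rewrite gE h1 rE mul1r -[1 + 1]/(2) c2 add0r.
    - by rewrite pE o.
  exists 0%N, 1%N, 0%N, (fun=> 'X + 1), 0, 0; split=> [||||||||e] /=; last by rewrite -/(B1 k p e (a, _)) B o.
  - by rewrite p2.
  - by apply/dvdzP; exists (a %/ p%:Z)%Z; lia.
  - by rewrite /condE pE o p2.
  - by case; rewrite /nn /condA /condB /condC o pE h1 p2 /=.
  - by case; rewrite /ntilde /condA /condB /condC o pE h1 p2 /=.
  - by rewrite /condA /condC pE o /= h1.
  - rewrite gE h1 rE mul0r subr0 mulrC; congr (_ * _).
    rewrite -polyCN -[1 in LHS]polyC1; congr (_ + _%:P).
    by apply/eqP; rewrite -subr_eq0 opprK; apply/eqP.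
  - by rewrite pE o.
have h0 : hat p a = 0%N by move: o hlt; move: (hat p a); rewrite p2 => -[|[]].
move: rE; rewrite h0 c2 addr0 subr0 => rE /eqP jE; subst j.
exists 0%N, 0%N, 0%N, (fun e => if e then 'X else 1), 1, 1; split=> [||||||||e] /=; last by rewrite -/(B1 k p e (a, _)) B o.
- by rewrite p2.
- by apply/dvdzP; exists (a %/ p%:Z)%Z; lia.
- by rewrite /condE pE (negbTE o) p2.
- by case; rewrite /nn /condA /condB /condC o pE h0 p2 /=.
- by case; rewrite /ntilde /condA /condB /condC o pE h0 p2 /=.
- by rewrite /condA /condC pE (negbTE o) /= h0.
- by rewrite gE h0 rE mul0r subr0.
- move=> _; rewrite gE mul0r subr0 mulr1 mul1r expr2 rE hornerC oner_neq0.
  by split.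
Qed.
End Two.

Lemma exists_datum aj : PZ p aj -> exists n nt s f l q, datum aj n nt s f l q.
Proof.
case: aj => a j pz; have [p2|p2] := eqVneq p 2%N; first exact: datum_two.
have podd : odd p by case: (even_prime pP) p2 => [->|].
have := pz; rewrite /PZ (negbTE p2) => /existsP [i /eqP ->].
by apply: datum_odd => //; rewrite -ltnS.
Qed.
End Datum.

(** * Identification of the given elements and maps with the maps [Zm] *)

Section Link2.
Variables (k : fieldType) (p : nat).
Hypothesis hp : p \in [pchar k].
Let pP : prime p := pcharf_prime hp.
Let p0 : (0 < p)%N := prime_gt0 pP.
Local Notation U := (hyper k).
Let HA : hyper_axioms (hX k) (hY k) (@hE k) := hyper_is_hyper k.
Let Frl := (Fr'_spec hp).1.
Let FrE := (Fr'_spec hp).2.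

Variables (aj : int * rat) (n nt s : nat) (f : bool -> {poly 'F_p}) (l q : {poly 'F_p}).
Hypothesis D : datum hp aj n nt s f l q.
Local Notation a := aj.1.
Local Notation N := (p.-1 - nt)%N.
Local Notation gF := (fun i : nat => (i%:Z * (a + i%:Z + 1))%:~R : 'F_p).
Local Notation gm := (fun i : nat => gam k a i).

(** The cofactor of B^(0) over [k]; its value at the eigenvalue is the scalar beta. Under (E), where
    epsilon = 0 is excluded, it is set to 1. *)
Definition dbeta : {poly k} := if condE p aj then 1 else map_poly (femb hp) l.
Local Notation Z := (Zm p (hX k) (hY k) (@hE k) (Fr' p (k := k)) a n nt s dbeta).

Lemma dt_shift_ok : shift_ok p a n nt s.
Proof.
have := dt_shift D; rewrite /shift_ok; case: ifP => _ [-> H]; last by rewrite eqxx H.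
by rewrite H orbT.
Qed.
Let hs := dt_shift_ok.
Let ntp := dt_lt D.
Let ant := dt_dvd D.

Lemma dbeta_neq0 : dbeta.[gam k a n] != 0.
Proof.
rewrite /dbeta; case: ifP => cE; first by rewrite hornerC oner_neq0.
have [|_ _ lE] := dt_f0 D; first by rewrite cE.
have -> : gam k a n = femb hp (gF n) by rewrite femb_int.
by rewrite horner_map /= fmorph_eq0.
Qed.

Lemma dt_nN : ~~ condE p aj -> (n < N)%N.
Proof. by rewrite (dt_E D); move: ntp; lia. Qed.

Let nN : (n <= N)%N. Proof. by move: ntp p0; lia. Qed.
Let np : (n < p)%N. Proof. by move: ntp; lia. Qed.
Let Np : (N < p)%N. Proof. by move: p0; lia. Qed.
Let sn : (s <= n)%N.
Proof. by move: hs; case/orP => [/andP [/eqP -> //]|/and3P [? ? _]]; lia. Qed.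

Let gFN : gF N = gF n.
Proof. by apply: (@femb_inj k p hp); rewrite !femb_int; exact: (gam_N hp ntp ant hs). Qed.

Let Xg_neq0 : 'X - (gF n)%:P != 0. Proof. by rewrite polyXsubC_eq0. Qed.

Lemma dt_f1n : f true = rprod gF 0 n * rprod gF n.+1 p.
Proof.
apply: (mulIf Xg_neq0); rewrite (dt_f1 D).
rewrite -(@rprod_cat _ gF 0 n p) // 1?ltnW // (@rprod_recl _ gF n p) //.
by ring.
Qed.

Lemma dt_f1N : f true = rprod gF 0 N * rprod gF N.+1 p.
Proof.
apply: (mulIf Xg_neq0); rewrite (dt_f1 D).
rewrite -(@rprod_cat _ gF 0 N p) // 1?ltnW // (@rprod_recl _ gF N p) // gFN.
by ring.
Qed.

Lemma dt_f0n : ~~ condE p aj ->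
  f false = l * (rprod gF 0 n * (rprod gF n.+1 N * rprod gF N.+1 p)).
Proof.
move=> cE; have [-> qE _] := dt_f0 D cE; congr (_ * _); have nlN := dt_nN cE.
apply: (mulIf (expf_neq0 2 Xg_neq0)); rewrite qE.
rewrite -(@rprod_cat _ gF 0 n p) // 1?ltnW // (@rprod_recl _ gF n p) //.
rewrite -(@rprod_cat _ gF n.+1 N p) // 1?ltnW // (@rprod_recl _ gF N p) // gFN.
by ring.
Qed.

Lemma map_dt_f e : (condE p aj -> e = true) ->
  map_poly (femb hp) (f e) = rprod gm 0 s * Zg p a n nt s dbeta e.
Proof.
have fgm : (fun l => femb hp (gF l)) = gm by apply/funext => i; rewrite femb_int.
have sE : rprod gm 0 n = rprod gm 0 s * rprod gm s n by rewrite rprod_cat.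
case: e => [_|cE]; rewrite /Zg.
  by rewrite dt_f1n rmorphM /= !map_rprod fgm sE mulrA.
have {}cE : ~~ condE p aj by apply/negP => /cE.
rewrite dt_f0n // !rmorphM /= !map_rprod fgm sE /dbeta (negbTE cE).
by ring.
Qed.

Lemma B1_Zm e : (condE p aj -> e = true) -> B1 k p e aj = Z e 1.
Proof.
move=> cE; rewrite (dt_B1 D) map_dt_f // mulrC actM -mulrA; congr (_ * _).
rewrite -(mu_YX_act hp).
have := mu_Wz hp HA Frl FrE a 1 (leqnn s).
by rewrite (Fr_1 HA FrE) subnn expr0 !mulr1.
Qed.

Lemma Zmap_Zm e z : (condE p aj -> e = true) -> Zmap p e z aj = Z e z.
Proof.
move=> cE; have := dt_shift D; rewrite /Zmap; case: ifP => cAC [sE H].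
  rewrite (mu_wmu hp) -sE.
  have nnE := dt_nn D e; have BE := dt_B1 D e; have mE := map_dt_f cE.
  have [hF hFE] : exists hF, f e = rprod gF 0 (if e then N else n) * hF.
    case: e cE {nnE BE mE} => cE; first by exists (rprod gF N.+1 p); rewrite dt_f1N.
    exists (l * (rprod gF n.+1 N * rprod gF N.+1 p)); rewrite mulrCA dt_f0n //.
    by apply/negP => /cE.
  have := @Zmap_link k p hp e a aj.2 s (if e then N else n) (f e) (Zg p a n nt s dbeta e).
  rewrite -surjective_pairing; apply=> //; last exact: hFE.
    by case: (e); [exact: ltnW | exact: ltnW].
  by case: (e) => //; exact: leq_trans nN.
by rewrite B1_Zm // -(Zm_s0 hp HA Frl FrE).
Qed.
End Link2.

(** * The interface for one digit *)

Section Layer.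
Variables (k : fieldType) (p : nat).
Hypothesis hp : p \in [pchar k].
Let pP : prime p := pcharf_prime hp.
Let p0 : (0 < p)%N := prime_gt0 pP.
Local Notation U := (hyper k).
Let HA : hyper_axioms (hX k) (hY k) (@hE k) := hyper_is_hyper k.
Let Frl := (Fr'_spec hp).1.
Let FrE := (Fr'_spec hp).2.
Local Notation X := (hX k 1).
Local Notation Y := (hY k 1).
Local Notation ut := (@u_pow k U (hX k) (hY k)).

(** One coordinate of [Theta], with [x] the pair (theta_i, t_i); negation encodes theta_i + 1. *)
Definition good (e : bool) (aj : int * rat) (x : bool * int) : bool :=
  [&& e ==> x.1, condE p aj ==> x.1, - ntilde p (~~ x.1) aj <= x.2%:~R
    & x.2%:~R <= nn p (~~ x.1) aj].

Definition spanW (Z : bool -> U -> U) (I : seq (bool * int)) (W : U -> Prop) (v : U) :=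
  exists c : bool * int -> U, (forall i, W (c i)) /\
    v = \sum_(i <- I) ut i.2 * Z i.1 (c i).

(** All that the induction over digits needs. Coefficients are elements of U or of a subspace [W]
    rather than scalars, so that the basis for the remaining digits can be substituted; [ly_span]
    multiplies the range of admissible divided powers by p. *)
Record layer (e : bool) (aj : int * rat) (Z : bool -> U -> U) (I : seq (bool * int)) :
    Prop := Layer {
  ly_Z : forall b z, (condE p aj -> b = true) -> Zmap p b z aj = Z b z;
  ly_B1 : B1 k p e aj = Z e 1;
  ly_uniq : uniq I;
  ly_mem : forall x, (x \in I) = good e aj x;
  ly_lin : forall b, linear (Z b);
  ly_X : forall b c z, hX k (c * p) * Z b z = Z b (hX k c * z);
  ly_Y : forall b c z, hY k (c * p) * Z b z = Z b (hY k c * z);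
  ly_free : forall c : bool * int -> U,
    \sum_(i <- I) ut i.2 * Z i.1 (c i) = 0 -> forall i, i \in I -> c i = 0;
  ly_span : forall W M, submod W ->
    (forall m w, (m < M)%N -> W w -> W (hX k m * w)) ->
    (forall m w, (m < M)%N -> W w -> W (hY k m * w)) ->
    submod (spanW Z I W) /\
    (forall i w, i \in I -> W w -> spanW Z I W (ut i.2 * Z i.1 w)) /\
    forall m v, (m < M * p)%N -> spanW Z I W v ->
      spanW Z I W (hX k m * v) /\ spanW Z I W (hY k m * v);
  ly_0 : (e, 0) \in I;
  ly_gen : forall b, (e -> b = true) -> exists g, Ur k p 1 g /\ forall z, Z b z = g * Z e z
}.

Lemma layerP e aj : PZ p aj -> (condE p aj -> e = true) -> exists Z I, layer e aj Z I.
Proof.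
move=> pz cE; have [n [nt [s [f [l [q D]]]]]] := exists_datum hp pz.
have hs := dt_shift_ok D; have ntp := dt_lt D; have ant := dt_dvd D.
pose lk := dbeta hp aj l; pose g := gam k aj.1 n.
pose Z := Zm p (hX k) (hY k) (@hE k) (Fr' p (k := k)) aj.1 n nt s lk.
pose only := e || condE p aj.
have Zl : forall b, linear (Z b) by move=> b; apply: (Zm_lin _ _ _ _ Frl).
have Zw b z : has_wt p (@hE k) aj.1 (Z b z) by apply: (wt_Zm hp HA Frl FrE).
have Z1 z : Y * (X * Z true z) = g *: Z true z.
  by apply: (YX_Zm1 hp HA Frl FrE).
have Z0 : (n < p.-1 - nt)%N -> forall z,
    Y * (X * Z false z) = g *: Z false z + lk.[g] *: Z true z.
  by move=> nN z; apply: (YX_Zm0 hp HA Frl FrE).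
have ZX b c z : hX k (c * p) * Z b z = Z b (hX k c * z) by exact: (XFr_Zm hp HA Frl FrE).
have ZY b c z : hY k (c * p) * Z b z = Z b (hY k c * z) by exact: (YFr_Zm hp HA Frl FrE).
have lg : lk.[g] != 0 by exact: (dbeta_neq0 D).
have XZ1 q' z : (p <= q' + (p.-1 - n))%N -> X ^+ q' * Z true z = 0.
  exact: (X_Zm1 hp HA Frl FrE).
have XZ0 q' z : (p <= q' + nt)%N -> X ^+ q' * Z false z = 0.
  exact: (X_Zm0 hp HA Frl FrE).
have YZ1 q' z : (p <= q' + (p.-1 - nt))%N -> Y ^+ q' * Z true z = 0.
  exact: (Y_Zm1 hp HA Frl FrE).
have YZ0 q' z : (p <= q' + n)%N -> Y ^+ q' * Z false z = 0.
  exact: (Y_Zm0 hp HA Frl FrE).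
have Zi z : Z true z = 0 -> z = 0 by exact: (Zm1_inj hp HA Frl FrE ntp ant hs).
have nNo : ~~ only -> (n < p.-1 - nt)%N.
  by rewrite negb_or => /andP [_ /(dt_nN D)].
exists Z, (idx p n nt only); split.
- by move=> b z cb; rewrite (Zmap_Zm D).
- by rewrite (B1_Zm D).
- exact: (idx_uniq ntp nNo).
- move=> [b t]; rewrite (mem_idx ntp nNo) /good /= (dt_nn D) (dt_nt D) /only.
  have leL (m : nat) : (- m%:Z <= t) = (- (m%:R : rat) <= t%:~R).
    by rewrite -[m%:R]/((m%:Z)%:~R) -rmorphN ler_int.
  have leR (m : nat) : (t <= m%:Z) = (t%:~R <= (m%:R : rat)).
    by rewrite -[m%:R]/((m%:Z)%:~R) ler_int.
  case: b => /=; rewrite ?implybT /= leL leR //.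
  by case: (e); case: (condE p aj).
- exact: Zl.
- exact: ZX.
- exact: ZY.
- by move=> c; apply: (idx_free hp HA ntp ant Zl Zw Z1 Z0 lg XZ1 XZ0 YZ1 Zi nNo).
- move=> W M sW WX WY; split; first exact: (spanM_submod).
  split; first exact: spanM_Vz.
  move=> m v mM sv; split.
    exact: (spanM_hX hp HA ntp ant Zl Zw Z1 Z0 lg XZ1 XZ0 YZ1 YZ0 ZX nNo sW WX mM sv).
  exact: (spanM_hY hp HA ntp ant Zl Zw Z1 Z0 lg XZ1 XZ0 YZ1 YZ0 ZY nNo sW WY mM sv).
- rewrite (mem_idx ntp nNo) /only; apply/andP; split; last by case: (e); apply/andP; split; lia.
  by case: (e) cE => //=; case: condE => // /(_ isT).
- case=> [|eb]; last first.
    have -> : e = false by case: (e) eb => // /(_ isT).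
    by exists 1; split; [exact: Ur_1 | move=> z; rewrite mul1r].
  case: (e) cE => [_ _|cE _].
    by exists 1; split; [exact: Ur_1 | move=> z; rewrite mul1r].
  have nN : (n < p.-1 - nt)%N by apply: (dt_nN D); apply/negP => /cE.
  (* [YX] minus the eigenvalue, divided by beta, sends Z^(0)(z) to Z^(1)(z). *)
  exists (lk.[g]^-1 *: (Y * X + (- g) *: 1)); split.
    have p1 : (1 <= p ^ 1 - 1)%N by rewrite expn1 subn_gt0 prime_gt1.
    apply/Ur_Z/Ur_D; last exact/Ur_Z/Ur_1.
    by apply: Ur_M; [exact: Ur_Y | exact: Ur_X].
  move=> z; rewrite -scalerAl mulrDl -mulrA (Z0 nN z) -scalerAl mul1r scaleNr addrAC subrr add0r.
  by rewrite scalerA mulVf // scale1r.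
Qed.
End Layer.

(** * Induction over the digits *)

Section ListBasis.
Variables (k : fieldType) (p : nat).
Hypothesis hp : p \in [pchar k].
Let pP : prime p := pcharf_prime hp.
Let p0 : (0 < p)%N := prime_gt0 pP.
Local Notation U := (hyper k).
Let HA : hyper_axioms (hX k) (hY k) (@hE k) := hyper_is_hyper k.
Local Notation X := (hX k 1).
Local Notation ut := (@u_pow k U (hX k) (hY k)).
Implicit Types (es : seq bool) (ajs : seq (int * rat)) (xs : seq (bool * int)).

(** The recursion of [Bvec] started at the empty list with 1, which is legitimate since Z(1) is the
    element B; the induction can thus start at zero digits. *)
Fixpoint Bv es ajs : U :=
  match es, ajs with
  | e :: es', aj :: ajs' => Zmap p e (Bv es' ajs') aj
  | _, _ => 1
  end.

(** The basis vectors in nested form, each power of X or Y standing directly outside its own Z;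
    [Tv_zip] compares this with the product form. *)
Fixpoint Tv xs ajs : U :=
  match xs, ajs with
  | x :: xs', aj :: ajs' => ut x.2 * Zmap p x.1 (Tv xs' ajs') aj
  | _, _ => 1
  end.

Fixpoint goods es ajs xs : bool :=
  match es, ajs, xs with
  | e :: es', aj :: ajs', x :: xs' => good p e aj x && goods es' ajs' xs'
  | [::], [::], [::] => true
  | _, _, _ => false
  end.

Fixpoint valid es ajs : bool :=
  match es, ajs with
  | e :: es', aj :: ajs' => [&& PZ p aj, condE p aj ==> e & valid es' ajs']
  | [::], [::] => true
  | _, _ => false
  end.

Lemma Bvec_Bv es ajs : valid es ajs -> (0 < size es)%N -> Bvec k p es ajs = Bv es ajs.
Proof.
elim: es ajs => [|e es IHes] [|aj ajs] //= /and3P [pz /implyP cE ve] _.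
case: es ajs IHes ve => [|e' es] [|aj' ajs] // IHes ve; last by rewrite IHes.
by have [Z [I L]] := layerP hp pz cE; rewrite (ly_Z L _ cE) (ly_B1 L).
Qed.

Lemma ut_Ur t : Ur k p 1 (ut t).
Proof.
have p1 : (1 <= p ^ 1 - 1)%N by rewrite expn1 subn_gt0 prime_gt1.
rewrite /u_pow; case: ifP => _; elim: (absz t) => [|n IHn]; rewrite ?expr0; try exact: Ur_1.
  by rewrite exprS; apply: Ur_M IHn; apply: Ur_X.
by rewrite exprS; apply: Ur_M IHn; apply: Ur_Y.
Qed.

Lemma Ur_widen r s z : (r <= s)%N -> Ur k p r z -> Ur k p s z.
Proof.
move=> rs; have le n : (n <= p ^ r - 1)%N -> (n <= p ^ s - 1)%N.
  by move/leq_trans; apply; apply: leq_sub2r; rewrite leq_pexp2l.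
elim=> {z} [n /le|n /le||x y _ Hx _ Hy|c x _ Hx|x y _ Hx _ Hy].
- exact: Ur_X.
- exact: Ur_Y.
- exact: Ur_1.
- exact: Ur_D.
- exact: Ur_Z.
- exact: Ur_M.
Qed.

(** On generators replace [X^(n)], [Y^(n)] by [X^(np)], [Y^(np)], which Z intertwines; sums and
    products follow. *)
Lemma Ur_lift e aj Z I r z : layer p e aj Z I -> Ur k p r z ->
  exists z', Ur k p r.+1 z' /\ forall b w, Z b (z * w) = z' * Z b w.
Proof.
move=> L; have le n : (n <= p ^ r - 1)%N -> (n * p <= p ^ r.+1 - 1)%N.
  move=> np; rewrite -ltnS subn1 prednK ?expn_gt0 ?p0 // expnSr ltn_pmul2r //.
  by rewrite -[X in (_ < X)%N](@subnK 1) ?expn_gt0 ?p0 // addn1.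
elim=> {z} [n /le nr|n /le nr||x y _ [x' [ux xE]] _ [y' [uy yE]]|c x _ [x' [ux xE]]|
  x y _ [x' [ux xE]] _ [y' [uy yE]]].
- by exists (hX k (n * p)); split=> [|b w]; [exact: Ur_X | rewrite (ly_X L)].
- by exists (hY k (n * p)); split=> [|b w]; [exact: Ur_Y | rewrite (ly_Y L)].
- by exists 1; split=> [|b w]; [exact: Ur_1 | rewrite !mul1r].
- exists (x' + y'); split=> [|b w]; first exact: Ur_D.
  have := ly_lin L b 1 (x * w) (y * w).
  by rewrite !scale1r mulrDl mulrDl xE yE => ->.
- exists (c *: x'); split=> [|b w]; first exact: Ur_Z.
  have := ly_lin L b c (x * w) 0; rewrite -scalerAl addr0 => ->.
  have := ly_lin L b (-1) 0 0; rewrite scaler0 addr0 scaleN1r addNr => ->.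
  by rewrite addr0 xE -scalerAl.
- exists (x' * y'); split=> [|b w]; first exact: Ur_M.
  by rewrite -mulrA xE yE mulrA.
Qed.

Definition spanT (I : seq (seq (bool * int))) ajs (v : U) :=
  exists c : seq (bool * int) -> k, v = \sum_(xs <- I) c xs *: Tv xs ajs.

Lemma list_basis es ajs : valid es ajs -> exists I : seq (seq (bool * int)),
  [/\ uniq I, forall xs, (xs \in I) = goods es ajs xs,
    forall c : seq (bool * int) -> k, \sum_(xs <- I) c xs *: Tv xs ajs = 0 ->
      forall xs, xs \in I -> c xs = 0,
    submod (spanT I ajs) /\ spanT I ajs (Bv es ajs) /\
      forall m v, (m < p ^ size es)%N -> spanT I ajs v ->
        spanT I ajs (hX k m * v) /\ spanT I ajs (hY k m * v) &
    forall xs, xs \in I -> exists z, Ur k p (size es) z /\ Tv xs ajs = z * Bv es ajs].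
Proof.
elim: es ajs => [|e es IHes] [|aj ajs] //=.
  move=> _; exists [:: [::]]; split=> //.
  - by move=> xs; rewrite inE; case: xs.
  - move=> c; rewrite big_seq1 /= => /eqP; rewrite scaler_eq0 oner_eq0 orbF => /eqP c0 xs.
    by rewrite inE => /eqP ->.
  - split.
      split; first by exists (fun=> 0); rewrite big_seq1 scale0r.
      move=> c u v [d ->] [d' ->]; exists (fun xs => c * d xs + d' xs).
      by rewrite !big_seq1 scalerDl scalerA.
    split; first by exists (fun=> 1); rewrite big_seq1 scale1r.
    move=> m v; rewrite ltnS leqn0 => /eqP -> sv.
    by rewrite (hax_X0 HA) (hax_Y0 HA) mul1r.
  - by move=> xs; rewrite inE => /eqP -> /=; exists 1; split; [exact: Ur_1 | rewrite mul1r].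
case/and3P => pz /implyP cE /IHes [I [uI mI fI [sI [BI cI]] gI]].
have [Z [I1 L]] := layerP hp pz cE.
have ZE x w : x \in I1 -> Zmap p x.1 w aj = Z x.1 w.
  by rewrite (ly_mem L) => /and4P [_ /implyP cx _ _]; apply: (ly_Z L).
have Zsum b (c : seq (bool * int) -> k) :
    Z b (\sum_(xs <- I) c xs *: Tv xs ajs) = \sum_(xs <- I) c xs *: Z b (Tv xs ajs).
  have lb := ly_lin L b; have Z0 : Z b 0 = 0.
    by have := lb (-1) 0 0; rewrite scaler0 addr0 scaleN1r addNr.
  by elim: (I) => [|y s IHs]; rewrite ?big_nil // !big_cons lb IHs.
set J := [seq x :: xs | x <- I1, xs <- I].
have sumE (c : seq (bool * int) -> k) : \sum_(ys <- J) c ys *: Tv ys (aj :: ajs) =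
    \sum_(x <- I1) ut x.2 * Z x.1 (\sum_(xs <- I) c (x :: xs) *: Tv xs ajs).
  rewrite big_allpairs_dep big_seq [RHS]big_seq; apply: eq_bigr => x xI.
  rewrite Zsum mulr_sumr; apply: eq_bigr => xs _ /=.
  by rewrite ZE // scalerAr.
(* Scalar combinations over the product index set are the same as combinations over the first index
   with coefficients in the span for the tail. *)
have spE v : spanT J (aj :: ajs) v <-> spanW Z I1 (spanT I ajs) v.
  split=> [[c ->]|[d [/choice [c cE'] ->]]].
    exists (fun x => \sum_(xs <- I) c (x :: xs) *: Tv xs ajs); rewrite sumE; split=> // x.
    by exists (fun xs => c (x :: xs)).
  exists (fun ys => if ys is x :: xs then c x xs else 0); rewrite sumE.
  by apply: eq_bigr => x _; rewrite cE'.
have [sW [WZ WX]] := ly_span L sI (fun m w mM sw => (cI m w mM sw).1)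
   (fun m w mM sw => (cI m w mM sw).2).
exists J; split.
- by apply: (allpairs_uniq (ly_uniq L) uI) => -[x xs] [y ys] _ _ /= [-> ->].
- case=> [|x xs] /=.
    by apply/allpairsP => -[[y ys] [_ _]].
  rewrite -(ly_mem L) -mI; apply/allpairsP/andP => [[[y ys] /= [yI ysI [-> ->]]] //|[xI xsI]].
  by exists (x, xs).
- move=> c; rewrite sumE => /(ly_free L) H [|x xs] /allpairsP [[y ys] /= [yI ysI]] // [-> ->].
  exact: (fI _ (H y yI) ys ysI).
- split.
    split=> [|c u v]; first by apply/spE; case: sW.
    by rewrite !spE; case: sW => _; apply.
  split.
    apply/spE; have := WZ _ _ (ly_0 L) BI; rewrite /u_pow lexx /= mul1r.
    by rewrite (ly_Z L).
  move=> m v; rewrite expnSr => mM; rewrite !spE; exact: WX.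
- move=> [|x xs] /allpairsP [[y ys] /= [yI ysI]] // [-> ->] {x xs}.
  have [z [uz ->]] := gI ys ysI; rewrite ZE //.
  have [z' [uz' zE]] := Ur_lift L uz.
  have [g [ug gE]] : exists g, Ur k p 1 g /\ forall w, Z y.1 w = g * Z e w.
    by apply: (ly_gen L); move: yI; rewrite (ly_mem L) => /and4P [/implyP].
  exists (ut y.2 * (z' * g)); split.
    apply: Ur_M; first exact: (Ur_widen _ (ut_Ur _)).
    by apply: Ur_M => //; exact: (Ur_widen _ ug).
  by rewrite zE gE (ly_Z L _ cE) !mulrA.
Qed.
End ListBasis.

Local Open Scope classical_set_scope.

(** * From independent families to basis sets *)

Section Family.
Variables (k : fieldType) (V : lmodType k) (J : eqType) (I : seq J) (F : J -> V).
Hypothesis I_uniq : uniq I.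
Hypothesis F_free : forall c : J -> k, \sum_(x <- I) c x *: F x = 0 ->
  forall x, x \in I -> c x = 0.

(** Two equal members would give the nontrivial relation with coefficients 1 and -1. Hence passing
    from the family to its set of values loses nothing. *)
Lemma free_inj : {in I &, injective F}.
Proof.
move=> x y xI yI xy; apply/eqP/negPn/negP => nxy.
pose c z : k := (z == x)%:R - (z == y)%:R.
have delta z : z \in I -> \sum_(w <- I) (w == z)%:R *: F w = F z.
  move=> zI; rewrite (bigD1_seq z) //= eqxx scale1r big1 ?addr0 // => w /negbTE ->.
  by rewrite scale0r.
have := F_free (c := c); rewrite (eq_bigr (fun w => (w == x)%:R *: F w - (w == y)%:R *: F w)); last first.
  by move=> w _; rewrite scalerBl.
rewrite sumrB !delta // xy subrr => /(_ erefl x xI) /eqP.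
by rewrite /c eqxx (negbTE nxy) subr0 oner_eq0.
Qed.

Lemma family_basis (M : set V) :
    (forall v, M v <-> exists c : J -> k, v = \sum_(x <- I) c x *: F x) ->
  is_basis M [set F x | x in [set x | x \in I]].
Proof.
move=> ME; have uF : uniq (map F I) by rewrite map_inj_in_uniq //; exact: free_inj.
have memF x : x \in I -> index (F x) (map F I) = index x I.
  move=> xI; rewrite -[x in LHS](nth_index x xI) -(nth_map x (F x)) ?index_mem //.
  by rewrite index_uniq ?size_map ?index_mem.
split.
  rewrite eqEsubset; split=> v.
    case=> s [c [sS ->]]; apply/ME.
    elim: s sS => [|y s IHs] sS.
      by exists (fun=> 0); rewrite big_nil big1 // => x _; rewrite scale0r.
    have [|d dE] := IHs; first by move=> x xs; apply: sS; rewrite inE xs orbT.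
    have [x xI <-] := sS y (mem_head y s); rewrite big_cons dE.
    exists (fun z => (if z == x then c (F x) else 0) + d z).
    rewrite [RHS](eq_bigr (fun z => (if z == x then c (F x) else 0) *: F z + d z *: F z)); last first.
      by move=> z _; rewrite scalerDl.
    rewrite big_split /=; congr (_ + _).
    by rewrite (bigD1_seq x) //= eqxx big1 ?addr0 // => z /negbTE ->; rewrite scale0r.
  move/ME => [c ->]; case: (I =P [::]) => [I0|].
    by exists [::], (fun=> 0); rewrite I0 !big_nil.
  case EI: I => [//|x0 I'] _; rewrite -EI.
  exists (map F I), (fun v => c (nth x0 I (index v (map F I)))); split.
    by move=> _ /mapP [x xI ->]; exists x.
  rewrite big_map [LHS]big_seq [RHS]big_seq; apply: eq_bigr => x xI.
  by rewrite memF // nth_index.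
move=> s c us sS s0 v vs; have [x xI xv] := sS v vs.
have := F_free (c := fun x => if F x \in s then c (F x) else 0).
rewrite (_ : \sum_(x <- I) _ = 0); last first.
  rewrite -[RHS]s0 -(big_map F xpredT (fun y => (if y \in s then c y else 0) *: y)).
  rewrite (eq_bigr (fun y => if y \in s then c y *: y else 0)); last first.
    by move=> y _; case: ifP => // _; rewrite scale0r.
  rewrite -big_mkcond -big_filter; apply: perm_big; apply: uniq_perm => //.
    exact: filter_uniq.
  move=> y; rewrite mem_filter; case: (boolP (y \in s)) => //= ys.
  by have [z zI <-] := sS y ys; rewrite map_f.
by move=> /(_ erefl x xI); rewrite xv vs.
Qed.
End Family.

(** * Comparison with the tuple-indexed vectors and conclusion *)

Section Tuples.
Variables (k : fieldType) (p : nat).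
Hypothesis hp : p \in [pchar k].
Implicit Types (es : seq bool) (ajs : seq (int * rat)) (xs : seq (bool * int)).
Let aj0 : int * rat := (0, 0).

Lemma u_elt_Z e aj Z I (b : bool) i t w : layer p e aj Z I ->
  u_elt k p i.+1 t * Z b w = Z b (u_elt k p i t * w).
Proof.
move=> L; rewrite /u_elt; case: ifP => _; elim: (absz t) => [|n IHn]; rewrite ?expr0 ?mul1r //.
  by rewrite !exprS -!mulrA IHn expnSr (ly_X L).
by rewrite !exprS -!mulrA IHn expnSr (ly_Y L).
Qed.

(** Pulling u^(i,t) out of one Z raises [i] by one ([u_elt_Z]), so the nested powers come out as the
    product u^(0,t_0) u^(1,t_1) ... in front. *)
Lemma Tv_zip es ajs (ts : seq int) : valid p es ajs -> size ts = size es ->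
  Tv k p (zip es ts) ajs = (\prod_(i < size ts) u_elt k p i (nth 0 ts i)) * Bv k p es ajs.
Proof.
elim: es ajs ts => [|e es IHes] [|aj ajs] [|t ts] //=; first by rewrite big_ord0 mul1r.
case/and3P => pz /implyP cE ve [st]; have [Z [I L]] := layerP hp pz cE.
rewrite IHes // big_ord_recl /= !(ly_Z L _ cE) -mulrA; congr (_ * _).
move: (Bv k p es ajs); elim/big_ind2: _ => [w|x x' y y' Hx Hy w|i _ w].
- by rewrite !mul1r.
- by rewrite -!mulrA Hx Hy.
- by rewrite (u_elt_Z _ _ _ _ L).
Qed.

Lemma goodsP es ajs xs : goods p es ajs xs =
  [&& size ajs == size es, size xs == size es & all (fun i =>
     good p (nth false es i) (nth aj0 ajs i) (nth (false, 0) xs i)) (iota 0 (size es))].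
Proof.
elim: es ajs xs => [|e es IHes] [|aj ajs] [|x xs] //=; rewrite ?andbF //.
by rewrite IHes !eqSS (iotaDl 1 0) all_map /=; do !bool_congr.
Qed.

Lemma validP es ajs : valid p es ajs = (size ajs == size es) && all (fun i =>
  PZ p (nth aj0 ajs i) && (condE p (nth aj0 ajs i) ==> nth false es i)) (iota 0 (size es)).
Proof.
elim: es ajs => [|e es IHes] [|aj ajs] //=; rewrite IHes eqSS (iotaDl 1 0) all_map /=.
by do !bool_congr.
Qed.

Variable r : nat.
Lemma valid_tuple (ajs : r.-tuple (int * rat)) (e : r.-tuple bool) :
  (forall i, PZ p (tnth ajs i)) -> Yr p ajs e -> valid p e ajs.
Proof.
move=> hajs /forallP he; rewrite validP !size_tuple eqxx; apply/allP => i.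
rewrite mem_iota add0n => ir; have := he (Ordinal ir); have := hajs (Ordinal ir).
by rewrite !(tnth_nth aj0) (tnth_nth false) => -> ->.
Qed.

Lemma Bhat_goods (ajs : r.-tuple (int * rat)) (e : r.-tuple bool) : (0 < r)%N ->
  (forall i, PZ p (tnth ajs i)) -> Yr p ajs e ->
  Bhat k p ajs e = [set Tv k p xs ajs | xs in [set xs | goods p e ajs xs]].
Proof.
move=> r0 hajs he.
have BtE (th : r.-tuple bool) (t : r.-tuple int) : Yr p ajs th ->
    Bt k p th ajs t = Tv k p (zip th t) ajs.
  move=> hth; have v := valid_tuple hajs hth.
  rewrite Tv_zip ?size_tuple // /Bt (Bvec_Bv hp v) ?size_tuple //; congr (_ * _).
  by apply: eq_bigr => i _; rewrite (tnth_nth 0).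
have goodE (th : r.-tuple bool) (t : r.-tuple int) :
    goods p e ajs (zip th t) <-> Theta p ajs e (th, t).
  rewrite goodsP size_zip !size_tuple minnn eqxx /=.
  split=> [/allP H|[/forallP H1 /forallP H2 H3]].
    have G (i : 'I_r) : good p (tnth e i) (tnth ajs i) (tnth th i, tnth t i).
      have := H i; rewrite mem_iota ltn_ord => /(_ isT).
      by rewrite nth_zip ?size_tuple // !(tnth_nth false) (tnth_nth aj0) (tnth_nth 0).
    split; [apply/forallP|apply/forallP|] => i; have /and4P [] := G i => //.
  apply/allP => i; rewrite mem_iota add0n => ir; rewrite nth_zip ?size_tuple //.
  have := H1 (Ordinal ir); have := H2 (Ordinal ir); have [] := H3 (Ordinal ir).
  rewrite !(tnth_nth false) !(tnth_nth aj0) !(tnth_nth 0) /good /=.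
  by move=> -> -> -> ->.
rewrite eqEsubset; split=> v [].
  move=> [th t] Th <-; exists (zip th t); first exact/goodE.
  by rewrite -BtE //; case: Th.
move=> xs gx <-; have sx : size xs = r.
  by move: gx; rewrite /= goodsP !size_tuple => /and3P [_ /eqP].
have s1 : size (unzip1 xs) == r by rewrite size_map sx.
have s2 : size (unzip2 xs) == r by rewrite size_map sx.
have xE : xs = zip (Tuple s1) (Tuple s2) by rewrite /= zip_unzip.
have Th : Theta p ajs e (Tuple s1, Tuple s2) by apply/goodE; rewrite -xE.
by exists (Tuple s1, Tuple s2) => //; rewrite BtE -?xE //; case: Th.
Qed.
End Tuples.

Theorem theorem5p1 (k : closedFieldType) (p : nat) (hp : p \in [pchar k])
    (r : nat) (hr : (0 < r)%N)
    (ajs : r.-tuple (int * rat)) (hajs : forall i : 'I_r, PZ p (tnth ajs i))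
    (eps : r.-tuple bool) (heps : Yr p ajs eps) :
  is_basis [set z * Bvec k p eps ajs | z in Ur k p r]
           (Bhat k p ajs eps).
Proof.
have v := valid_tuple hajs heps.
have [I [uI mI fI [[s0 sl] [sB sX]] gI]] := list_basis hp v.
rewrite (Bhat_goods hp) // (Bvec_Bv hp v) ?size_tuple // in gI sX *.
rewrite (_ : [set xs | goods p eps ajs xs] = [set xs | xs \in I]); last first.
  by apply/seteqP; split=> xs; rewrite /= mI.
apply: family_basis => // w; split.
  (* The span contains the generator and is stable under the generators of U_r, hence contains the
     whole module. *)
  case=> z uz <-; change (spanT p I ajs (z * Bv k p eps ajs)).
  have H u : Ur k p r u -> forall x, spanT p I ajs x -> spanT p I ajs (u * x).
    have le n : (n <= p ^ r - 1)%N -> (n < p ^ r)%N.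
      by move=> np; rewrite -(prednK (_ : 0 < p ^ r)%N) ?ltnS -?subn1 // expn_gt0 prime_gt0 // (pcharf_prime hp).
    elim=> {u} [n /le nr|n /le nr||x y _ Hx _ Hy|c x _ Hx|x y _ Hx _ Hy] w' sw.
    - exact: (sX n w' nr sw).1.
    - exact: (sX n w' nr sw).2.
    - by rewrite mul1r.
    - by rewrite mulrDl -[_ * _]scale1r; apply: sl; [apply: Hx | apply: Hy].
    - by rewrite -scalerAl -[_ *: _]addr0; apply: sl => //; apply: Hx.
    - by rewrite -mulrA; apply/Hx/Hy.
  exact: H.
(* Conversely each basis vector is a U_r-multiple of the generator, and such multiples are closed
   under linear combinations. *)
case=> c ->; rewrite big_seq; elim/big_ind: _ => [|x y [z uz <-] [z' uz' <-]|xs xsI].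
- by exists 0; rewrite ?mul0r // -(scale0r 1); apply/Ur_Z/Ur_1.
- by exists (z + z'); [exact: Ur_D | rewrite mulrDl].
- have [z [uz ->]] := gI xs xsI; exists (c xs *: z); first exact: Ur_Z.
  by rewrite -scalerAl.
Qed.
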